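(* Assume that $X_1$ is of Pareto-type with index $\alpha\in(1,2)$ (including $\alpha=1$ if $\mu_1<\infty$), i.e. $1-F(x)\sim x^{-\alpha}\ell(x)$ as $x\to\infty$ with $\ell$ slowly varying. Let the counting process $\{N(t);\,t\geq 0\}$ $\mathcal{D}$-average in time to the random variable $\Lambda$. Let $(a_t)_{t>0}$ be defined by $\lim_{t\to\infty}t\,a_t^{-\alpha}\ell(a_t)=1$. (a) Then $$\left(\frac{N(t)}{a_t}\right)^2T_{N(t)}\stackrel{\mathcal{D}}{\longrightarrow}\frac{1}{\mu_1^2}\,U_\alpha\quad\text{as } t\rightarrow\infty,$$ where the random variable $U_\alpha$ has the Laplace transform $\mathbb{E}\{e^{-rU_\alpha}\}=\mathbb{E}\{e^{-r^{\alpha/2}\Gamma(1-\alpha/2)\,\Lambda}\}$ for $r\geq 0$. (b) Then $$\left(\frac{t}{a_t}\right)^2T_{N(t)}\stackrel{\mathcal{D}}{\longrightarrow}\frac{1}{\mu_1^2}\,\frac{U_\alpha}{\Lambda^2}\quad\text{as } t\rightarrow\infty,$$ where the random vector $(U_\alpha,\mu_1\Lambda)^\prime$ has the Laplace transform $$\mathbb{E}\left\{e^{-rU_\alpha-s\mu_1\Lambda}\right\}=\mathbb{E}\left\{e^{-r^{\alpha/2}\Gamma(1-\alpha/2)\,\Lambda}\right\},\quad r>0,\ s\geq 0.$$ In particular, $U_\alpha$ has the Laplace transform $\mathbb{E}\{e^{-rU_\alpha}\}=\mathbb{E}\{e^{-r^{\alpha/2}\Gamma(1-\alpha/2)\,\Lambda}\}$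 for $r\geq 0$.
   Context: $\{X_1,X_2,\ldots\}$ is a sequence of i.i.d. positive random variables with distribution function $F$, and $\{N(t);\,t\geq 0\}$ is a counting process (nonnegative integer-valued, nondecreasing in $t$) independent of the $X_i$'s. For fixed $t\ge 0$, $$T_{N(t)}:=\frac{X_1^2+\cdots+X_{N(t)}^2}{(X_1+\cdots+X_{N(t)})^2}$$ if $N(t)\geq 1$, and $T_{N(t)}:=0$ otherwise. $\mu_\beta:=\mathbb{E}X_1^\beta\le\infty$ for $\beta>0$. $X_1$ (or $F$) is of Pareto-type with index $\alpha>0$ if $1-F(x)\sim x^{-\alpha}\ell(x)$ as $x\to\infty$ for a slowly varying function $\ell$. The counting process $\mathcal{D}$-averages in time to the random variable $\Lambda$ if $N(t)/t\stackrel{\mathcal{D}}{\longrightarrow}\Lambda$ as $t\to\infty$, where $\mathbb{P}[\Lambda>0]=1$. $\stackrel{\mathcal{D}}{\longrightarrow}$ denotes convergence in distribution and $\Gamma$ is the gamma function.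
   Formalization: In (b) the right side of the joint Laplace transform is corrected to E{exp(-r^{α/2}Γ(1-α/2)Λ - sμ_1Λ)}, since the printed one does not depend on s and is impossible; a_t→∞ is assumed explicitly, as the defining limit alone allows spurious solutions. *)

(* Defs.v *)
From HB Require Import structures.
From mathcomp Require Import all_boot all_order all_algebra finmap.
From mathcomp Require Import all_classical all_reals all_analysis.

Set Implicit Arguments.
Unset Strict Implicit.
Unset Printing Implicit Defensive.

Import Order.TTheory GRing.Theory Num.Theory.
Import numFieldNormedType.Exports.

Local Open Scope classical_set_scope.
Local Open Scope ring_scope.

Definition Gamma (R : realType) (a : R) : R :=
  \int[lebesgue_measure]_(x in `]0, +oo[) (x `^ (a - 1) * expR (- x)).

(* Only the behaviour at infinity matters: [l] may take any values, and need
   not be measurable, away from a neighbourhood of +oo. *)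
Definition slowly_varying (R : realType) (l : R -> R) : Prop :=
  (exists A : R,
     measurable_fun `[A, +oo[ l /\ (forall x, A <= x -> 0 < l x)) /\
  (forall c : R, 0 < c -> l (c * x) / l x @[x --> +oo] --> (1 : R)).

Definition pareto_type (R : realType) (F : R -> R) (alpha : R) (l : R -> R) :
    Prop :=
  slowly_varying l /\
  (1 - F x) / (x `^ (- alpha) * l x) @[x --> +oo] --> (1 : R).

(* Product rule over every finite subfamily. *)
Definition mutually_independent d d' (T : measurableType d)
    (T' : measurableType d') (R : realType) (P : probability T R)
    (I : choiceType) (X : I -> {RV P >-> T'}) : Prop :=
  forall (J : {fset I}) (B : I -> set T'), (forall i, measurable (B i)) ->
    P (\bigcap_(i in [set` J]) X i @^-1` B i) =
    (\prod_(i <- J) P (X i @^-1` B i))%E.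

(* The sigma-algebra on the sample space generated by (X i), i in D. *)
Definition sigma_generated d d' (T : measurableType d) (T' : measurableType d')
    (I : Type) (D : set I) (X : I -> T -> T') : set (set T) :=
  <<s [set A | exists i B, [/\ D i, measurable B & A = X i @^-1` B]] >>.

Definition independent_families d d1 d2 (T : measurableType d)
    (T1 : measurableType d1) (T2 : measurableType d2) (R : realType)
    (P : probability T R) (I1 I2 : Type) (D1 : set I1) (D2 : set I2)
    (X : I1 -> {RV P >-> T1}) (Y : I2 -> {RV P >-> T2}) : Prop :=
  forall A B, sigma_generated D1 X A -> sigma_generated D2 Y B ->
    P (A `&` B) = (P A * P B)%E.

(* The values of [N] at negative times are irrelevant. *)
Definition counting_process d (T : measurableType d) (R : realType)
    (P : probability T R) (N : R -> {RV P >-> nat}) : Prop :=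
  forall w s t, 0 <= s -> s <= t -> (N s w <= N t w)%N.

(* Convergence of the distribution functions at every continuity point of the
   limiting one; the limit may live on another probability space. *)
Definition cvg_in_distribution d d' (T : measurableType d)
    (T' : measurableType d') (R : realType) (P : probability T R)
    (P' : probability T' R) (Y : R -> T -> R) (Z : T' -> R) : Prop :=
  forall x : R, {for x, continuous (fun y : R => P' [set w | Z w <= y])} ->
    P [set w | Y t w <= x] @[t --> +oo] --> P' [set w | Z w <= x].

Definition D_averages_in_time d d' (T : measurableType d)
    (T' : measurableType d') (R : realType) (P : probability T R)
    (P' : probability T' R) (N : R -> {RV P >-> nat})
    (Lambda : {RV P' >-> R}) : Prop :=
  P' [set w | 0 < Lambda w] = 1%E /\
  cvg_in_distribution P P' (fun t w => (N t w)%:R / t) Lambda.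

(* T_n, with X_(i+1) written [X i]. *)
Definition sq_ratio d (T : measurableType d) (R : realType)
    (P : probability T R) (X : nat -> {RV P >-> R}) (n : nat) (w : T) : R :=
  if n is 0%N then 0
  else (\sum_(i < n) X i w ^+ 2) / (\sum_(i < n) X i w) ^+ 2.

(* Main.v *)
Require Import Defs.
From HB Require Import structures.
From mathcomp Require Import all_boot all_order all_algebra finmap.
From mathcomp Require Import all_classical all_reals all_analysis.
From mathcomp Require Import measurable_realfun ring lra.

Set Implicit Arguments.
Unset Strict Implicit.
Unset Printing Implicit Defensive.

Import Order.TTheory GRing.Theory Num.Theory.
Import numFieldNormedType.Exports.

Local Open Scope classical_set_scope.
Local Open Scope ring_scope.

(** For Pareto-type [X i] the Laplace transform [phi] of [X 0 ^ 2] satisfies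
    [t * (1 - phi (s / a t ^ 2)) --> c * s ^ (alpha / 2)], so the normalised sums
    of squares behave like a positive stable variable of index [alpha / 2],
    whereas [S_n / n --> mu1] in probability by the weak law. Conditioning on
    [N t], independent of the [X i], turns the Laplace transform of the sum of
    squares into [phi (s / a t ^ 2) ^ N t], a function of [N t / t], whose mean
    is evaluated in the limit by a Helly-Bray argument. Both parts are the
    instances [p = 0] and [p = - 2] of one convergence, that of
    [(N t / t) ^ p * (X_1 ^ 2 + ... + X_(N t) ^ 2) / a t ^ 2], divided by the
    square of [S_(N t) / N t]. The limit is realised on a product space as
    [U = W * Lambda ^ (2 / alpha)], with [W] stable and independent of
    [Lambda]. *)

(** * Means of bounded random variables *)

(** Laplace transforms handle laws on the nonnegative half-line only, whereas the [X i] and [Lambda]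
    are positive merely almost surely; hence sums of [|X i|] and the positive part of [Lambda] are
    used until the last step. Since alpha < 2, squares have no mean, so the weak law and the stable
    limit come from transforms, not second moments. The constant arises from t (1 - phi (s / a_t^2))
    = int_0^oo e^(-x) t H (a_t sqrt (x / s)) dx, with H the tail of X: the integrand tends to e^(-x)
    (x / s)^(-alpha / 2), and int_0^oo e^(-x) x^(-alpha / 2) dx is Gamma (1 - alpha / 2). Two
    uniformities carry the rest. The distance from phi^n to exp (- n (1 - phi)) is at most 2 (1 -
    phi) for every n, which admits a random exponent; and scaling x by a factor near 1 changes
    e^(-x) little, uniformly in x >= 0, so the random divisor may be replaced by its limit with no
    tightness of the numerator. Positivity of [Lambda] sends [N t] to infinity, as the weak law at a
    random index requires. The existence of U is part of the claim, so the stable law is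
    constructed, by compactness, from the sums with deterministic index. *)

Definition bounded_measurable d (T : measurableType d) (R : realType)
    (f : T -> R) : Prop :=
  measurable_fun setT f /\ exists M : R, forall w, `|f w| <= M.

Section bounded_mean.
Context d (T : measurableType d) (R : realType) (P : probability T R).
Implicit Types (f g h : T -> R) (A B : set T).
Local Notation bm := bounded_measurable.

Lemma bounded_measurable_integrable f :
  bm f -> P.-integrable setT (EFin \o f).
Proof.
move=> [mf [M fM]]; apply: measurable_bounded_integrable => //.
  by rewrite -[ltLHS]/(P setT) probability_setT ltry.
exists M; split; first by rewrite num_real.
by move=> x Mx t _ /=; rewrite (le_trans (fM t))// ltW.
Qed.

Lemma bounded_measurable_cst (r : R) : bm (fun _ : T => r).
Proof. by split; [exact: measurable_cst | exists `|r|]. Qed.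

Lemma bounded_measurableD f g : bm f -> bm g -> bm (fun w => f w + g w).
Proof.
move=> [mf [M fM]] [mg [M' gM]]; split; first exact: measurable_funD.
by exists (M + M') => w; rewrite (le_trans (ler_normD _ _))// lerD.
Qed.

Lemma bounded_measurableN f : bm f -> bm (fun w => - f w).
Proof.
move=> [mf [M fM]]; split; last by exists M => w; rewrite normrN.
exact: measurableT_comp.
Qed.

Lemma bounded_measurableB f g : bm f -> bm g -> bm (fun w => f w - g w).
Proof. by move=> bf bg; apply/bounded_measurableD/bounded_measurableN. Qed.

Lemma bounded_measurableM f g : bm f -> bm g -> bm (fun w => f w * g w).
Proof.
move=> [mf [M fM]] [mg [M' gM]]; split; first exact: measurable_funM.
by exists (M * M') => w; rewrite normrM ler_pM.
Qed.

Lemma bounded_measurable_norm f : bm f -> bm (fun w => `|f w|).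
Proof.
move=> [mf [M fM]]; split; last by exists M => w; rewrite normr_id.
exact: measurableT_comp.
Qed.

Lemma bounded_measurable_indic A : measurable A -> bm (\1_A : T -> R).
Proof.
move=> mA; split; first exact: measurable_indic.
by exists 1 => w; rewrite indicE normr_nat lern1 leq_b1.
Qed.

Lemma bounded_measurable_sum (I : Type) (s : seq I) (f : I -> T -> R) :
  (forall i, bm (f i)) -> bm (fun w => \sum_(i <- s) f i w).
Proof.
move=> bf; elim: s => [|i s IH].
  under eq_fun do rewrite big_nil.
  exact: bounded_measurable_cst.
under eq_fun do rewrite big_cons.
exact: bounded_measurableD.
Qed.

Lemma bounded_measurable_prod (I : Type) (s : seq I) (f : I -> T -> R) :
  (forall i, bm (f i)) -> bm (fun w => \prod_(i <- s) f i w).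
Proof.
move=> bf; elim: s => [|i s IH].
  under eq_fun do rewrite big_nil.
  exact: bounded_measurable_cst.
under eq_fun do rewrite big_cons.
exact: bounded_measurableM.
Qed.

Lemma bounded_measurable01 f :
  measurable_fun setT f -> (forall w, 0 <= f w <= 1) -> bm f.
Proof.
move=> mf f01; split => //; exists 1 => w.
by have /andP[f0 f1] := f01 w; rewrite ger0_norm.
Qed.

Lemma mean_cst (r : R) : \int[P]_w r = r.
Proof. by rewrite Rintegral_cst// -[X in fine X]/(P setT) probability_setT mulr1. Qed.

Lemma meanD f g : bm f -> bm g ->
  \int[P]_w (f w + g w) = \int[P]_w f w + \int[P]_w g w.
Proof. by move=> ? ?; rewrite RintegralD//; exact: bounded_measurable_integrable. Qed.

Lemma meanB f g : bm f -> bm g ->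
  \int[P]_w (f w - g w) = \int[P]_w f w - \int[P]_w g w.
Proof. by move=> ? ?; rewrite RintegralB//; exact: bounded_measurable_integrable. Qed.

Lemma meanZ (r : R) f : bm f -> \int[P]_w (r * f w) = r * \int[P]_w f w.
Proof. by move=> ?; rewrite RintegralZl//; exact: bounded_measurable_integrable. Qed.

Lemma mean_sum (I : Type) (s : seq I) (f : I -> T -> R) : (forall i, bm (f i)) ->
  \int[P]_w (\sum_(i <- s) f i w) = \sum_(i <- s) \int[P]_w f i w.
Proof.
move=> bf; elim: s => [|i s IH].
  by under eq_Rintegral do rewrite big_nil; rewrite mean_cst big_nil.
under eq_Rintegral do rewrite big_cons.
by rewrite meanD// ?big_cons ?IH//; exact: bounded_measurable_sum.
Qed.

Lemma le_mean f g : bm f -> bm g -> (forall w, f w <= g w) ->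
  \int[P]_w f w <= \int[P]_w g w.
Proof.
by move=> bf bg fg; apply: le_Rintegral => //; exact: bounded_measurable_integrable.
Qed.

Lemma mean_ge0 f : (forall w, 0 <= f w) -> 0 <= \int[P]_w f w.
Proof. by move=> f0; apply: Rintegral_ge0. Qed.

Lemma mean_le1 f : bm f -> (forall w, f w <= 1) -> \int[P]_w f w <= 1.
Proof.
move=> bf f1; rewrite -[leRHS](mean_cst 1); apply: le_mean => //.
exact: bounded_measurable_cst.
Qed.

Lemma mean_indic A : measurable A -> \int[P]_w (\1_A w) = fine (P A).
Proof. by move=> mA; rewrite /Rintegral integral_indic// setIT. Qed.

Lemma mean_dist f g h : bm f -> bm g -> bm h ->
  (forall w, `|f w - g w| <= h w) ->
  `|\int[P]_w f w - \int[P]_w g w| <= \int[P]_w h w.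
Proof.
move=> bf bg bh fgh; rewrite -meanB//.
apply: le_trans (le_normr_Rintegral _ _) _ => //.
  exact/bounded_measurable_integrable/bounded_measurableB.
by apply: le_mean => //; exact/bounded_measurable_norm/bounded_measurableB.
Qed.

Lemma mean_ae_eq f g : bm f -> bm g -> {ae P, forall w, f w = g w} ->
  \int[P]_w f w = \int[P]_w g w.
Proof.
move=> [mf _] [mg _] fg; congr fine; apply: ae_eq_integral => //.
- exact/measurable_EFinP.
- exact/measurable_EFinP.
- by apply: filterS fg => w /= -> _.
Qed.

Lemma mean_EFin f : bm f -> (\int[P]_w (f w)%:E)%E = (\int[P]_w f w)%:E.
Proof.
move=> bf; rewrite fineK//; apply: integrable_fin_num => //.
exact: bounded_measurable_integrable.
Qed.

Lemma fine_prob_le1 A : measurable A -> fine (P A) <= 1.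
Proof.
move=> mA; rewrite -[leRHS]/(fine 1%E) fine_le ?fin_num_measure//.
exact: probability_le1.
Qed.

Lemma fine_prob_ge0 A : 0 <= fine (P A).
Proof. by rewrite fine_ge0. Qed.

Lemma le_fine_prob A B : measurable A -> measurable B -> A `<=` B ->
  fine (P A) <= fine (P B).
Proof.
by move=> mA mB AB; rewrite fine_le ?fin_num_measure// le_measure ?inE.
Qed.

Lemma fine_prob_setC A : measurable A -> fine (P (~` A)) = 1 - fine (P A).
Proof. by move=> mA; rewrite probability_setC// fineB// fin_num_measure. Qed.

Lemma fine_prob_setU A B : measurable A -> measurable B ->
  fine (P (A `|` B)) <= fine (P A) + fine (P B).
Proof.
move=> mA mB; rewrite -fineD ?fin_num_measure// fine_le ?fin_num_measure//.
- exact: measurableU.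
- by rewrite fin_numD !fin_num_measure.
- exact: measureU2.
Qed.

End bounded_mean.

(** * Exponential inequalities *)

Section exponential_inequalities.
Context (R : realType).
Implicit Types x y u : R.

Lemma expR_dist x y : 0 <= x -> 0 <= y -> `|expR (- x) - expR (- y)| <= `|x - y|.
Proof.
wlog xy : x y / x <= y => [h x0 y0|x0 y0].
  have [xy|/ltW yx] := leP x y; first exact: h.
  by rewrite distrC (distrC x); exact: h.
rewrite ger0_norm ?subr_ge0 ?ler_expR ?lerN2// ler0_norm ?subr_le0// opprB.
have -> : expR (- y) = expR (- x) * expR (- (y - x)).
  by rewrite -expRD; congr expR; ring.
have e1 : expR (- x) <= 1 by rewrite expR_le1 oppr_le0.
have e2 := expR_ge1Dx (- (y - x)).
have e3 := expR_gt0 (- x).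
have e4 : 0 <= y - x by rewrite subr_ge0.
nra.
Qed.

(* The bound is uniform in [x], because x * exp (- x / 2) is bounded. *)
Lemma expR_scale_dist u x : 2^-1 <= u -> 0 <= x ->
  `|expR (- (u * x)) - expR (- x)| <= 2 * `|u - 1|.
Proof.
move=> u2 x0.
(* Both cases reduce to a factor [v] in [0, 1]: v = u at the point x if u <= 1, and v = 1 / u at the
   point u x otherwise. The bound rests on v y exp (- v y) <= 1; the final factor 2 comes from
   dividing by u >= 1/2. *)
have key (v y : R) : 0 <= v <= 1 -> 0 <= y ->
    `|expR (- y) - expR (- (v * y))| * v <= 1 - v.
  move=> /andP[v0 v1] y0.
  have vy : v * y <= y by rewrite ler_piMl.
  rewrite distrC ger0_norm ?subr_ge0 ?ler_expR ?lerN2//.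
  have -> : expR (- y) = expR (- (v * y)) * expR (- ((1 - v) * y)).
    by rewrite -expRD; congr expR; ring.
  have e1 := expR_ge1Dx (v * y).
  have e2 := expR_ge1Dx (- ((1 - v) * y)).
  have e3 := expR_gt0 (- (v * y)).
  have e4 : expR (- (v * y)) * expR (v * y) = 1 by rewrite mulrC expRxMexpNx_1.
  have e5 : expR (- (v * y)) * (v * y) <= 1.
    rewrite -e4 ler_pM2l//; lra.
  have e6 : expR (- (v * y)) * (1 - expR (- ((1 - v) * y))) <=
      expR (- (v * y)) * ((1 - v) * y).
    by rewrite ler_pM2l//; lra.
  have : expR (- (v * y)) * (1 - expR (- ((1 - v) * y))) * v <= 
      expR (- (v * y)) * ((1 - v) * y) * v by rewrite ler_wpM2r.
  have : expR (- (v * y)) * (v * y) * (1 - v) <= 1 * (1 - v).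
    by rewrite ler_wpM2r// subr_ge0.
  lra.
have [u1|/ltW u1] := leP u 1.
  have := key u x; rewrite u1 x0 (le_trans _ u2)// => /(_ isT isT).
  rewrite distrC (distrC u) (ger0_norm (x := 1 - u)) ?subr_ge0//.
  by have := normr_ge0 (expR (- x) - expR (- (u * x))); nra.
have u0 : 0 < u by lra.
have := key u^-1 (u * x).
rewrite mulKf ?gt_eqF// invr_ge0 (ltW u0) invf_le1// u1 => /(_ isT).
rewrite mulr_ge0 ?(ltW u0)// => /(_ isT).
rewrite (ger0_norm (x := u - 1)) ?subr_ge0//.
have uV : u^-1 * u = 1 by rewrite mulVf// gt_eqF.
move=> /(ler_wpM2r (ltW u0)); rewrite -mulrA uV mulrBl uV mulr1 mul1r.
lra.
Qed.

(* [x] does not depend on [n], because n * x * exp (- n * x) <= 1. *)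
Lemma expRM_natl_dist x n : 0 <= x <= 1 ->
  `|(1 - x) ^+ n - expR (- (n%:R * x))| <= 2 * x.
Proof.
move=> /andP[x0 x1].
have e0 : 1 - x <= expR (- x) by have := expR_ge1Dx (- x); lra.
have -> : - (n%:R * x) = n%:R * - x by rewrite mulrN.
rewrite expRM_natl; set q := expR (- x) in e0 *.
have q0 : 0 < q := expR_gt0 _.
have q1 : q <= 1 by rewrite expR_le1 oppr_le0.
have qx : q * (1 + x) <= 1.
  have := expR_ge1Dx x; have : q * expR x = 1 by rewrite mulrC expRxMexpNx_1.
  nra.
have x1' : 0 <= 1 - x by lra.
have pq m : (1 - x) ^+ m <= q ^+ m by rewrite lerXn2r// nnegrE ltW.
rewrite distrC ger0_norm ?subr_ge0//.
(* Factors are exchanged one at a time; each exchange of 1 - x for q costs at most x^2, because q (1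
   + x) <= 1. *)
have sq m : q ^+ m.+1 - (1 - x) ^+ m.+1 <= m.+1%:R * x ^+ 2 * q ^+ m.
  elim: m => [|m IH]; first by rewrite !expr1 expr0; nra.
  rewrite exprS [X in _ - X]exprS.
  have -> : q * q ^+ m.+1 - (1 - x) * (1 - x) ^+ m.+1 =
    (q - (1 - x)) * q ^+ m.+1 + (1 - x) * (q ^+ m.+1 - (1 - x) ^+ m.+1) by ring.
  have h1 : (q - (1 - x)) * q ^+ m.+1 <= x ^+ 2 * q ^+ m.+1.
    by apply: ler_wpM2r; [rewrite exprn_ge0// ltW|nra].
  have h2 : (1 - x) * (q ^+ m.+1 - (1 - x) ^+ m.+1) <=
      m.+1%:R * x ^+ 2 * q ^+ m.+1.
    rewrite [q ^+ m.+1 in leRHS]exprS mulrCA.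
    apply: (@le_trans _ _ (q * (q ^+ m.+1 - (1 - x) ^+ m.+1))).
      by rewrite ler_wpM2r// subr_ge0.
    by rewrite ler_wpM2l// ltW.
  have -> : m.+2%:R * x ^+ 2 * q ^+ m.+1 =
    x ^+ 2 * q ^+ m.+1 + m.+1%:R * x ^+ 2 * q ^+ m.+1.
    by rewrite -[m.+2%:R]natr1; ring.
  exact: lerD.
case: n => [|n]; first by rewrite !expr0 subrr mulr_ge0.
apply: le_trans (sq n) _.
(* Bernoulli's inequality for (1 + x)^n, together with q (1 + x) <= 1, absorbs the factor n. *)
have b1 : n%:R * x * q ^+ n <= 1.
  have : q ^+ n * (1 + x) ^+ n <= 1.
    by rewrite -exprMn exprn_ile1// mulr_ge0 ?(ltW q0)//; lra.
  have : 1 + n%:R * x <= (1 + x) ^+ n.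
    elim: n {sq pq} => [|n IH]; first by rewrite mul0r addr0 expr0.
    rewrite exprS -natr1.
    have : (1 + x) * (1 + n%:R * x) <= (1 + x) * (1 + x) ^+ n.
      by rewrite ler_wpM2l//; lra.
    have : 0 <= n%:R * x * x :> R by rewrite !mulr_ge0.
    lra.
  move=> h1 h2; apply: le_trans h2; rewrite mulrC ler_wpM2l ?exprn_ge0 ?ltW//.
  lra.
have b2 : q ^+ n <= 1 by rewrite exprn_ile1// ltW.
rewrite -natr1.
have -> : (n%:R + 1) * x ^+ 2 * q ^+ n =
  x * (n%:R * x * q ^+ n) + x * (x * q ^+ n) by ring.
have : x * q ^+ n <= 1 by rewrite mulr_ile1// exprn_ge0// ltW.
nra.
Qed.

(* Polynomial in exp (- y), approximating the indicator of ]c, +oo[. *)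
Lemma exponential_step (c e h : R) : 0 <= c -> 0 < e -> 0 < h ->
  exists M n : nat, let k y := (1 - expR (- (M%:R * y))) ^+ n in
    (forall y, 0 <= y -> y <= c - h -> k y <= e) /\
    (forall y, c + h <= y -> 1 - e <= k y).
Proof.
move=> c0 e0 h0.
have [M Mh] : exists M : nat, 2 * e^-1 <= expR (M%:R * h).
  exists (Num.bound (2 * e^-1 / h)).
  apply: le_trans (expR_ge1Dx _).
  have : 2 * e^-1 / h <= (Num.bound (2 * e^-1 / h))%:R.
    by rewrite ltW// archi_boundP// !mulr_ge0// ?invr_ge0 ltW.
  by rewrite ler_pdivrMr//; lra.
(* This is exp (M c) up to a factor 2, so that the power behaves like exp (- exp (M (c - y))), which
   switches from 0 to 1 around y = c. *)
pose n := (Num.trunc (expR (M%:R * c))).+1.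
have n1 : expR (M%:R * c) <= n%:R by rewrite ltW// truncnS_gt.
have n2 : n%:R <= 2 * expR (M%:R * c).
  rewrite /n -natr1.
  have : (Num.trunc (expR (M%:R * c)))%:R <= expR (M%:R * c).
    by rewrite truncn_le// expR_ge0.
  have : 1 <= expR (M%:R * c) by rewrite -expR0 ler_expR mulr_ge0.
  lra.
exists M, n => k; split=> y.
- move=> y0 yc; rewrite /k.
  have e1 : 0 <= 1 - expR (- (M%:R * y)).
    by rewrite subr_ge0 expR_le1 oppr_le0 mulr_ge0.
  apply: (@le_trans _ _ (expR (- expR (- (M%:R * y))) ^+ n)).
    rewrite lerXn2r// ?nnegrE ?expR_ge0//.
    exact: expR_ge1Dx.
  rewrite -expRM_natl.
  have ne : 2 * e^-1 <= n%:R * expR (- (M%:R * y)).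
    apply: le_trans Mh _.
    apply: (@le_trans _ _ (expR (M%:R * c) * expR (- (M%:R * y)))).
      rewrite -expRD ler_expR -mulrBr ler_wpM2l//; lra.
    by rewrite ler_wpM2r// expR_ge0.
  rewrite mulrN [leLHS]expRN -[leRHS]invrK lef_pV2 ?posrE ?expR_gt0 ?invr_gt0//.
  apply: le_trans (expR_ge1Dx _).
  have : 0 < e^-1 by rewrite invr_gt0.
  lra.
- move=> cy; rewrite /k.
  have e1 : expR (- (M%:R * y)) <= expR (- (M%:R * c)) * expR (- (M%:R * h)).
    by rewrite -expRD ler_expR -opprD lerN2 -mulrDr ler_wpM2l.
  have y0 : 0 <= y by lra.
  have e2 : 0 <= 1 - expR (- (M%:R * y)).
    by rewrite subr_ge0 expR_le1 oppr_le0 mulr_ge0.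
  have e3 : n%:R * expR (- (M%:R * y)) <= e.
    apply: (@le_trans _ _ (2 * expR (M%:R * c) *
        (expR (- (M%:R * c)) * expR (- (M%:R * h))))).
      by apply: ler_pM => //; exact: expR_ge0.
    rewrite mulrA -[X in X * _ <= _]mulrA expRxMexpNx_1 mulr1 expRN.
    by rewrite ler_pdivrMr ?expR_gt0// -ler_pdivrMl// mulrC.
  apply: (@le_trans _ _ (1 - n%:R * expR (- (M%:R * y)))); first lra.
  move: (expR_ge0 (- (M%:R * y))) e2; move: (expR _) => q q0 q1.
  elim: (n) => [|m IH]; first by rewrite mul0r subr0.
  rewrite exprS -natr1.
  have : (1 - q) * (1 - m%:R * q) <= (1 - q) * (1 - q) ^+ m by rewrite ler_wpM2l.
  have : 0 <= m%:R * q * q by rewrite !mulr_ge0.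
  lra.
Qed.

End exponential_inequalities.

(** * From Laplace transforms to distribution functions *)

Section measurability_in_R.
Context d (T : measurableType d) (R : realType).
Implicit Types f g : T -> R.

Lemma measurable_set_le f (x : R) :
  measurable_fun setT f -> measurable [set w | f w <= x].
Proof.
by move=> mf; rewrite -[X in measurable X]setTI; exact: measurable_fun_le.
Qed.

Lemma measurable_set_gt f (x : R) :
  measurable_fun setT f -> measurable [set w | x < f w].
Proof.
move=> mf; have -> : [set w | x < f w] = ~` [set w | f w <= x].
  by apply/seteqP; split=> w /=; rewrite ltNge => /negP.
exact/measurableC/measurable_set_le.
Qed.

Lemma indic_pred (p : T -> bool) w : \1_[set v | p v] w = (p w)%:R :> R.
Proof.
rewrite indicE; case: (boolP (w \in _)) => [|/negP].
  by rewrite inE /= => ->.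
by rewrite inE /=; case: (p w) => // /(_ isT).
Qed.

Lemma measurable_expRN f (r : R) :
  measurable_fun setT f -> measurable_fun setT (fun w => expR (- (r * f w))).
Proof.
move=> mf; apply: measurableT_comp => //; apply: measurableT_comp => //.
exact: measurable_funM.
Qed.

Lemma bounded_measurable_expRN f (r : R) : measurable_fun setT f ->
  (forall w, 0 <= r * f w) -> bounded_measurable (fun w => expR (- (r * f w))).
Proof.
move=> mf f0; apply: bounded_measurable01; first exact: measurable_expRN.
by move=> w; rewrite expR_ge0 expR_le1 oppr_le0 f0.
Qed.

End measurability_in_R.

(** Passes between the extended reals, where convergence in distribution is stated, and the reals,
    where the estimates are made. *)
Lemma cvg_fine_probP (I : Type) (FF : set_system I) {FFF : Filter FF}
    d d' (T : measurableType d) (T' : measurableType d') (R : realType)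
    (P : probability T R) (P' : probability T' R) (A : I -> set T) (B : set T') :
  (forall i, measurable (A i)) -> measurable B ->
  (P (A i) @[i --> FF] --> P' B) <->
  (fine (P (A i)) @[i --> FF] --> fine (P' B)).
Proof.
move=> mA mB; rewrite -[X in _ --> X]fineK ?fin_num_measure//.
rewrite fine_cvgP; split=> [[]//|h]; split=> //.
by apply: nearW => i; rewrite fin_num_measure.
Qed.

Section laplace_to_cdf.
Context (I : Type) (FF : set_system I) {FFF : ProperFilter FF}.
Context d d' (T : measurableType d) (T' : measurableType d') (R : realType)
  (P : probability T R) (P' : probability T' R).
Context (Y : I -> T -> R) (Z : T' -> R).
Hypotheses (mY : forall i, measurable_fun setT (Y i))
  (mZ : measurable_fun setT Z).
Hypotheses (Y0 : forall i w, 0 <= Y i w) (Z0 : forall w, 0 <= Z w).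
Hypothesis laplaceYZ : forall r, 0 <= r ->
  \int[P]_w expR (- (r * Y i w)) @[i --> FF] --> \int[P']_w expR (- (r * Z w)).

(** The step function of [exponential_step]. Expanding the power makes its mean a combination of
    Laplace transforms at multiples of [M]. *)
Let k (M n : nat) (y : R) := (1 - expR (- (M%:R * y))) ^+ n.

Let k01 M n y : 0 <= y -> 0 <= k M n y <= 1.
Proof.
move=> y0; have e1 : 0 <= 1 - expR (- (M%:R * y)).
  by rewrite subr_ge0 expR_le1 oppr_le0 mulr_ge0.
by rewrite exprn_ge0//= exprn_ile1// gerBl expR_ge0.
Qed.

Let bk d0 (T0 : measurableType d0) (f : T0 -> R) M n r :
  measurable_fun setT f -> (forall w, 0 <= f w) -> 0 <= r ->
  bounded_measurable (fun w => expR (- (r * f w)) * k M n (f w)).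
Proof.
move=> mf f0 r0; apply: bounded_measurableM.
  by apply: bounded_measurable_expRN => // w; rewrite mulr_ge0.
apply: bounded_measurable01; last by move=> w; exact: k01.
by apply: measurable_funX; apply: measurable_funB => //; exact: measurable_expRN.
Qed.

(** The factor exp (- r y) is there for the induction on [n]: one more factor 1 - exp (- M y) gives
    a difference of the same expressions at r and r + M. *)
Let kcvg M n r : 0 <= r ->
  \int[P]_w (expR (- (r * Y i w)) * k M n (Y i w)) @[i --> FF] -->
  \int[P']_w (expR (- (r * Z w)) * k M n (Z w)).
Proof.
elim: n r => [|n IH] r r0.
  under eq_fun do under eq_Rintegral do rewrite /k expr0 mulr1.
  under eq_Rintegral do rewrite /k expr0 mulr1.
  exact: laplaceYZ.
have E x : expR (- (r * x)) * k M n.+1 x = expR (- (r * x)) * k M n x -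
    expR (- ((r + M%:R) * x)) * k M n x.
  have -> : expR (- ((r + M%:R) * x)) = expR (- (r * x)) * expR (- (M%:R * x)).
    by rewrite -expRD; congr expR; ring.
  by rewrite /k exprS; ring.
under eq_fun do under eq_Rintegral do rewrite E.
under eq_Rintegral do rewrite E.
have rM : 0 <= r + M%:R by rewrite addr_ge0.
rewrite meanB; [|exact: bk..].
have -> : (fun i => \int[P]_w (expR (- (r * Y i w)) * k M n (Y i w) -
      expR (- ((r + M%:R) * Y i w)) * k M n (Y i w))) =
    (fun i => \int[P]_w (expR (- (r * Y i w)) * k M n (Y i w)) -
      \int[P]_w (expR (- ((r + M%:R) * Y i w)) * k M n (Y i w))).
  by apply/funext => i; rewrite meanB//; exact: bk.
by apply: cvgB; exact: IH.
Qed.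

(** Here 1 - k plays the indicator of a lower half-line; this bound and the next compare its mean
    with a distribution function from either side. *)
Let kbd (d0 : measure_display) (T0 : measurableType d0) (P0 : probability T0 R)
    (f : T0 -> R) (M n : nat) (x e : R) :
  measurable_fun setT f -> (forall w, 0 <= f w) -> 0 <= e ->
  (forall y, 0 <= y -> y <= x -> k M n y <= e) ->
  fine (P0 [set w | f w <= x]) <= 1 - \int[P0]_w k M n (f w) + e.
Proof.
move=> mf f0 e0 kx.
have mA : measurable [set w | f w <= x] by exact: measurable_set_le.
have bkf : bounded_measurable (fun w => k M n (f w)).
  have := @bk _ _ f M n 0 mf f0 (lexx _).
  by under eq_fun do rewrite mul0r oppr0 expR0 mul1r.
rewrite -(mean_indic P0 mA) -[X in X - _](mean_cst P0 1) -meanB//; last first.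
  exact: bounded_measurable_cst.
rewrite -[X in _ + X](mean_cst P0 e) -meanD; last 2 first.
- by apply: bounded_measurableB => //; exact: bounded_measurable_cst.
- exact: bounded_measurable_cst.
apply: le_mean.
- exact: bounded_measurable_indic.
- apply: bounded_measurableD; last exact: bounded_measurable_cst.
  by apply: bounded_measurableB => //; exact: bounded_measurable_cst.
move=> w; rewrite indicE; have /andP[k0 k1] := k01 M n (f0 w).
case: (boolP (w \in _)) => [/[!inE]/= fx|_] /=; last lra.
by have := kx _ (f0 w) fx; lra.
Qed.

Let kbd' (d0 : measure_display) (T0 : measurableType d0) (P0 : probability T0 R)
    (f : T0 -> R) (M n : nat) (x e : R) :
  measurable_fun setT f -> (forall w, 0 <= f w) -> 0 <= e ->
  (forall y, x < y -> 1 - e <= k M n y) ->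
  1 - \int[P0]_w k M n (f w) <= fine (P0 [set w | f w <= x]) + e.
Proof.
move=> mf f0 e0 kx.
have mA : measurable [set w | f w <= x] by exact: measurable_set_le.
have bkf : bounded_measurable (fun w => k M n (f w)).
  have := @bk _ _ f M n 0 mf f0 (lexx _).
  by under eq_fun do rewrite mul0r oppr0 expR0 mul1r.
rewrite -(mean_indic P0 mA) -[X in X - _](mean_cst P0 1) -meanB//; last first.
  exact: bounded_measurable_cst.
rewrite -[X in _ + X](mean_cst P0 e) -meanD; last 2 first.
- exact: bounded_measurable_indic.
- exact: bounded_measurable_cst.
apply: le_mean.
- by apply: bounded_measurableB => //; exact: bounded_measurable_cst.
- apply: bounded_measurableD; last exact: bounded_measurable_cst.
  exact: bounded_measurable_indic.
move=> w; rewrite indicE; have /andP[k0 k1] := k01 M n (f0 w).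
case: (boolP (w \in _)) => [_|] /=; first lra.
rewrite notin_setE/= => /negP; rewrite -ltNge => xf.
by have := kx _ xf; lra.
Qed.

Let cdf0 (d0 : measure_display) (T0 : measurableType d0) (P0 : probability T0 R)
    (f : T0 -> R) (x : R) : (forall w, 0 <= f w) -> x < 0 ->
  fine (P0 [set w | f w <= x]) = 0.
Proof.
move=> f0 x0; have -> : [set w | f w <= x] = set0.
  by rewrite -subset0 => w /= fx; have := f0 w; lra.
by rewrite measure0.
Qed.

(** The gap between [x] and [x'] leaves room for [k] to climb from e / 3 to 1 - e / 3, so the mean
    of 1 - k separates the two distribution functions. No continuity point is involved, which also
    suits the degenerate limit of the weak law. *)
Lemma laplace_cvg_near (x x' e : R) : x < x' -> 0 < e ->
  \forall i \near FF,
    fine (P [set w | Y i w <= x]) <= fine (P' [set w | Z w <= x']) + e /\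
    fine (P' [set w | Z w <= x]) <= fine (P [set w | Y i w <= x']) + e.
Proof.
move=> xx' e0.
(* [exponential_step] wants a nonnegative threshold. If the midpoint is negative then so is [x], and
   both distribution functions vanish there. *)
have [c0|c0] := ltP ((x + x') / 2) 0.
  have x0 : x < 0 by lra.
  apply: nearW => i; rewrite (cdf0 P (Y0 i) x0) (cdf0 P' Z0 x0).
  by rewrite !addr_ge0// ?fine_prob_ge0// ltW.
have e3 : 0 < e / 3 by rewrite divr_gt0.
have h0 : 0 < (x' - x) / 4 by lra.
have [M [n [k1 k2]]] := exponential_step c0 e3 h0.
have klo y : 0 <= y -> y <= x -> k M n y <= e / 3.
  by move=> y0 yx; apply: k1 => //; lra.
have khi y : x' < y -> 1 - e / 3 <= k M n y by move=> yx; apply: k2; lra.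
have := @kcvg M n 0 (lexx _).
under eq_fun do under eq_Rintegral do rewrite mul0r oppr0 expR0 mul1r.
under [X in _ --> X -> _]eq_Rintegral do rewrite mul0r oppr0 expR0 mul1r.
move=> /cvgrPdist_le/(_ _ e3); apply: filterS => i.
rewrite ler_distl => /andP[a1 a2].
have b1 := kbd P (mY i) (Y0 i) (ltW e3) klo.
have b2 := kbd P' mZ Z0 (ltW e3) klo.
have b3 := kbd' P (mY i) (Y0 i) (ltW e3) khi.
have b4 := kbd' P' mZ Z0 (ltW e3) khi.
by split; lra.
Qed.

Lemma laplace_cvg_cdf (x : R) :
  {for x, continuous (fun y : R => P' [set w | Z w <= y])} ->
  P [set w | Y i w <= x] @[i --> FF] --> P' [set w | Z w <= x].
Proof.
rewrite /continuous_at.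
move=> /(cvg_fine_probP _ _ (fun y => measurable_set_le y mZ)
  (measurable_set_le x mZ)) cx.
apply/(cvg_fine_probP _ _ (fun i => measurable_set_le x (mY i))
  (measurable_set_le x mZ)).
apply/cvgrPdist_le => e e0.
have e2 : 0 < e / 2 by rewrite divr_gt0.
move/cvgrPdist_le : cx => /(_ _ e2)/nbhs_ballP[h /= h0 hx].
have x1 : x - h / 2 < x by lra.
have x2 : x < x + h / 2 by lra.
have := laplace_cvg_near x1 e2; have := laplace_cvg_near x2 e2.
apply: filterS2 => i [a1 a2] [a3 a4].
have b1 : ball x h (x - h / 2) by rewrite /ball /= ltr_distl; lra.
have b2 : ball x h (x + h / 2) by rewrite /ball /= ltr_distl; lra.
move: (hx _ b1) (hx _ b2) => /=; rewrite !ler_distl => /andP[b3 b4] /andP[b5 b6].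
apply/andP; split; lra.
Qed.

End laplace_to_cdf.

(** * Convergence of means from convergence in distribution *)

Section continuity_points.
Context d (T : measurableType d) (R : realType) (P : probability T R)
  (Z : {RV P >-> R}).

Let F (y : R) := fine (P [set w | Z w <= y]).

Let mF y : measurable [set w | Z w <= y].
Proof. exact: measurable_set_le. Qed.

Let F_nd x y : x <= y -> F x <= F y.
Proof. by move=> xy; apply: le_fine_prob => // w /= /le_trans; apply. Qed.

Lemma cdf_right_cvg (x e : R) : 0 < e -> exists2 h, 0 < h &
  fine (P [set w | Z w <= x + h]) <= fine (P [set w | Z w <= x]) + e.
Proof.
move=> e0; have := @cdf_right_continuous _ _ _ P Z x.
have cdfE y : cdf Z y = (F y)%:E by rewrite /F fineK ?fin_num_measure.
rewrite cdfE (_ : cdf Z = (fun y => (F y)%:E)); last exact/funext.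
move=> /fine_cvgP[_] /cvgrPdist_le/(_ _ e0) [h /= h0 hx].
have h20 : 0 < h / 2 by rewrite divr_gt0.
exists (h / 2) => //.
have := hx (x + h / 2); rewrite /ball_ /= opprD addNKr normrN gtr0_norm//.
rewrite ltrDl h20 => /(_ (ltac:(lra)) isT).
by rewrite ler_distl /F => /andP[]; lra.
Qed.

(** Without an atom at [x], the event Z <= x has no more mass than the union of the events Z <= x -
    1 / (n + 1). *)
Let F_left x e : 0 < e -> pmf Z x = 0 -> exists2 h, 0 < h & F x - e <= F (x - h).
Proof.
move=> e0 px.
pose A n := [set w | Z w <= x - n.+1%:R^-1].
have mA n : measurable (A n) by exact: mF.
have cA : P (A n) @[n --> \oo] --> P (\bigcup_n A n).
  apply: nondecreasing_cvg_mu => //; first exact: bigcup_measurable.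
  move=> m n mn; apply/subsetPset => w /= /le_trans; apply.
  by rewrite lerD2l lerN2 lef_pV2 ?posrE// ler_nat.
have mU : measurable (\bigcup_n A n) by exact: bigcup_measurable.
move/(cvg_fine_probP _ _ mA mU) : cA => /cvgrPdist_le/(_ _ e0)[n _ /(_ n (leqnn n))].
rewrite /= ler_distl => /andP[_ h]; exists (n.+1%:R^-1); first by rewrite invr_gt0.
suff : F x <= fine (P (\bigcup_n A n)) by rewrite -/(F _) in h; lra.
have mZx : measurable (Z @^-1` [set x]) by [].
have -> : fine (P (\bigcup_n A n)) =
    fine (P (\bigcup_n A n)) + fine (P (Z @^-1` [set x])).
  by rewrite [X in _ + X]px addr0.
apply: le_trans (fine_prob_setU _ mU mZx).
apply: le_fine_prob => //; first exact: measurableU.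
move=> w /=; rewrite le_eqVlt => /predU1P[->|zx]; first by right.
left; exists (Num.trunc (x - Z w)^-1) => //=.
have xz : 0 < x - Z w by rewrite subr_gt0.
rewrite /A /= lerBrDl -lerBrDr -[leRHS]invrK lef_pV2 ?posrE ?invr_gt0//.
by rewrite ltW// truncnS_gt.
Qed.

Lemma pmf0_continuous x : pmf Z x = 0 ->
  {for x, continuous (fun y : R => P [set w | Z w <= y])}.
Proof.
move=> px; apply/(cvg_fine_probP P P mF (mF x))/cvgrPdist_le => e e0.
have [h1 h10 h1x] := F_left e0 px.
have [h2 h20 h2x] := cdf_right_cvg x e0.
apply/nbhs_ballP; exists (Num.min h1 h2) => /=; first by rewrite lt_min h10.
move=> y; rewrite /ball /= lt_min !ltr_distlC => /andP[/andP[y1 _] /andP[_ y2]].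
rewrite -!/(F _) in h2x *; rewrite ler_distl.
by have := F_nd (ltW y1); have := F_nd (ltW y2); lra.
Qed.

(** Every discontinuity is an atom, and atoms are countable, while an open interval has positive
    Lebesgue measure. *)
Lemma continuity_point_between (u v : R) : u < v -> exists x,
  [/\ u < x, x < v & {for x, continuous (fun y : R => P [set w | Z w <= y])}].
Proof.
move=> uv; apply: contrapT => h.
have uvc : `]u, v[%classic `<=` [set r | 0 < pmf Z r].
  move=> x /=; rewrite in_itv/= => /andP[ux xv].
  rewrite lt_neqAle pmf_ge0 andbT; apply/eqP => p0; apply: h.
  by exists x; split=> //; exact/pmf0_continuous.
have := countable_lebesgue_measure0 (sub_countable (subset_card_le uvc) (pmf_gt0_countable Z)).
rewrite lebesgue_measure_itv/= lte_fin uv -EFinB => /eqP.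
by rewrite eqe subr_eq0 gt_eqF.
Qed.

End continuity_points.

(** The point [z] may leave the interval: in [uniform_square_tail] the grid overshoots the right
    end. Compactness enters through the near-covering property, the width [h] being the parameter
    tending to 0. *)
Lemma uniform_continuity_on_itv (R : realType) (G : R -> R) (u v e : R) :
  {in `[u, v]%R, forall y, {for y, continuous G}} -> 0 < e ->
  exists2 h, 0 < h & forall y z, u <= y <= v -> `|y - z| < h -> `|G y - G z| <= e.
Proof.
move=> cG e0.
have e2 : 0 < e / 2 by rewrite divr_gt0.
have /compact_near_coveringP/(_ R (0^'+) (fun h y => forall z, `|y - z| < h ->
    `|G y - G z| <= e) _) := @segment_compact R u v.
case=> [y yuv|h /= h0 hP].
  have /cvgrPdist_le/(_ _ e2)/nbhs_ballP[r /= r0 ry] : G x @[x --> y] --> G y.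
    by apply: cG; rewrite inE.
  exists (ball y (r / 2), [set t | t < r / 2]) => /=.
    split; first by apply: nbhsx_ballx; rewrite divr_gt0.
    by apply: nbhs_right_lt; rewrite divr_gt0.
  move=> [y' h] /= [yy' hr] z y'z.
  have := ry y'; have := ry z; rewrite /= /ball/=.
  have d1 : `|y - y'| < r by rewrite (lt_trans yy')// ltr_pdivrMr// mulr2n; lra.
  have d2 : `|y - z| < r.
    rewrite -(subrKA y') (le_lt_trans (ler_normD _ _))//.
    by rewrite /ball /= in yy'; lra.
  move=> /(_ d2) g1 /(_ d1) g2.
  rewrite -(subrKA (G y)) (le_trans (ler_normD _ _))// distrC; lra.
exists (h / 2); first by rewrite divr_gt0.
move=> y z yuv yz; have := @hP (h / 2).
rewrite /ball_ /= sub0r normrN gtr0_norm ?divr_gt0//.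
move=> /(_ (ltac:(lra)) isT); exact.
Qed.

Section helly_bray.
Context (I : Type) (FF : set_system I) {FFF : ProperFilter FF}.
Context d d' (T : measurableType d) (T' : measurableType d') (R : realType)
  (P : probability T R) (P' : probability T' R).
Context (Y : I -> T -> R) (Z : {RV P' >-> R}).
Hypothesis mY : forall i, measurable_fun setT (Y i).
Hypothesis Z_gt0 : P' [set w | 0 < Z w] = 1%E.
Hypothesis cdfYZ : forall x : R,
  {for x, continuous (fun y : R => P' [set w | Z w <= y])} ->
  P [set w | Y i w <= x] @[i --> FF] --> P' [set w | Z w <= x].
Context (G : R -> R) (A : I -> T -> R).
Hypotheses (mG : measurable_fun setT G) (G01 : forall y, 0 <= G y <= 1).
Hypothesis cG : forall y, 0 < y -> {for y, continuous G}.
Hypotheses (mA : forall i, measurable_fun setT (A i))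
  (A01 : forall i w, 0 <= A i w <= 1).
Hypothesis AG : forall u v e : R, 0 < u -> u < v -> 0 < e ->
  \forall i \near FF, forall w, u <= Y i w <= v -> `|A i w - G (Y i w)| <= e.

Let cdf_small (e : R) : 0 < e ->
  exists u v : R, [/\ 0 < u, u < v, fine (P' [set w | Z w <= u]) <= e &
    fine (P' [set w | Z w <= v]) >= 1 - e].
Proof.
move=> e0; have [u u0 uP] := cdf_right_cvg Z 0 e0.
have Z0 : fine (P' [set w | Z w <= 0]) = 0.
  have -> : [set w | Z w <= 0] = ~` [set w | 0 < Z w].
    by apply/seteqP; split=> w /=; rewrite leNgt => /negP.
  by rewrite fine_prob_setC ?Z_gt0 ?subrr//; exact: measurable_set_gt.
have [v uv vP] : exists2 v, u < v & fine (P' [set w | Z w <= v]) >= 1 - e.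
  have := cvg_cdfy1 Z.
  rewrite (_ : cdf Z = (fun y => (fine (P' [set w | Z w <= y]))%:E)); last first.
    apply/funext => y; rewrite fineK ?fin_num_measure//.
    exact: measurable_set_le.
  move=> /fine_cvgP[_] /cvgrPdist_le/(_ _ e0)[M [_ MP]].
  exists (Num.max u M + 1); first by rewrite ltr_pwDr// le_max lexx.
  have /= := MP (Num.max u M + 1) (ltac:(by rewrite ltr_pwDr// le_max lexx orbT)).
  by rewrite ler_distl => /andP[]; lra.
exists u, v; split=> //; by rewrite add0r Z0 add0r in uP.
Qed.

(** A step function interpolating [G] on the grid [x], written by its increments so that its mean is
    linear in the values of the distribution function at the grid points. *)
Let S (x : nat -> R) (K : nat) (y : R) :=
  G (x 0%N) + \sum_(i < K) (G (x i.+1) - G (x i)) * (x i < y)%R%:R.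

(** Between two consecutive nodes the increments telescope to the value of [G] at the right node.
    Off the grid only the trivial bound 1 is available, whence the two indicators. *)
Let S_dist (x : nat -> R) (K : nat) (h e : R) :
  (forall i, x i < x i.+1 < x i + h) ->
  (forall y z, x 0%N <= y <= x K -> `|y - z| < h -> `|G y - G z| <= e) ->
  0 <= e -> forall y : R,
  `|S x K y - G y| <= e + (y <= x 0%N)%R%:R + (x K < y)%R%:R.
Proof.
move=> xS uG e0 y.
have xhomo : {homo x : m n / (m <= n)%N >-> m <= n}.
  by apply: homo_leq => // [a b c|i]; [exact: le_trans|have /andP[/ltW] := xS i].
have dG a b : `|G a - G b| <= 1.
  by rewrite ler_distl; have := G01 a; have := G01 b; lra.
have [yx0|x0y] := leP y (x 0%N).
  rewrite /S big1 ?addr0 => [|i _]; last first.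
    rewrite ltNge (le_trans yx0) ?mulr0//; exact: xhomo.
  apply: le_trans (dG _ _) _; rewrite -[leLHS]add0r addrAC lerD ?addr_ge0//.
have telescope j : S x j y = G (x j) + \sum_(i < j) (G (x i.+1) - G (x i)) * ((x i < y)%R%:R - 1).
  rewrite /S; elim: j => [|j IH]; first by rewrite !big_ord0.
  by rewrite !big_ord_recr/= addrA IH; ring.
have telx j : x j < y -> S x j.+1 y = G (x j.+1).
  move=> xjy; rewrite telescope big1 ?addr0// => i _.
  by rewrite (le_lt_trans _ xjy) ?subrr ?mulr0// xhomo// -ltnS.
have [xKy|yxK] := ltP (x K) y.
  case: (K) xKy => [|m] xKy.
    rewrite /S big_ord0 addr0; apply: le_trans (dG _ _) _.
    by rewrite lerDr addr_ge0.
  rewrite telx; last by apply: le_lt_trans xKy; exact: xhomo.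
  by apply: le_trans (dG _ _) _; rewrite lerDr addr_ge0.
rewrite !addr0.
have [j [jK xjy yxj]] : exists j, [/\ (j < K)%N, x j < y & y <= x j.+1].
  move: yxK {uG telescope}; elim: (K) => [|m IH] yxm.
    by move: (lt_le_trans x0y yxm); rewrite ltxx.
  have [/IH [j [jm ? ?]]|xmy] := leP y (x m); last by exists m.
  by exists j; split=> //; exact: ltnW.
have SKj : S x K y = S x j.+1 y.
  rewrite /S; congr (_ + _); rewrite -!(big_mkord xpredT (fun i => (G (x i.+1) - G (x i)) * (x i < y)%R%:R)).
  rewrite (big_cat_nat (n := j.+1))//= [X in _ + X]big1_seq ?addr0//= => i.
  rewrite mem_index_iota => /andP[ji _].
  by rewrite ltNge (le_trans yxj) ?mulr0// xhomo.
rewrite SKj telx// uG//.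
  by rewrite xhomo//= xhomo.
have /andP[a1 a2] := xS j; rewrite ger0_norm; lra.
Qed.

(** As [Z] is positive almost surely, little mass of [Y i] lies near 0 or near infinity. It is
    therefore enough that [A i] be close to [G (Y i)] on compact parts of the open half-line, and
    the integrand may vary with [i]. *)
Theorem helly_bray :
  \int[P]_w A i w @[i --> FF] --> \int[P']_w G (Z w).
Proof.
apply/cvgrPdist_le => e0 e0_gt0.
(* The final budget is 17 e: 6 e on the side of [Z], e for the step functions, and 10 e on the side
   of [Y i], whose two tails have mass at most 2 e each. *)
pose e := e0 / 20; have e_gt0 : 0 < e by rewrite divr_gt0.
have [u [v [u_gt0 uv Fu Fv]]] := cdf_small e_gt0.
have cGuv : {in `[u / 2, v + 1]%R, forall y, {for y, continuous G}}.
  by move=> y; rewrite in_itv/= => /andP[y1 _]; apply: cG; lra.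
have [h h0 uG] := uniform_continuity_on_itv cGuv e_gt0.
(* With one continuity point in each cell of width [s], consecutive nodes are less than 2 s <= h
   apart; the other two bounds place the first node below [u] and the last one below v + 1. *)
pose s := Num.min (h / 2) (Num.min (u / 2) (1 / 2)).
have s0 : 0 < s by rewrite !lt_min; apply/and3P; split; lra.
have [sh su s1] : [/\ s <= h / 2, s <= u / 2 & s <= 1 / 2].
  by split; rewrite !ge_min lexx ?orbT.
have /choice[x xP] (i : nat) : exists x : R, [/\ u / 2 + i%:R * s < x,
    x < u / 2 + i.+1%:R * s &
    {for x, continuous (fun y : R => P' [set w | Z w <= y])}].
  by apply: continuity_point_between; rewrite ltrD2l ltr_pM2r// ltr_nat.
pose K := (Num.trunc ((v - u / 2) / s)).+1.
have K1 : v - u / 2 < K%:R * s by rewrite -ltr_pdivrMr// truncnS_gt.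
have K2 : K%:R * s <= v - u / 2 + s.
  rewrite /K -natr1 mulrDl mul1r lerD2r -ler_pdivlMr// truncn_le//.
  by rewrite divr_ge0 ?(ltW s0)//; lra.
have xS i : x i < x i.+1 < x i + h.
  have [a1 a2 _] := xP i; have [b1 b2 _] := xP i.+1.
  rewrite -[i.+2%:R]natr1 mulrDl mul1r -[i.+1%:R]natr1 mulrDl mul1r in a2 b1 b2.
  by apply/andP; split; lra.
have [x0l x0u _] := xP 0%N; have [xKl xKu _] := xP K.
rewrite mul0r mul1r -[K.+1%:R]natr1 mulrDl mul1r in x0l x0u xKu.
have S_G y : `|S x K y - G y| <= e + (y <= x 0%N)%R%:R + (x K < y)%R%:R.
  apply: (S_dist xS _ (ltW e_gt0)) => z z' zx zz'.
  by apply: uG => //; lra.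
have bS d0 (T0 : measurableType d0) (f : T0 -> R) : measurable_fun setT f ->
    bounded_measurable (fun w => S x K (f w)).
  move=> mf; apply: bounded_measurableD; first exact: bounded_measurable_cst.
  apply: bounded_measurable_sum => i; apply: bounded_measurableM.
    exact: bounded_measurable_cst.
  rewrite (_ : (fun _ => _) = \1_[set w | x i < f w]).
    by apply: bounded_measurable_indic; exact: measurable_set_gt.
  by apply/funext => w; rewrite indic_pred.
have mS d0 (T0 : measurableType d0) (P0 : probability T0 R) (f : T0 -> R) :
    measurable_fun setT f -> \int[P0]_w S x K (f w) =
    G (x 0%N) + \sum_(i < K) (G (x i.+1) - G (x i)) *
      (1 - fine (P0 [set w | f w <= x i])).
  move=> mf.
  have bi i : bounded_measurable (fun w => (x i < f w)%R%:R : R).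
    rewrite (_ : (fun _ => _) = \1_[set w | x i < f w]).
      by apply: bounded_measurable_indic; exact: measurable_set_gt.
    by apply/funext => w; rewrite indic_pred.
  rewrite /S meanD ?mean_cst; last 2 first.
  - exact: bounded_measurable_cst.
  - apply: bounded_measurable_sum => i; apply: bounded_measurableM => //.
    exact: bounded_measurable_cst.
  rewrite mean_sum => [|i]; last first.
    by apply: bounded_measurableM => //; exact: bounded_measurable_cst.
  congr (_ + _); apply: eq_bigr => i _; rewrite meanZ//; congr (_ * _).
  rewrite -fine_prob_setC; last exact: measurable_set_le.
  rewrite -mean_indic; last exact/measurableC/measurable_set_le.
  rewrite (_ : ~` _ = [set w | x i < f w]).
    by apply: eq_Rintegral => w _; rewrite indic_pred.
  by apply/seteqP; split=> w /=; rewrite ltNge => /negP.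
have SYZ : \int[P]_w S x K (Y i w) @[i --> FF] --> \int[P']_w S x K (Z w).
  rewrite mS//; under eq_fun do rewrite mS//.
  apply: cvgD; first exact: cvg_cst.
  apply: cvg_big => [|i _]; first exact: add_continuous.
  apply: cvgM; first exact: cvg_cst.
  apply: cvgB; first exact: cvg_cst.
  apply/(cvg_fine_probP _ _ (fun j => measurable_set_le (x i) (mY j))
    (measurable_set_le (x i) (measurable_funPT Z))).
  by have [_ _] := xP i; exact: cdfYZ.
(* Used for [G (Z w)] and for [A i]. Off the grid, |B - G| and |S - G| are each charged 1, hence the
   factors 2. *)
have dist d0 (T0 : measurableType d0) (P0 : probability T0 R) (f B : T0 -> R) :
    measurable_fun setT f -> measurable_fun setT B ->
    (forall w, 0 <= B w <= 1) -> 
    (forall w, x 0%N <= f w <= x K -> `|B w - G (f w)| <= e) ->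
    `|\int[P0]_w B w - \int[P0]_w S x K (f w)| <=
    2 * e + 2 * fine (P0 [set w | f w <= x 0%N]) +
     2 * (1 - fine (P0 [set w | f w <= x K])).
  move=> mf mB B01 BG.
  have m1 : measurable [set w | f w <= x 0%N] by exact: measurable_set_le.
  have m2 : measurable [set w | x K < f w] by exact: measurable_set_gt.
  have -> : 1 - fine (P0 [set w | f w <= x K]) = fine (P0 [set w | x K < f w]).
    rewrite -fine_prob_setC; last exact: measurable_set_le.
    by congr (fine (P0 _)); apply/seteqP; split=> w /=; rewrite ltNge => /negP.
  rewrite -!(mean_indic P0)//.
  have bb1 : bounded_measurable (\1_[set w | f w <= x 0%N] : T0 -> R).
    exact: bounded_measurable_indic.
  have bb2 : bounded_measurable (\1_[set w | x K < f w] : T0 -> R).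
    exact: bounded_measurable_indic.
  have bb3 : bounded_measurable (fun w => 2 * \1_[set w | f w <= x 0%N] w : R).
    by apply: bounded_measurableM => //; exact: bounded_measurable_cst.
  have bb4 : bounded_measurable (fun w => 2 * \1_[set w | x K < f w] w : R).
    by apply: bounded_measurableM => //; exact: bounded_measurable_cst.
  have bb5 : bounded_measurable (fun _ : T0 => 2 * e) by exact: bounded_measurable_cst.
  rewrite -!meanZ// -[X in X + _ + _](mean_cst P0) -meanD// -meanD//; last first.
    exact: bounded_measurableD.
  apply: mean_dist.
  - exact: bounded_measurable01.
  - exact: bS.
  - by apply: bounded_measurableD => //; exact: bounded_measurableD.
  move=> w; rewrite !indic_pred.
  have := S_G (f w); rewrite distrC => SG.
  rewrite -(subrKA (G (f w))) (le_trans (ler_normD _ _))//.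
  have BG1 : `|B w - G (f w)| <= 1.
    by rewrite ler_distl; have := B01 w; have := G01 (f w); lra.
  have := BG w; move: SG.
  case: (leP (f w) (x 0%N)) => c1; case: (ltP (x K) (f w)) => c2 /=.
  - by move=> + _; lra.
  - by move=> + _; lra.
  - by move=> + _; lra.
  - by move=> SG /(_ (ltac:(by rewrite (ltW c1)))); lra.
have FZ0 : fine (P' [set w | Z w <= x 0%N]) <= e.
  apply: le_trans Fu; apply: le_fine_prob; [exact: measurable_set_le..|].
  by move=> w /= /le_trans; apply; lra.
have FZK : fine (P' [set w | Z w <= x K]) >= 1 - e.
  apply: le_trans Fv _; apply: le_fine_prob; [exact: measurable_set_le..|].
  by move=> w /= /le_trans; apply; lra.
have dZ : `|\int[P']_w G (Z w) - \int[P']_w S x K (Z w)| <= 6 * e.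
  have := dist _ _ P' Z (G \o Z) (measurable_funPT Z) (measurableT_comp mG (measurable_funPT Z)) (fun w => G01 _).
  by move=> /(_ (fun w _ => ltac:(by rewrite subrr normr0 ltW)))/=; lra.
have cF i : fine (P [set w | Y j w <= x i]) @[j --> FF] -->
    fine (P' [set w | Z w <= x i]).
  apply/(cvg_fine_probP _ _ (fun j => measurable_set_le (x i) (mY j))
    (measurable_set_le (x i) (measurable_funPT Z))).
  by have [_ _] := xP i; exact: cdfYZ.
have x00 : 0 < x 0%N by lra.
have x0K : x 0%N < x K by lra.
near=> i.
have AGi : forall w, x 0%N <= Y i w <= x K -> `|A i w - G (Y i w)| <= e.
  by near: i; exact: AG.
have S_i : `|\int[P']_w S x K (Z w) - \int[P]_w S x K (Y i w)| <= e.
  by near: i; move/cvgrPdist_le : SYZ; exact.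
have F0i : `|fine (P' [set w | Z w <= x 0%N]) - fine (P [set w | Y i w <= x 0%N])| <= e.
  by near: i; move/cvgrPdist_le : (cF 0%N); exact.
have FKi : `|fine (P' [set w | Z w <= x K]) - fine (P [set w | Y i w <= x K])| <= e.
  by near: i; move/cvgrPdist_le : (cF K); exact.
have dY := dist _ _ P (Y i) (A i) (mY i) (mA i) (A01 i) AGi.
have e20 : e0 = 20 * e by rewrite /e; field.
clear -S_i F0i FKi dY dZ FZ0 FZK e20.
rewrite !ler_distl in S_i F0i FKi dY dZ *.
by apply/andP; split; lra.
Unshelve. all: by end_near. Qed.

End helly_bray.

(** * Limits of Laplace transforms *)

Lemma probability_of_cdf (R : realType) (F : R -> R) :
  {homo F : x y / x <= y} -> (forall x, F y @[y --> x^'+] --> F x) ->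
  F x @[x --> -oo] --> (0 : R) -> F x @[x --> +oo] --> (1 : R) ->
  exists Q : probability (measurableTypeR R) R,
    forall x : R, Q [set y | (y : R) <= x] = (F x)%:E.
Proof.
move=> F_nd F_rc F_Ny F_y.
pose F1 := isCumulative.Build R _ R F F_nd F_rc.
pose F2 := isCumulativeBounded.Build R 0 1 F F_Ny F_y.
pose f : cumulativeBounded (0 : R) (1 : R) := HB.pack F F1 F2.
exists (lebesgue_stieltjes_measure f) => x.
rewrite -[RHS](cdf_lebesgue_stieltjes_id f x) /cdf /distribution /pushforward.
by congr (lebesgue_stieltjes_measure f _); apply/seteqP; split=> y /=; rewrite in_itv.
Qed.

Section right_limit.
Context (R : realType) (L : R -> R).
Hypotheses (L_nd : {homo L : x y / x <= y}) (L01 : forall x, 0 <= L x <= 1).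

(** A pointwise limit of distribution functions need not be right-continuous; this is its
    right-continuous regularisation. *)
Definition right_inf (x : R) := inf [set L y | y in [set y | x < y]].

Let has_inf_right x : has_inf [set L y | y in [set y | x < y]].
Proof.
split; first by exists (L (x + 1)), (x + 1) => //=; rewrite ltrDl.
by exists 0 => _ [y _ <-]; have /andP[] := L01 y.
Qed.

Lemma right_inf_le x y : x < y -> right_inf x <= L y.
Proof. by move=> xy; apply: ge_inf; [have [] := has_inf_right x|exists y]. Qed.

Lemma le_right_inf x : L x <= right_inf x.
Proof.
apply: lb_le_inf; first by have [] := has_inf_right x.
by move=> _ [y /= /ltW/L_nd xy <-].
Qed.

Lemma right_inf_nd : {homo right_inf : x y / x <= y}.
Proof.
move=> x y xy; apply: lb_le_inf; first by have [] := has_inf_right y.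
by move=> _ [z /= yz <-]; apply: right_inf_le; exact: le_lt_trans yz.
Qed.

Lemma right_inf_rc x : right_inf y @[y --> x^'+] --> right_inf x.
Proof.
apply/cvgrPdist_le => e e0.
have [_ [y /= xy <-] yL] := inf_adherent e0 (has_inf_right x).
near=> z; rewrite ler_distl; apply/andP; split.
  rewrite lerBlDr ltW//; apply: le_lt_trans yL.
  by apply: right_inf_le; near: z; exact: nbhs_right_lt.
apply: (@le_trans _ _ (right_inf z)); last by rewrite lerDl ltW.
by apply/right_inf_nd/ltW; near: z; exact: nbhs_right_gt.
Unshelve. all: by end_near. Qed.

End right_limit.

(** Compactness of [0, 1] gives a cluster point, and an ultrafilter converges to each of its cluster
    points. *)
Lemma ultrafilter_cvg01 (I : Type) (U : set_system I) (R : realType) (f : I -> R) :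
  UltraFilter U -> (forall i, 0 <= f i <= 1) -> exists l : R, f i @[i --> U] --> l.
Proof.
move=> UU f01; have PU : ProperFilter U by exact: ultra_proper.
have [|p [_ pP]] := @segment_compact R 0 1 (f @ U) _.
  by apply: nearW => i /=; rewrite in_itv/= f01.
exists p => B pB; have [//|UB] := in_ultra_setVsetC (f @^-1` B) UU.
by have [x [? ?]] := pP (~` B) B UB pB.
Qed.

Section laplace_limit.
Context d (T : measurableType d) (R : realType) (P : probability T R).
Context (V : nat -> T -> R) (psi : R -> R).
Hypotheses (mV : forall n, measurable_fun setT (V n)) (V0 : forall n w, 0 <= V n w).
Hypothesis laplaceV : forall r, 0 < r ->
  \int[P]_w expR (- (r * V n w)) @[n --> \oo] --> psi r.
Hypothesis psi0 : psi r @[r --> 0^'+] --> (1 : R).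
Hypothesis psiy : psi r @[r --> +oo] --> (0 : R).

(* An ultrafilter finer than [\oo] replaces Helly's selection theorem. *)
Lemma laplace_limit : exists (Q : probability (measurableTypeR R) R)
    (W : {RV Q >-> R}), [/\ forall w, 0 <= W w, Q [set w | 0 < W w] = 1%E &
    forall r, 0 < r -> \int[Q]_w expR (- (r * W w)) = psi r].
Proof.
have [U [UU ooU]] := @ultraFilterLemma nat \oo _.
have PU : ProperFilter U by exact: ultra_proper.
pose c n x := fine (P [set w | V n w <= x]).
have c01 n x : 0 <= c n x <= 1.
  by rewrite fine_prob_ge0 fine_prob_le1//; exact: measurable_set_le.
have c_nd n x y : x <= y -> c n x <= c n y.
  move=> xy; apply: le_fine_prob; [exact: measurable_set_le..|].
  by move=> w /= /le_trans; apply.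
have /choice[L LP] x := ultrafilter_cvg01 UU (fun n => c01 n x).
have L_nd x y : x <= y -> L x <= L y.
  by move=> xy; apply: ler_cvg_to (LP x) (LP y) _; apply: nearW => n; exact: c_nd.
have L01 x : 0 <= L x <= 1.
  apply/andP; split.
    by apply: ler_cvg_to (cvg_cst _) (LP x) _; apply: nearW => n; have /andP[] := c01 n x.
  by apply: ler_cvg_to (LP x) (cvg_cst _) _; apply: nearW => n; have /andP[] := c01 n x.
have lapU r : 0 < r -> \int[P]_w expR (- (r * V n w)) @[n --> U] --> psi r.
  by move=> r0; apply: cvg_trans (laplaceV r0); exact: cvg_app.
pose F := right_inf L.
have bV n r : 0 < r -> bounded_measurable (fun w => expR (- (r * V n w))).
  by move=> r0; apply: bounded_measurable_expRN => // w; rewrite mulr_ge0// ltW.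
(* Chernoff's bound: the indicator of V <= x is at most exp (r (x - V)). *)
have upper r x : 0 < r -> L x <= expR (r * x) * psi r.
  move=> r0; have : expR (r * x) * \int[P]_w expR (- (r * V n w)) @[n --> U] -->
      expR (r * x) * psi r by apply: cvgMr; exact: lapU.
  move=> /(ler_cvg_to (LP x)); apply; apply: nearW => n.
  rewrite -meanZ; last exact: bV.
  rewrite /c -(mean_indic P); last exact: measurable_set_le.
  apply: le_mean.
  - by apply: bounded_measurable_indic; exact: measurable_set_le.
  - by apply: bounded_measurableM; [exact: bounded_measurable_cst|exact: bV].
  move=> w; rewrite indic_pred -expRD.
  case: (leP (V n w) x) => vx /=; last exact: expR_ge0.
  by rewrite -[leLHS]expR0 ler_expR -mulrBr mulr_ge0 ?subr_ge0// ltW.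
(* Markov's inequality for 1 - exp (- r V); this is what provides tightness. *)
have lower r x : 0 < r -> 0 <= x -> (1 - L x) * (1 - expR (- (r * x))) <= 1 - psi r.
  move=> r0 x0.
  have cl : (1 - c n x) * (1 - expR (- (r * x))) @[n --> U] -->
      (1 - L x) * (1 - expR (- (r * x))).
    by apply: cvgMl; apply: cvgB (LP x); exact: cvg_cst.
  have cr : 1 - \int[P]_w expR (- (r * V n w)) @[n --> U] --> 1 - psi r.
    by apply: cvgB (lapU r r0); exact: cvg_cst.
  apply: ler_cvg_to cl cr _; apply: nearW => n.
  rewrite /c -fine_prob_setC; last exact: measurable_set_le.
  rewrite mulrC -[X in _ * X]mean_indic; last exact/measurableC/measurable_set_le.
  rewrite -meanZ; last first.
    by apply/bounded_measurable_indic/measurableC; exact: measurable_set_le.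
  rewrite -[X in _ <= X - _](mean_cst P) -meanB; [|exact: bounded_measurable_cst|exact: bV].
  apply: le_mean.
  - apply: bounded_measurableM; first exact: bounded_measurable_cst.
    by apply/bounded_measurable_indic/measurableC; exact: measurable_set_le.
  - by apply: bounded_measurableB; [exact: bounded_measurable_cst|exact: bV].
  move=> w; have e1 : 0 <= 1 - expR (- (r * V n w)).
    by rewrite subr_ge0 expR_le1 oppr_le0 mulr_ge0// ltW.
  rewrite indicE; case: (boolP (w \in _)) => [|_]; last by rewrite mulr0.
  rewrite inE /= => /negP; rewrite -ltNge => /ltW xv.
  by rewrite mulr1 lerB// ler_expR lerN2 ler_wpM2l// ltW.
have F_nd x y : x <= y -> F x <= F y by exact: right_inf_nd.
have F_neg x : x < 0 -> F x = 0.
  move=> x0; apply/eqP; rewrite eq_le; apply/andP; split; last first.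
    by apply: le_trans (le_right_inf L_nd L01 x); have /andP[] := L01 x.
  have x20 : x / 2 < 0 by lra.
  apply: (le_trans (right_inf_le (y := x / 2) L01 _)); first lra.
  apply: ler_cvg_to (LP _) (cvg_cst 0) _; apply: nearW => n.
  rewrite /c (_ : [set w | _] = set0) ?measure0//.
  by rewrite -subset0 => w /= h; have := V0 n w; lra.
(* Taking x = 1 / r in [upper] gives F 0 <= e psi(r), with e = exp 1, and psi vanishes at infinity:
   no atom at 0. *)
have F0 : F 0 = 0.
  apply/eqP; rewrite eq_le; apply/andP; split; last first.
    by apply: le_trans (le_right_inf L_nd L01 0); have /andP[] := L01 0.
  apply/ler_addgt0Pl => e e0; rewrite addr0.
  have e1 : 0 < e / expR 1 by rewrite divr_gt0 ?expR_gt0.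
  move/cvgrPdist_le : (psiy) => /(_ _ e1)[M [_ MP]].
  have r0 : 0 < Num.max M 0 + 1 by rewrite ltr_pwDr// le_max lexx orbT.
  have := MP (Num.max M 0 + 1) (ltac:(by rewrite ltr_pwDr// le_max lexx)).
  move: r0; move: (_ + 1) => r r0 /=.
  rewrite sub0r normrN => /(le_trans (ler_norm _)) pe.
  apply: (le_trans (right_inf_le (y := r^-1) L01 _)); first by rewrite invr_gt0.
  apply: le_trans (upper r _ r0) _.
  by rewrite mulfV ?gt_eqF// mulrC -ler_pdivlMr ?expR_gt0.
(* No mass escapes: choose r with psi(r) near 1, then x >= 1 / r, for which 1 - exp (- r x) is at
   least 1/2 in [lower]. *)
have F1 : F x @[x --> +oo] --> (1 : R).
  apply/cvgrPdist_le => e e0.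
  have e20 : 0 < e / 2 by rewrite divr_gt0.
  have [r /= r0 rP] : exists2 r, 0 < r & 1 - psi r <= e / 2.
    move/cvgrPdist_le : (psi0) => /(_ _ e20)[h /= h0 hP].
    have h20 : 0 < h / 2 by rewrite divr_gt0.
    exists (h / 2) => //; have := hP (h / 2).
    rewrite /ball_ /= sub0r normrN gtr0_norm// h20 => /(_ (ltac:(lra)) isT).
    by rewrite ler_distl => /andP[]; lra.
  near=> x.
  have x0 : 0 <= x by near: x; exact: nbhs_pinfty_ge.
  have rx : 1 <= r * x.
    by rewrite -ler_pdivrMl// mulr1; near: x; exact: nbhs_pinfty_ge.
  have ex : expR (- (r * x)) <= 2^-1.
    rewrite expRN lef_pV2 ?posrE ?expR_gt0//.
    by apply: le_trans (expR_ge1Dx _); lra.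
  have /andP[L0 L1] := L01 x.
  have FL : L x <= F x by exact: le_right_inf.
  have FL1 : F x <= 1.
    by apply: (le_trans (right_inf_le (y := x + 1) L01 _)); [rewrite ltrDl|have /andP[] := L01 (x + 1)].
  have := lower r x r0 x0 => lo.
  have : (1 - L x) * 2^-1 <= (1 - L x) * (1 - expR (- (r * x))).
    by rewrite ler_wpM2l//; lra.
  by rewrite ler_distl => ?; apply/andP; split; lra.
have FNy : F x @[x --> -oo] --> (0 : R).
  apply/cvgrPdist_le => e e0; near=> x.
  rewrite F_neg; first by rewrite subrr normr0 ltW.
  by near: x; exact: nbhs_ninfty_lt.
have [Q QF] := probability_of_cdf F_nd (right_inf_rc L01) FNy F1.
(* The identity under [Q] is nonnegative only almost surely; the maximum with 0 makes it so
   everywhere and keeps the law. *)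
pose W (x : measurableTypeR R) : R := Num.max (x : R) 0.
have mW : measurable_fun setT W.
  by apply: measurable_maxr => //; exact: measurable_cst.
pose W' : {RV Q >-> R} := HB.pack W (@isMeasurableFun.Build _ _ _ _ W mW).
have QW x : Q [set w | W' w <= x] = (F x)%:E.
  rewrite -QF; have [x0|x0] := ltP x 0.
    rewrite QF F_neg// (_ : [set w | _] = set0) ?measure0//.
    by rewrite -subset0 => w /=; rewrite /W ge_max => /andP[_]; lra.
  congr (Q _); apply/seteqP; split=> w /=; rewrite /W ge_max x0 andbT//.
have W0 w : 0 <= W' w by rewrite /= /W le_max lexx orbT.
have Wgt0 : Q [set w | 0 < W' w] = 1%E.
  rewrite (_ : [set w | _] = ~` [set w | W' w <= 0]).
    rewrite probability_setC; last exact: measurable_set_le.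
    by rewrite QW F0 sube0.
  by apply/seteqP; split=> w /=; rewrite ltNge => /negP.
exists Q, W'; split=> // r r0.
pose G (y : R) := expR (- (r * Num.max y 0)).
have max0 (y : R) : 0 <= y -> Num.max y 0 = y by move/max_idPl.
have GW : \int[Q]_w expR (- (r * W' w)) = \int[Q]_w G (W' w).
  by apply: eq_Rintegral => w _; rewrite /G max0.
rewrite GW; apply: (@cvg_unique _ _ (\int[P]_w G (V n w) @[n --> U])) => //; last first.
  rewrite /= (_ : (fun n => _) = (fun n => \int[P]_w expR (- (r * V n w)))).
    exact: lapU.
  by apply/funext => n; apply: eq_Rintegral => w _; rewrite /G max0.
have cG : continuous G.
  move=> y; apply: continuous_comp; last exact: continuous_expR.
  apply: continuousN; apply: continuousM; first exact: cst_continuous.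
  by apply: continuous_max => //; exact: cst_continuous.
apply: (@helly_bray _ U _ _ _ _ _ _ P Q V W' mV Wgt0).
- move=> x /(cvg_fine_probP Q Q (fun y => measurable_set_le y (measurable_funPT W'))
    (measurable_set_le x (measurable_funPT W'))) cx.
  apply/(cvg_fine_probP P Q (fun n => measurable_set_le x (mV n))
    (measurable_set_le x (measurable_funPT W'))).
  (* At a continuity point the regularisation changes nothing: F y <= L x for y < x, and F y tends
     to F x from the left. *)
  rewrite QW /=; have -> : F x = L x; last exact: LP.
  apply/eqP; rewrite eq_le le_right_inf// andbT.
  have {}cx : F y @[y --> x] --> F x.
    move: cx; rewrite QW/=.
    by under eq_fun do rewrite QW/=.
  have cx' : F y @[y --> x^'-] --> F x by exact: cvg_at_left_filter.
  apply: ler_cvg_to cx' (cvg_cst (L x)) _.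
  near=> y; apply: right_inf_le => //.
- exact: continuous_measurable_fun.
- move=> y; rewrite expR_ge0 expR_le1 oppr_le0 mulr_ge0 ?(ltW r0)//.
  by rewrite le_max lexx orbT.
- by move=> y _; exact: cG.
- by move=> n; apply: measurableT_comp (mV n); exact: continuous_measurable_fun.
- move=> n w; rewrite expR_ge0 expR_le1 oppr_le0 mulr_ge0 ?(ltW r0)//.
  by rewrite le_max lexx orbT.
- by move=> u v e _ _ e0; apply: nearW => n w _; rewrite subrr normr0 ltW.
Unshelve. all: by end_near. Qed.

End laplace_limit.

(** * Independence *)

Section layers.
Context (R : realType).

Lemma count_below (m : nat) (c : R) : 0 <= c <= m%:R ->
  c <= \sum_(j < m) (j%:R < c)%R%:R <= c + 1.
Proof.
elim: m => [|m IH] /andP[c0 cm].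
  by rewrite big_ord0 cm addr_ge0.
rewrite big_ord_recr /=; have [mc|cm'] := ltP (m%:R : R) c.
  rewrite (eq_bigr (fun=> 1)) => [|i _]; last first.
    by rewrite (lt_trans _ mc)// ltr_nat.
  rewrite sumr_const card_ord; apply/andP; split.
    by rewrite /= natr1.
  by rewrite lerD2r ltW.
by rewrite addr0; apply: IH; rewrite c0.
Qed.

(* Sums of indicators, which reduce the product rule for means to that for
   events. *)
Definition layer (m : nat) (y : R) : R :=
  m.+1%:R^-1 * \sum_(j < m.+1) (j%:R / m.+1%:R < y)%R%:R.

Lemma layer_dist m y : 0 <= y <= 1 -> `|layer m y - y| <= m.+1%:R^-1.
Proof.
move=> /andP[y0 y1]; have m0 : 0 < m.+1%:R :> R by [].
have := @count_below m.+1 (m.+1%:R * y).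
rewrite mulr_ge0// -[X in _ <= X -> _]mulr1 ler_pM2l// y1 => /(_ isT).
rewrite (eq_bigr (fun j : 'I_m.+1 => (j%:R / m.+1%:R < y)%R%:R)); last first.
  by move=> j _; rewrite ltr_pdivrMr// mulrC.
have := layer m y; rewrite /layer; move: (\sum_(_ < _) _) => c _ /andP[c1 c2].
rewrite ler_distl; apply/andP; split.
  rewrite lerBlDr -(ler_pM2l m0) mulrDr mulVKf ?gt_eqF// mulfV ?gt_eqF//.
  by rewrite (le_trans c1)// lerDl.
rewrite -(ler_pM2l m0) mulrDr mulVKf ?gt_eqF// mulfV ?gt_eqF//.
Qed.

Lemma prod_dist01 (n : nat) (a b : 'I_n -> R) (e : R) :
  (forall i, 0 <= a i <= 1) -> (forall i, 0 <= b i <= 1) ->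
  (forall i, `|a i - b i| <= e) ->
  `|\prod_i a i - \prod_i b i| <= n%:R * e.
Proof.
elim: n a b => [|n IH] a b a01 b01 ab.
  by rewrite !big_ord0 subrr normr0 mul0r.
rewrite !big_ord_recl.
have -> : a ord0 * \prod_(i < n) a (lift ord0 i) - b ord0 * \prod_(i < n) b (lift ord0 i)
  = a ord0 * (\prod_(i < n) a (lift ord0 i) - \prod_(i < n) b (lift ord0 i)) +
    (a ord0 - b ord0) * \prod_(i < n) b (lift ord0 i) by ring.
have {}IH := IH (fun i => a (lift ord0 i)) (fun i => b (lift ord0 i))
  (fun i => a01 _) (fun i => b01 _) (fun i => ab _).
have /andP[a0 a1] := a01 ord0.
have : 0 <= \prod_(i < n) b (lift ord0 i) <= 1.
  apply/andP; split; first by apply: prodr_ge0 => i _; have /andP[] := b01 (lift ord0 i).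
  rewrite -[leRHS](_ : \prod_(i < n) (1 : R) = 1); last by rewrite big1.
  by apply: ler_prod => i _; exact: b01.
move=> /andP[p0 p1].
rewrite (le_trans (ler_normD _ _))// -[n.+1%:R]natr1 [leRHS]mulrDl mul1r !normrM lerD//.
  by rewrite (ger0_norm a0) (le_trans _ IH)// ler_piMl.
by rewrite (ger0_norm p0) (le_trans _ (ab ord0))// ler_piMr.
Qed.

Lemma eq_of_le_inv (a b c : R) :
  (forall m : nat, `|a - b| <= c * m.+1%:R^-1) -> a = b.
Proof.
move=> h; apply/eqP; rewrite -subr_eq0 -normr_le0; apply/ler_addgt0Pl => e e0.
rewrite addr0; have [c0|c0] := leP c 0.
  by rewrite (le_trans (h 0%N))// (le_trans _ (ltW e0))// mulr_le0_ge0.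
apply: (le_trans (h (Num.trunc (c / e)))).
rewrite ler_pdivrMr// mulrC -ler_pdivrMr// ltW//.
exact: truncnS_gt.
Qed.

End layers.

Section independence.
Context d (T : measurableType d) (R : realType) (P : probability T R).

Lemma layer01 m (y : R) : 0 <= layer m y <= 1.
Proof.
rewrite /layer mulr_ge0 ?sumr_ge0//= mulrC ler_pdivrMr// mul1r.
rewrite -[leRHS]mulr1 -[in leRHS](card_ord m.+1) mulr_natl -sumr_const.
by apply: ler_sum => j _; rewrite lern1 leq_b1.
Qed.

Lemma measurable_layer m (f : T -> R) :
  measurable_fun setT f -> measurable_fun setT (fun w => layer m (f w)).
Proof.
move=> mf; apply: measurable_funM => //; apply: measurable_sum => j.
rewrite (_ : (fun _ => _) = \1_[set w | j%:R / m.+1%:R < f w]).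
  by apply: measurable_indic; exact: measurable_set_gt.
by apply/funext => w; rewrite indic_pred.
Qed.

(** The layers of [h] are sums of indicators of events c < h, for which the product rule is assumed;
    passing to [h] costs 1 / (m + 1) on each side, hence the constant 2 below. *)
Lemma mean_mul_indic_indep (h : T -> R) (A : set T) :
  measurable_fun setT h -> (forall w, 0 <= h w <= 1) -> measurable A ->
  (forall c : R, P ([set w | c < h w] `&` A) = (P [set w | (c < h w)%R] * P A)%E) ->
  \int[P]_w (h w * \1_A w) = (\int[P]_w h w) * fine (P A).
Proof.
move=> mh h01 mA hA.
have bA : bounded_measurable (\1_A : T -> R) by exact: bounded_measurable_indic.
have bh : bounded_measurable h by exact: bounded_measurable01.
have bl m : bounded_measurable (fun w => layer m (h w)).
  by apply: bounded_measurable01 => [|w]; [exact: measurable_layer|exact: layer01].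
have bi (c : R) : bounded_measurable (fun w => (c < h w)%R%:R : R).
  rewrite (_ : (fun _ => _) = \1_[set w | c < h w]).
    by apply: bounded_measurable_indic; exact: measurable_set_gt.
  by apply/funext => w; rewrite indic_pred.
apply: (@eq_of_le_inv _ _ _ 2) => m.
have E : \int[P]_w (layer m (h w) * \1_A w) = (\int[P]_w layer m (h w)) * fine (P A).
  have -> : (fun w => layer m (h w) * \1_A w) = (fun w => m.+1%:R^-1 *
     \sum_(j < m.+1) (j%:R / m.+1%:R < h w)%R%:R * \1_A w).
    by apply/funext => w; rewrite /layer -mulrA mulr_suml.
  rewrite /layer !meanZ; last 2 first.
  - by apply: bounded_measurable_sum => j; exact: bi.
  - by apply: bounded_measurable_sum => j; exact: bounded_measurableM.
  rewrite -mulrA; congr (_ * _).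
  rewrite !mean_sum; last 2 first.
  - by move=> j; exact: bi.
  - by move=> j; exact: bounded_measurableM.
  rewrite mulr_suml; apply: eq_bigr => j _.
  have mj : measurable [set w | j%:R / m.+1%:R < h w] by exact: measurable_set_gt.
  transitivity (\int[P]_w \1_([set w | j%:R / m.+1%:R < h w] `&` A) w).
    by apply: eq_Rintegral => w _; rewrite indicI /= indic_pred.
  rewrite mean_indic; last exact: measurableI.
  rewrite hA fineM ?fin_num_measure//; congr (_ * _).
  rewrite -mean_indic//; apply: eq_Rintegral => w _; rewrite indic_pred//.
have d1 : `|\int[P]_w (h w * \1_A w) - \int[P]_w (layer m (h w) * \1_A w)|
    <= m.+1%:R^-1.
  rewrite -[leRHS](mean_cst P); apply: mean_dist.
  - exact: bounded_measurableM.
  - exact: bounded_measurableM.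
  - exact: bounded_measurable_cst.
  move=> w; rewrite -mulrBl normrM distrC.
  apply: le_trans (layer_dist m (h01 w)); rewrite ler_piMr// indicE normr_nat.
  by rewrite lern1 leq_b1.
have d2 : `|\int[P]_w layer m (h w) - \int[P]_w h w| <= m.+1%:R^-1.
  rewrite -[leRHS](mean_cst P); apply: mean_dist => //.
  - exact: bounded_measurable_cst.
  - by move=> w; exact: layer_dist.
rewrite -(subrKA (\int[P]_w (layer m (h w) * \1_A w))) (le_trans (ler_normD _ _))//.
rewrite mulr2n mulrDl mul1r lerD// E -mulrBl normrM.
apply: le_trans d2; rewrite ler_piMr// ger0_norm ?fine_prob_ge0//.
exact: fine_prob_le1.
Qed.

Context (X : nat -> {RV P >-> R}).
Hypothesis X_indep : mutually_independent X.

Lemma mean_prod_indic (B : nat -> set R) (n : nat) : (forall i, measurable (B i)) ->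
  \int[P]_w (\prod_(i < n) \1_(B i) (X i w)) =
  \prod_(i < n) fine (P (X i @^-1` B i)).
Proof.
move=> mB; pose J := seq_fset tt (iota 0 n).
have JE : perm_eq J (iota 0 n).
  by apply: uniq_perm; [exact: fset_uniq|exact: iota_uniq|exact: seq_fsetE].
have iE : index_iota 0 n = iota 0 n by rewrite /index_iota subn0.
transitivity (fine (P (\bigcap_(i in [set` J]) X i @^-1` B i))); last first.
  rewrite X_indep// (perm_big _ JE)/=.
  rewrite (eq_bigr (fun i => (fine (P (X i @^-1` B i)))%:E)); last first.
    by move=> i _; rewrite fineK// fin_num_measure//; exact: measurable_funPTI.
  by rewrite prodEFin/= -iE big_mkord.
rewrite -mean_indic; last first.
  by apply: fin_bigcap_measurable => // i _; exact: measurable_funPTI.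
apply: eq_Rintegral => w _; rewrite indicE.
have [wJ|wJ] := boolP (w \in _).
  rewrite big1// => i _; rewrite indicE mem_set//.
  move: wJ; rewrite inE => /(_ (i : nat)); apply.
  by rewrite /= seq_fsetE mem_iota ltn_ord.
have /existsNP[k /not_implyP[/= kJ kB]] : ~ (\bigcap_(i in [set` J]) X i @^-1` B i) w.
  by move=> h; move/negP : wJ; apply; rewrite inE.
have kn : (k < n)%N by move: kJ; rewrite seq_fsetE mem_iota.
by rewrite (bigD1 (Ordinal kn))//= indicE memNset ?mul0r.
Qed.

(** Replacing [g] by its layers turns each factor into a finite sum of indicators. Distributivity
    expands both sides over all choices of one layer per factor, where the product rule for events
    applies. *)
Lemma mean_prod_indep (g : R -> R) (n : nat) :
  measurable_fun setT g -> (forall y, 0 <= g y <= 1) ->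
  \int[P]_w (\prod_(i < n) g (X i w)) = \prod_(i < n) \int[P]_w g (X i w).
Proof.
move=> mg g01.
have mgX i : measurable_fun setT (fun w => g (X i w)).
  exact: measurableT_comp.
have bl m i : bounded_measurable (fun w => layer m (g (X i w))).
  by apply: bounded_measurable01 => [|w]; [exact: measurable_layer|exact: layer01].
have bg i : bounded_measurable (fun w => g (X i w)) by exact: bounded_measurable01.
apply: (@eq_of_le_inv _ _ _ (n%:R + n%:R)) => m.
have E : \int[P]_w (\prod_(i < n) layer m (g (X i w))) =
    \prod_(i < n) \int[P]_w layer m (g (X i w)).
  pose B (j : 'I_m.+1) := [set y | j%:R / m.+1%:R < g y].
  have mB j : measurable (B j) by exact: measurable_set_gt.
  pose F (i : nat) (j : 'I_m.+1) w : R := m.+1%:R^-1 * \1_(B j) (X i w).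
  have bF i j : bounded_measurable (F i j).
    apply: bounded_measurableM; first exact: bounded_measurable_cst.
    rewrite (_ : (fun _ => _) = \1_(X i @^-1` B j)).
      by apply: bounded_measurable_indic; exact: measurable_funPTI.
    by apply/funext => w; rewrite !indicE.
  have layerE i w : layer m (g (X i w)) = \sum_j F i j w.
    by rewrite /layer mulr_sumr; apply: eq_bigr => j _; rewrite /F indic_pred.
  under eq_Rintegral do under eq_bigr do rewrite layerE.
  under [RHS]eq_bigr do under eq_Rintegral do rewrite layerE.
  under eq_Rintegral do rewrite bigA_distr_bigA.
  rewrite mean_sum => [|f]; last by apply: bounded_measurable_prod => i; exact: bF.
  under [RHS]eq_bigr => i _ do rewrite (mean_sum _ _ (bF i)).
  rewrite bigA_distr_bigA; apply: eq_bigr => f _.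
  (* [mean_prod_indic] takes a family indexed by all naturals, so the choice is extended by the
     whole line beyond [n]. *)
  pose Bf (k : nat) : set R := oapp (fun i : 'I_n => B (f i)) setT (insub k).
  have BfE (i : 'I_n) : Bf i = B (f i) by rewrite /Bf valK.
  have mBf k : measurable (Bf k) by rewrite /Bf; case: insub => //= i.
  have -> : (fun w => \prod_(i < n) F i (f i) w) =
      (fun w => (m.+1%:R^-1) ^+ n * \prod_(i < n) \1_(Bf i) (X i w)).
    apply/funext => w; rewrite big_split/= prodr_const card_ord; congr (_ * _).
    by apply: eq_bigr => i _; rewrite BfE.
  rewrite meanZ; last first.
    apply: bounded_measurable_prod => i.
    rewrite (_ : (fun _ => _) = \1_(X i @^-1` Bf i)).
      by apply: bounded_measurable_indic; exact: measurable_funPTI.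
    by apply/funext => w; rewrite !indicE.
  have -> : m.+1%:R^-1 ^+ n = \prod_(i < n) (m.+1%:R^-1 : R).
    by rewrite prodr_const card_ord.
  rewrite mean_prod_indic// -big_split/=.
  apply: eq_bigr => i _; rewrite BfE /F.
  have mXB : measurable (X i @^-1` B (f i)) by exact: measurable_funPTI.
  rewrite -(mean_indic P mXB) -meanZ; last exact: bounded_measurable_indic.
  by apply: eq_Rintegral => w _; rewrite !indicE.
rewrite -(subrKA (\int[P]_w (\prod_(i < n) layer m (g (X i w))))).
rewrite (le_trans (ler_normD _ _))// mulrDl lerD//.
  rewrite -[leRHS](mean_cst P); apply: mean_dist.
  - by apply: bounded_measurable_prod.
  - by apply: bounded_measurable_prod.
  - exact: bounded_measurable_cst.
  move=> w; apply: prod_dist01 => i //; first exact: layer01.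
  by rewrite distrC; exact: layer_dist.
rewrite E; apply: prod_dist01 => i.
- by rewrite mean_ge0 ?mean_le1// => w; have /andP[] := layer01 m (g (X i w)).
- by rewrite mean_ge0 ?mean_le1// => w; have /andP[] := g01 (X i w).
rewrite -[leRHS](mean_cst P); apply: mean_dist => //.
- exact: bounded_measurable_cst.
- by move=> w; exact: layer_dist.
Qed.

Lemma measurable_random_index (N : T -> nat) (h : nat -> T -> R) :
  measurable_fun setT N -> (forall n, measurable_fun setT (h n)) ->
  measurable_fun setT (fun w => h (N w) w).
Proof.
move=> mN mh _ B mB; rewrite setTI.
have -> : (fun w => h (N w) w) @^-1` B =
    \bigcup_n ((N @^-1` [set n]) `&` (h n @^-1` B)).
  apply/seteqP; split=> [w /= hB|w [n _ /= [<-]]//].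
  by exists (N w).
apply: bigcup_measurable => n _; apply: measurableI.
  by rewrite -[X in measurable X]setTI; exact: mN.
by rewrite -[X in measurable X]setTI; exact: mh.
Qed.

Lemma eq_mean_fibers (N : T -> nat) (f g : T -> R) : measurable_fun setT N ->
  measurable_fun setT f -> measurable_fun setT g ->
  (forall w, 0 <= f w) -> (forall w, 0 <= g w) ->
  (forall n, \int[P]_(w in N @^-1` [set n]) (f w)%:E =
             \int[P]_(w in N @^-1` [set n]) (g w)%:E)%E ->
  \int[P]_w f w = \int[P]_w g w.
Proof.
move=> mN mf mg f0 g0 fg.
have mNn n : measurable (N @^-1` [set n]).
  by rewrite -[X in measurable X]setTI; exact: mN.
have TE : setT = \bigcup_n (N @^-1` [set n]).
  by apply/seteqP; split=> // w _; exists (N w).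
have tN : trivIset setT (fun n => N @^-1` [set n]).
  by move=> i j _ _ [w [/= <- <-]].
have E (h : T -> R) : measurable_fun setT h -> (forall w, 0 <= h w) ->
    (\int[P]_w (h w)%:E = \sum_(n <oo) \int[P]_(w in N @^-1` [set n]) (h w)%:E)%E.
  move=> mh h0; rewrite {1}TE ge0_integral_bigcup//.
    by rewrite -TE; exact/measurable_EFinP.
  by move=> w _; rewrite lee_fin.
rewrite /Rintegral !E//; congr fine; apply: eq_eseriesr => n _; exact: fg.
Qed.

(** Conditioning on [N]: on each fibre N = n the variable [h n] is independent of the event and may
    be replaced by its mean; countable additivity over the fibres concludes. *)
Lemma mean_random_index (N : T -> nat) (h : nat -> T -> R) :
  measurable_fun setT N -> (forall n, measurable_fun setT (h n)) ->
  (forall n w, 0 <= h n w <= 1) ->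
  (forall n (c : R), P ([set w | c < h n w] `&` N @^-1` [set n]) =
     (P [set w | (c < h n w)%R] * P (N @^-1` [set n]))%E) ->
  \int[P]_w h (N w) w = \int[P]_w (\int[P]_v h (N w) v).
Proof.
move=> mN mh h01 hN.
have mNn n : measurable (N @^-1` [set n]).
  by rewrite -[X in measurable X]setTI; exact: mN.
have h0 n w : 0 <= h n w by have /andP[] := h01 n w.
have bh n : bounded_measurable (h n) by exact: bounded_measurable01.
apply: (eq_mean_fibers mN).
- exact: measurable_random_index.
- by apply: (measurable_random_index (h := fun n _ => \int[P]_v h n v) mN).
- by [].
- by move=> w; exact: mean_ge0.
move=> n; transitivity (\int[P]_(w in N @^-1` [set n]) (h n w)%:E)%E.
  by apply: eq_integral => w; rewrite inE /= => ->.
transitivity (\int[P]_(w in N @^-1` [set n]) (\int[P]_v h n v)%:E)%E; last first.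
  by apply: eq_integral => w; rewrite inE /= => ->.
rewrite integral_cst// integral_mkcond.
rewrite (_ : (_ \_ _) = (fun w => (h n w * \1_(N @^-1` [set n]) w)%:E)).
  rewrite mean_EFin; last exact/bounded_measurableM/bounded_measurable_indic.
  rewrite mean_mul_indic_indep// EFinM; congr (_ * _)%E.
  exact: fineK (fin_num_measure P _ (mNn n)).
apply/funext => w; rewrite patchE indicE; case: ifPn => _; first by rewrite mulr1.
by rewrite mulr0.
Qed.

End independence.

(** * Regularly varying tails *)

Section regularly_varying_tail.
Context (R : realType) (alpha : R) (l H : R -> R).
Hypotheses (H_ni : forall x y, x <= y -> H y <= H x) (H_ge0 : forall x, 0 <= H x).
Hypothesis H_tail : pareto_type (fun x => 1 - H x) alpha l.

Let lpos : \forall x \near +oo, 0 < l x.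
Proof.
have [[[A [_ lA]] _] _] := H_tail; near=> x; apply: lA.
by near: x; apply: nbhs_pinfty_ge; exact: num_real.
Unshelve. all: by end_near. Qed.

Let HlE : (H x) / (x `^ (- alpha) * l x) @[x --> +oo] --> (1 : R).
Proof.
have [_] := H_tail.
by under eq_fun do rewrite opprB addrC subrK.
Qed.

Lemma tail_gt0 : \forall x \near +oo, 0 < H x.
Proof.
have /cvgr_gt := HlE => /(_ _ (@ltr01 R)) h.
near=> x.
have : 0 < H x / (x `^ (- alpha) * l x) by near: x; exact: h.
have x0 : 0 < x by near: x; apply: nbhs_pinfty_gt; exact: num_real.
have lx : 0 < l x by near: x; exact: lpos.
by rewrite pmulr_lgt0// invr_gt0 mulr_gt0// powR_gt0.
Unshelve. all: by end_near. Qed.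

(** The left-hand side factors as H (c b) / ((c b)^(-alpha) l (c b)), times l (c b) / l (b), times s
    b^(-alpha) l (b), times c^(-alpha); the first three factors tend to 1. A general filter allows
    both b = a and b = id with s = 1 / H. *)
Lemma tail_scaled_cvg (I : Type) (FF : set_system I) {FFF : Filter FF}
    (b s : I -> R) (c : R) : 0 < c ->
  b i @[i --> FF] --> +oo -> s i * b i `^ (- alpha) * l (b i) @[i --> FF] --> (1 : R) ->
  s i * H (b i * c) @[i --> FF] --> c `^ (- alpha).
Proof.
move=> c0 by_ sb.
have cb : c * b i @[i --> FF] --> +oo.
  exact: (cvg_comp b (fun x => c * x) by_ (gt0_cvgMry c0 cvg_id)).
have h1 : H (c * b i) / ((c * b i) `^ (- alpha) * l (c * b i)) @[i --> FF] --> (1 : R).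
  exact: (cvg_comp (fun i => c * b i) _ cb HlE).
have h2 : l (c * b i) / l (b i) @[i --> FF] --> (1 : R).
  have [[_ lc] _] := H_tail.
  exact: (cvg_comp b (fun x => l (c * x) / l x) by_ (lc c c0)).
have : H (c * b i) / ((c * b i) `^ (- alpha) * l (c * b i)) * (l (c * b i) / l (b i)) *
    (s i * b i `^ (- alpha) * l (b i)) * c `^ (- alpha) @[i --> FF] -->
    1 * 1 * 1 * c `^ (- alpha).
  by apply: cvgM; [apply: cvgM => //; exact: cvgM|exact: cvg_cst].
rewrite !mul1r; apply: cvg_trans; apply: near_eq_cvg.
have n1 : \forall i \near FF, 0 < b i.
  exact: (by_ _ (nbhs_pinfty_gt (num_real 0))).
have n2 : \forall i \near FF, 0 < l (b i) by exact: (by_ _ lpos).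
have n3 : \forall i \near FF, 0 < l (c * b i) by exact: (cb _ lpos).
near=> i.
have b0 : 0 < b i by near: i.
have l1 : 0 < l (b i) by near: i.
have l2 : 0 < l (c * b i) by near: i.
rewrite /= powRM ?ltW// mulrC [b i * c]mulrC.
have p1 : 0 < b i `^ (- alpha) by rewrite powR_gt0.
have p2 : 0 < c `^ (- alpha) by rewrite powR_gt0.
by field; rewrite !gt_eqF.
Unshelve. all: by end_near. Qed.

Let HQ c : 0 < c -> H (x * c) / H x @[x --> +oo] --> c `^ (- alpha).
Proof.
move=> c0.
have /(tail_scaled_cvg c0 (@cvg_id R +oo)) :
    (H x)^-1 * x `^ (- alpha) * l x @[x --> +oo] --> (1 : R).
  rewrite -[X in _ --> X]invr1.
  have -> : (fun x => (H x)^-1 * x `^ (- alpha) * l x) =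
      (fun x => (H x / (x `^ (- alpha) * l x))^-1).
    by apply/funext => x; rewrite invfM invrK mulrA.
  by apply: cvgV; [exact: oner_neq0|exact: HlE].
have -> // : (fun x => (H x)^-1 * H (x * c)) = (fun x => H (x * c) / H x).
by apply/funext => x; rewrite mulrC.
Qed.

(** The ratio H (2 x) / H x tends to 2^(-alpha), strictly above 2^(-q). Iterated, this controls the
    growth of [H] towards small arguments; the companion with q < alpha controls its decay. *)
Lemma tail_doubling (q : R) : alpha < q ->
  \forall x \near +oo, H x <= 2 `^ q * H (2 * x).
Proof.
move=> aq; have /cvgr_ge/(_ (2 `^ (- q))) := HQ (ltr0n R 2).
have q2 : 2 `^ (- q) < 2 `^ (- alpha) :> R.
  by rewrite -ltr_ln ?posrE ?powR_gt0// !ln_powR ltr_pM2r ?ltrN2// ln_gt0// ltr1n.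
move=> /(_ q2) h; near=> x.
have H0 : 0 < H x by near: x; exact: tail_gt0.
have : 2 `^ (- q) <= H (x * 2) / H x by near: x; exact: h.
by rewrite ler_pdivlMr// powRN mulrC ler_pdivrMr ?powR_gt0// mulrC (mulrC x 2).
Unshelve. all: by end_near. Qed.

Lemma tail_halving (q : R) : q < alpha ->
  \forall x \near +oo, H (2 * x) <= 2 `^ (- q) * H x.
Proof.
move=> aq; have /cvgr_le/(_ (2 `^ (- q))) := HQ (ltr0n R 2).
have q2 : 2 `^ (- alpha) < 2 `^ (- q) :> R.
  by rewrite -ltr_ln ?posrE ?powR_gt0// !ln_powR ltr_pM2r ?ltrN2// ln_gt0// ltr1n.
move=> /(_ q2) h; near=> x.
have H0 : 0 < H x by near: x; exact: tail_gt0.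
have : H (x * 2) / H x <= 2 `^ (- q) by near: x; exact: h.
by rewrite ler_pdivrMr// (mulrC x).
Unshelve. all: by end_near. Qed.

(* The easy half of Potter's theorem, where monotonicity replaces the uniform
   convergence theorem. *)
Lemma tail_potter (q x0 : R) : 0 <= q -> 0 < x0 ->
  (forall x, x0 <= x -> H x <= 2 `^ q * H (2 * x)) ->
  forall y b, x0 <= y -> y <= b -> H y <= (2 * b / y) `^ q * H b.
Proof.
move=> q0 x00 Hdbl y b x0y yb.
have y0 : 0 < y by exact: lt_le_trans x0y.
have [k bk] : exists k : nat, b <= 2 ^+ k * y.
  exists (Num.trunc (b / y)).+1; rewrite -ler_pdivrMr//.
  apply: (@le_trans _ _ (Num.trunc (b / y)).+1%:R); first by rewrite ltW// truncnS_gt.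
  by rewrite -natrX ler_nat ltnW// ltn_expl.
have mono u v : 0 <= u -> u <= v -> u `^ q <= v `^ q :> R.
  by move=> u0 uv; rewrite ge0_ler_powR// nnegrE// (le_trans u0).
elim: k y x0y yb y0 bk => [|k IH] y x0y yb y0 bk.
  have -> : b = y by apply/eqP; rewrite eq_le yb andbT; rewrite expr0 mul1r in bk.
  rewrite mulfK ?gt_eqF// ler_peMl//.
  by have := mono 1 2 ler01 (ltac:(by rewrite ler1n)); rewrite powR1.
apply: (le_trans (Hdbl _ x0y)).
(* Within one doubling of [b] monotonicity finishes, and the factor 2 inside 2 b / y pays for that
   doubling. *)
have [b2|b2] := leP b (2 * y).
  apply: ler_pM => //; rewrite ?powR_ge0//; last exact: H_ni.
  by apply: mono => //; rewrite -mulrA ler_pMr// ler_pdivlMr// mul1r.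
have IHy := IH (2 * y) _ (ltW b2) _ _.
apply: (@le_trans _ _ (2 `^ q * ((2 * b / (2 * y)) `^ q * H b))).
  rewrite ler_wpM2l ?powR_ge0// IHy//; first lra.
  - by rewrite mulr_gt0.
  - by rewrite mulrA -exprSr.
rewrite mulrA -powRM// ?divr_ge0 ?mulr_ge0//; try lra.
have -> : 2 * (2 * b / (2 * y)) = 2 * b / y by field; rewrite gt_eqF.
by [].
Qed.

Hypothesis H_le1 : forall x, H x <= 1.

(** Supplies the majorant for dominated convergence in [laplace_square_tail], where [x] becomes a
    square root, so that q < 2 means integrability at 0. *)
Lemma tail_dominated (a : R -> R) : 0 < alpha < 2 ->
  a t @[t --> +oo] --> +oo -> t * a t `^ (- alpha) * l (a t) @[t --> +oo] --> (1 : R) ->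
  exists C q : R, [/\ 0 <= C, 0 < q < 2 &
    \forall t \near +oo, forall x, 0 < x -> t * H (a t * x) <= C * (1 + x `^ (- q))].
Proof.
move=> /andP[al0 al2] ay an; pose q := (alpha + 2) / 2.
have aq : alpha < q by rewrite /q; lra.
have q02 : 0 < q < 2 by rewrite /q; lra.
have q0 : 0 <= q by lra.
have [x0 [x00 Hx0 Hdbl]] : exists x0, [/\ 0 < x0, 0 < H x0 &
    forall x, x0 <= x -> H x <= 2 `^ q * H (2 * x)].
  have [A [_ hA]] := tail_doubling aq; have [B [_ hB]] := tail_gt0.
  pose M := Num.max 0 (Num.max A B) + 1.
  have M0 : 0 < M by rewrite /M ltr_pwDr// le_max lexx.
  have MA : A < M by rewrite /M ltr_pwDr// !le_max lexx !orbT.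
  have MB : B < M by rewrite /M ltr_pwDr// !le_max lexx !orbT.
  exists M; split; [by []|exact: hB|move=> x Mx].
  by apply: hA; exact: lt_le_trans Mx.
have potter := tail_potter q0 x00 Hdbl.
pose K := 2 `^ q * 2.
have K0 : 0 <= K by rewrite mulr_ge0 ?powR_ge0.
(* One summand per regime: x >= 1 by monotonicity, x0 <= a t * x by Potter's bound, and a t * x < x0
   by H <= 1. *)
exists (2 + K + K / H x0), q; split=> //.
  by rewrite !addr_ge0// divr_ge0.
have tH : t * H (a t * 1) @[t --> +oo] --> (1 : R).
  by have := tail_scaled_cvg ltr01 ay an; rewrite powR1; exact.
near=> t => x x_gt0.
have t0 : 0 < t by near: t; apply: nbhs_pinfty_gt; exact: num_real.
have at0 : x0 <= a t by near: t; exact: (ay _ (nbhs_pinfty_ge (num_real x0))).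
have tH2 : t * H (a t) <= 2.
  by rewrite -[a t]mulr1; near: t; apply: (cvgr_le _ tH); rewrite ltr1n.
have at_gt0 : 0 < a t by exact: lt_le_trans at0.
have xq0 : 0 <= x `^ (- q) by exact: powR_ge0.
have KH : 0 <= K / H x0 by rewrite divr_ge0.
have b1 : 2 <= (2 + K + K / H x0) * (1 + x `^ (- q)) by nra.
have b2 : K * x `^ (- q) <= (2 + K + K / H x0) * (1 + x `^ (- q)) by nra.
have b3 : K / H x0 * x `^ (- q) <= (2 + K + K / H x0) * (1 + x `^ (- q)) by nra.
have [x1|x1] := leP 1 x.
  apply: le_trans b1; apply: le_trans tH2; rewrite ler_pM2l//.
  by apply: H_ni; rewrite ler_pMr.
have mono u v : 0 <= u -> u <= v -> u `^ q <= v `^ q :> R.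
  by move=> u0 uv; rewrite ge0_ler_powR// nnegrE// (le_trans u0).
have [ax|ax] := leP x0 (a t * x).
  apply: le_trans b2.
  have := potter (a t * x) (a t) ax (ltac:(by rewrite ler_piMr ?ltW)).
  have -> : 2 * a t / (a t * x) = 2 * x^-1 by field; rewrite !gt_eqF.
  rewrite powRM ?invr_ge0 ?(ltW x_gt0)// -powR_inv1 ?(ltW x_gt0)// -powRrM mulN1r => h.
  apply: (@le_trans _ _ (t * (2 `^ q * x `^ (- q) * H (a t)))); first by rewrite ler_pM2l.
  have -> : t * (2 `^ q * x `^ (- q) * H (a t)) = 2 `^ q * x `^ (- q) * (t * H (a t)) by ring.
  have -> : K * x `^ (- q) = 2 `^ q * x `^ (- q) * 2 by rewrite /K; ring.
  by rewrite ler_wpM2l// mulr_ge0// powR_ge0.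
(* The bound H <= 1 leaves [t] alone; Potter's bound between [x0] and [a t] then gives t H(x0) <= K
   x^(-q), because a t / x0 < 1 / x here. *)
apply: le_trans b3.
apply: (@le_trans _ _ t); first by rewrite ler_piMr// ltW.
have := potter x0 (a t) (lexx _) at0 => h.
have h2 : (2 * a t / x0) `^ q <= 2 `^ q * x `^ (- q).
  have -> : x `^ (- q) = x^-1 `^ q by rewrite -powR_inv1 ?(ltW x_gt0)// -powRrM mulN1r.
  rewrite -powRM ?invr_ge0 ?(ltW x_gt0)//; apply: mono.
    by rewrite divr_ge0 ?mulr_ge0 ?ltW.
  by rewrite -mulrA ler_pM2l// ler_pdivrMr// mulrC ler_pdivlMr// ltW.
have h3 : t * H x0 <= 2 `^ q * x `^ (- q) * 2.
  apply: (@le_trans _ _ (t * (2 `^ q * x `^ (- q) * H (a t)))).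
    by rewrite ler_pM2l// (le_trans h)// ler_wpM2r.
  have -> : t * (2 `^ q * x `^ (- q) * H (a t)) = 2 `^ q * x `^ (- q) * (t * H (a t)) by ring.
  by rewrite ler_wpM2l// mulr_ge0// powR_ge0.
by rewrite -mulrA mulrC -mulrA mulrC mulrA ler_pdivlMr// /K; lra.
Unshelve. all: by end_near. Qed.

End regularly_varying_tail.

(** * The Laplace transform of the square of a heavy-tailed variable *)

Section power_integrability.
Context (R : realType).
Notation mu := (@lebesgue_measure R).

Lemma measurable_expRN_powR (p : R) (D : set R) : measurable D ->
  measurable_fun D (fun x : R => expR (- x) * x `^ p).
Proof.
move=> mD; apply: measurable_funTS; apply: measurable_funM.
  by exact: measurableT_comp.
exact: measurable_powR.
Qed.

Lemma integral_expRN_itv (y : R) : 0 <= y ->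
  (\int[mu]_(x in `]0%R, y[) (expR (- x))%:E = (1 - expR (- y))%:E :> \bar R)%E.
Proof.
rewrite le_eqVlt => /predU1P[<-|y0].
  by rewrite set_itvoo0 integral_set0 oppr0 expR0 subrr.
have mf (D : set R) : measurable D -> measurable_fun D (fun x : R => (expR (- x))%:E).
  move=> mD; apply: measurable_funTS; apply/measurable_EFinP.
  by exact: measurableT_comp.
rewrite integral_itv_bndo_bndc; last exact: mf.
rewrite integral_itv_obnd_cbnd; last exact: mf.
have := exponential_prob_itv0c 1 y0.
rewrite mulN1r EFinB => <-; apply: eq_integral => x.
rewrite inE/= in_itv/= => /andP[x0 _].
by rewrite exponential_pdfE// mul1r mulN1r.
Qed.

(** The bound, from the primitive x^(1 - p) / (1 - p), does not depend on [c], which can thus be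
    sent to 0. *)
Lemma integral_powR_le (p c : R) : 0 < p < 1 -> 0 < c < 1 ->
  (\int[mu]_(x in `[c, 1%R]) (x `^ (- p))%:E <= ((1 - p)^-1)%:E)%E.
Proof.
move=> /andP[p0 p1] /andP[c0 c1].
pose F (x : R) := (1 - p)^-1 * x `^ (1 - p).
have p10 : 1 - p != 0 by rewrite subr_eq0 eq_sym lt_eqF.
have dpow (x : R) : 0 < x -> derivable (fun y : R => y `^ (1 - p)) x 1.
  by move=> x0; apply: derivable_powR; rewrite in_itv/= x0.
have dF (x : R) : 0 < x -> derivable F x 1.
  by move=> x0; apply: derivableM => //; exact: dpow.
have F' (x : R) : 0 < x -> derive1 F x = x `^ (- p).
  move=> x0; rewrite derive1E deriveM//; last exact: dpow.
  rewrite derive_cst scaler0 addr0 -derive1E powR_derive1 ?in_itv/= ?x0//.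
  rewrite /GRing.scale/= mulrA mulVf// mul1r; congr (_ `^ _); ring.
have cF (x : R) : 0 < x -> {for x, continuous F}.
  by move=> x0; apply: differentiable_continuous; apply/derivable1_diffP; exact: dF.
have cpow (x : R) : 0 < x -> {for x, continuous (fun y : R => y `^ (- p))}.
  move=> x0; apply: differentiable_continuous; apply/derivable1_diffP.
  by apply: derivable_powR; rewrite in_itv/= x0.
rewrite (@continuous_FTC2 R _ F)//.
- rewrite -EFinB lee_fin /F powR1 mulr1 lerBlDr lerDl mulr_ge0 ?powR_ge0// invr_ge0.
  by rewrite subr_ge0 ltW.
- apply: continuous_in_subspaceT => x; rewrite inE/= in_itv/= => /andP[cx _].
  by apply: cpow; exact: lt_le_trans cx.
- split.
  + move=> x; rewrite in_itv/= => /andP[cx _].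
    by apply: dF; exact: lt_trans cx.
  + by apply: cvg_at_right_filter; exact: cF.
  + by apply: cvg_at_left_filter; exact: cF.
- move=> x; rewrite in_itv/= => /andP[cx _].
  by apply: F'; exact: lt_trans cx.
Qed.

Lemma integrable_expRN_powR (p : R) : 0 < p < 1 ->
  mu.-integrable `]0, +oo[ (EFin \o (fun x : R => expR (- x) * x `^ (- p))).
Proof.
move=> p01; have /andP[p0 p1] := p01.
have f0 (x : R) : 0 <= expR (- x) * x `^ (- p) by rewrite mulr_ge0 ?expR_ge0 ?powR_ge0.
have mf (D : set R) : measurable D ->
    measurable_fun D (fun x : R => (expR (- x) * x `^ (- p))%:E).
  by move=> mD; apply/measurable_EFinP; exact: measurable_expRN_powR.
apply/integrableP; split; first exact: mf.
under eq_integral do rewrite /= ger0_norm//.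
rewrite (@itv_bndbnd_setU _ _ _ (BRight 1)) ?bnd_simp//.
rewrite ge0_integral_setU//=; last 3 first.
- by apply: (mf (`]0, 1] `|` `]1, +oo[)%classic); exact: measurableU.
- by move=> x _; rewrite lee_fin.
- by apply/disj_setPS => x /= []; rewrite !in_itv/= => /andP[_ x1] /andP[]; lra.
apply: lte_add_pinfty.
  apply: (@le_lt_trans _ _ (((1 - p)^-1)%:E)%E); last exact: ltry.
  (* The denominators start at 2 because [integral_powR_le] asks for a left end strictly below 1. *)
  pose S n : set R := `[n.+2%:R^-1, 1]%classic.
  have US : `]0, 1]%classic = \bigcup_n S n.
    apply/seteqP; split=> [x /=|x [n _]]; rewrite /S /= !in_itv/=.
      move=> /andP[x0 x1]; exists (Num.trunc x^-1) => //=.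
      rewrite in_itv/= x1 andbT -[leRHS]invrK lef_pV2 ?posrE ?invr_gt0//.
      rewrite (@le_trans _ _ (Num.trunc x^-1).+1%:R)//; first by rewrite ltW// truncnS_gt.
      by rewrite ler_nat.
    by move=> /andP[x0 ->]; rewrite andbT (lt_le_trans _ x0)// invr_gt0.
  rewrite US.
  have ndS : nondecreasing_seq S.
    move=> m n mn; apply/subsetPset => x; rewrite /S /= !in_itv/= => /andP[mx ->].
    by rewrite andbT (le_trans _ mx)// lef_pV2 ?posrE// ler_nat !ltnS.
  have mS n : measurable (S n) by rewrite /S.
  have cS := ge0_nondecreasing_set_cvg_integral (mu := mu) ndS mS
    (fun n => mf _ (mS n)) (fun n x _ => ltac:(by rewrite lee_fin)).
  rewrite -(cvg_lim _ cS)//; apply: lime_le; first by apply/cvg_ex; eexists; exact: cS.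
  apply: nearW => n.
  have cn : 0 < (n.+2%:R^-1 : R) < 1 by rewrite invr_gt0 ltr0n invf_lt1// ltr1n.
  apply: le_trans (integral_powR_le p01 cn); apply: ge0_le_integral => //.
  - exact: mS.
  - by move=> x _; rewrite lee_fin.
  - exact: mf.
  - by apply/measurable_EFinP; apply: measurable_funTS; exact: measurable_powR.
  - move=> x; rewrite /S /= in_itv/= => /andP[x0 _].
    by rewrite lee_fin ler_piMl ?powR_ge0// expR_le1 oppr_le0 (le_trans _ x0).
apply: (@le_lt_trans _ _ (\int[mu]_(x in `]1%R, +oo[) (exponential_pdf 1 x)%:E)%E).
  have mp (D : set R) : measurable D ->
      measurable_fun D (fun x : R => (exponential_pdf 1 x)%:E).
    by move=> mD; apply: measurable_funTS; apply/measurable_EFinP; exact: measurable_exponential_pdf.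
  apply: ge0_le_integral => //.
  - by move=> x _; rewrite lee_fin.
  - exact: mf.
  - exact: mp.
  - move=> x; rewrite /= in_itv/= andbT => x1; have x0 : 0 <= x by lra.
    rewrite lee_fin exponential_pdfE// mul1r mulN1r ler_piMr ?expR_ge0//.
    by rewrite powRN invf_le1 ?powR_gt0 -?[leLHS](powRr0 x) ?ler_powR//; lra.
apply: (@le_lt_trans _ _ (\int[mu]_x (exponential_pdf 1 x)%:E)%E).
  apply: ge0_subset_integral => //.
    by apply/measurable_EFinP; exact: measurable_exponential_pdf.
  by move=> x _; rewrite lee_fin exponential_pdf_ge0.
by rewrite integral_exponential_pdf// ltry.
Qed.

Lemma integrable_expRN : mu.-integrable `]0, +oo[ (EFin \o (fun x : R => expR (- x))).
Proof.
apply: (@eq_integrable _ _ _ mu _ _ (EFin \o exponential_pdf 1)) => //.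
  move=> x; rewrite inE/= in_itv/= andbT => x0.
  by rewrite exponential_pdfE ?mul1r ?mulN1r// ltW.
apply: (@integrableS _ _ _ mu setT) => //.
exact: integrable_exponential_pdf.
Qed.

End power_integrability.

Section laplace_of_squares.
Context d (T : measurableType d) (R : realType) (P : probability T R).
Notation mu := (@lebesgue_measure R).

(* Fubini with the exponential law: [1 - exp (- y)] is the mass that it gives
   to [0, y[. *)
Lemma mean_one_sub_expRN (Y : T -> R) :
  measurable_fun setT Y -> (forall w, 0 <= Y w) ->
  (\int[P]_w (1 - expR (- Y w))%:E =
   \int[mu]_(x in `]0%R, +oo[) (expR (- x) * fine (P [set w | (x < Y w)%R]))%:E)%E.
Proof.
move=> mY Y0.
pose f (z : T * R) : R := (expR (- z.2) * \1_[set v : T * R | 0 < v.2] z) *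
  \1_[set v : T * R | 0 < Y v.1 - v.2] z.
have f0 z : 0 <= f z by rewrite !mulr_ge0 ?expR_ge0// indicE.
have mf : measurable_fun setT f.
  apply: measurable_funM; first apply: measurable_funM.
  - by apply: measurableT_comp => //; exact: measurableT_comp.
  - by apply: measurable_indic; apply: measurable_set_gt.
  - apply: measurable_indic; apply: measurable_set_gt.
    by apply: measurable_funB => //; exact: (measurableT_comp mY).
have mfE : measurable_fun setT (EFin \o f) by exact/measurable_EFinP.
have fE0 z : (0 <= (EFin \o f) z)%E by rewrite lee_fin.
transitivity (\int[P]_w \int[mu]_x (f (w, x))%:E)%E.
  apply: eq_integral => w _; rewrite -integral_expRN_itv//.
  rewrite integral_mkcond; apply: eq_integral => x _.
  rewrite patchE /f /= !indic_pred /= subr_gt0 mem_setE in_itv/=.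
  by case: (0 < x); case: (x < Y w); rewrite /= ?mulr1 ?mulr0 ?mul0r.
rewrite (@fubini_tonelli _ _ _ _ _ P mu (EFin \o f) mfE fE0).
rewrite [RHS]integral_mkcond; apply: eq_integral => x _.
rewrite patchE; have [/=|/=] := boolP (x \in `]0, +oo[%classic).
  rewrite inE/= in_itv/= andbT => x0.
  transitivity (\int[P]_w ((expR (- x))%:E * (\1_[set w | x < Y w] w)%:E))%E.
    apply: eq_integral => w _; rewrite /f/= -EFinM !indic_pred /= subr_gt0.
    by rewrite x0 mulr1.
  rewrite ge0_integralZl//=; do ?[by rewrite lee_fin expR_ge0
    | by apply/measurable_EFinP/measurable_indic/measurable_set_gt
    | by move=> w _; rewrite lee_fin indicE].
  have mx : measurable [set w | x < Y w] by exact: measurable_set_gt.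
  rewrite integral_indic// setIT EFinM; congr (_ * _)%E.
  by rewrite fineK// fin_num_measure.
rewrite mem_setE in_itv/= andbT => x0; rewrite integral0_eq// => w _.
by rewrite /f /= indic_pred /= (negPf x0) mulr0 mul0r.
Qed.

Context (X : T -> R) (alpha : R) (l a : R -> R).
Hypothesis mX : measurable_fun setT X.
Let H (y : R) := fine (P [set w | y < `|X w|]).
Hypothesis H_tail : pareto_type (fun x => 1 - H x) alpha l.
Hypothesis alpha02 : 0 < alpha < 2.
Hypotheses (a_infty : a t @[t --> +oo] --> +oo)
  (a_norm : t * a t `^ (- alpha) * l (a t) @[t --> +oo] --> (1 : R)).

Let mnX : measurable_fun setT (fun w => `|X w|).
Proof. exact: measurableT_comp. Qed.

Let H_ni x y : x <= y -> H y <= H x.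
Proof.
move=> xy; apply: le_fine_prob; [exact: measurable_set_gt..|].
by move=> w /=; exact: le_lt_trans.
Qed.

Let H_ge0 x : 0 <= H x. Proof. exact: fine_prob_ge0. Qed.

Let H_le1 x : H x <= 1.
Proof. by apply: fine_prob_le1; exact: measurable_set_gt. Qed.

Let one_sub_mean (s b : R) : 0 < s -> 0 < b ->
  (1 - \int[P]_w expR (- (s / b ^+ 2 * X w ^+ 2)))%:E =
  (\int[mu]_(x in `]0%R, +oo[) (expR (- x) * H (b * Num.sqrt (x / s)))%:E)%E.
Proof.
move=> s0 b0.
have sb0 : 0 < s / b ^+ 2 by rewrite divr_gt0// exprn_gt0.
pose Y w := s / b ^+ 2 * X w ^+ 2.
have mY : measurable_fun setT Y by apply: measurable_funM => //; exact: measurable_funX.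
have Y0 w : 0 <= Y w by rewrite mulr_ge0 ?sqr_ge0// ltW.
transitivity (\int[P]_w (1 - expR (- Y w))%:E)%E.
  rewrite mean_EFin.
    rewrite meanB ?mean_cst//; first exact: bounded_measurable_cst.
    by apply: bounded_measurable_expRN => //; exact: measurable_funX.
  apply: bounded_measurableB; first exact: bounded_measurable_cst.
  by apply: bounded_measurable_expRN => //; exact: measurable_funX.
rewrite mean_one_sub_expRN//; apply: eq_integral => x.
rewrite inE/= in_itv/= andbT => x0; congr (_ * fine (P _))%:E.
apply/seteqP; suff E w : (x < Y w) = (b * Num.sqrt (x / s) < `|X w|).
  by split=> w /=; rewrite E.
rewrite -ltr_pdivlMl// -[X in _ = X](ltr_pXn2r (n := 2))// ?nnegrE ?mulr_ge0 ?invr_ge0 ?(ltW b0) ?sqrtr_ge0//.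
rewrite sqr_sqrtr ?divr_ge0 ?ltW//.
rewrite exprMn -normrX ger0_norm ?sqr_ge0// /Y ltr_pdivrMr//.
by rewrite exprVn mulrC; congr (_ < _); ring.
Qed.

(** By [one_sub_mean] the left-hand side is the integral of exp (- x) t H (a t sqrt (x / s)); the
    tail converges pointwise to (x / s)^(-alpha / 2), and the Gamma integral appears in the
    limit. *)
Lemma laplace_square_tail (s : R) : 0 < s ->
  t * (1 - \int[P]_w expR (- (s / a t ^+ 2 * X w ^+ 2))) @[t --> +oo] -->
  Gamma (1 - alpha / 2) * s `^ (alpha / 2).
Proof.
(* Dominated convergence concerns sequences, so the limit is tested along sequences tending to
   infinity. *)
move=> s0; apply/cvg_pinftyP => u uy.
have [C [q [C0 q02 dom]]] := tail_dominated H_ni H_ge0 H_tail H_le1 alpha02 a_infty a_norm.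
pose D : set R := `]0, +oo[%classic.
have [N uN] : exists N, forall n, (N <= n)%N -> [/\ 0 < u n, 0 < a (u n) &
    forall x, 0 < x -> u n * H (a (u n) * x) <= C * (1 + x `^ (- q))].
  have : \forall t \near +oo, [/\ 0 < t, 0 < a t &
      forall x, 0 < x -> t * H (a t * x) <= C * (1 + x `^ (- q))].
    near=> t; split.
    - by near: t; exact: nbhs_pinfty_gt (num_real 0).
    - by near: t; exact: (a_infty (nbhs_pinfty_gt (num_real 0))).
    - by near: t; exact: dom.
  by move=> /uy [N _ NP]; exists N => n Nn; exact: NP.
(* The shift makes positivity and domination hold for every index, not just eventually. *)
pose v n := u (n + N)%N.
have vP n : [/\ 0 < v n, 0 < a (v n) &
    forall x, 0 < x -> v n * H (a (v n) * x) <= C * (1 + x `^ (- q))].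
  by apply: uN; exact: leq_addl.
have vy : v n @[n --> \oo] --> +oo by exact: (cvg_comp _ _ (cvg_addnr N) uy).
rewrite -(cvg_shiftn N).
pose f n (x : R) := (expR (- x) * (v n * H (a (v n) * Num.sqrt (x / s))))%:E.
(* The majorant C (1 + y^(-q)) at y = sqrt (x / s), weighted by exp (- x). *)
pose g (x : R) := (C * (expR (- x) + expR (- x) * x `^ (- (q / 2)) * s `^ (q / 2)))%:E.
pose fl (x : R) := (expR (- x) * x `^ (- (alpha / 2)) * s `^ (alpha / 2))%:E.
have mH (b : R) : measurable_fun setT (fun x : R => H (b * Num.sqrt (x / s))).
  apply: (measurableT_comp (f := H)).
    have -> : H = (fun x => - (- H x)) by apply/funext => x; rewrite opprK.
    apply: measurableT_comp => //.
    by apply: nondecreasing_measurable => // x y xy; rewrite lerN2; exact: H_ni.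
  apply: measurable_funM => //; apply: measurableT_comp.
    by apply: continuous_measurable_fun; exact: sqrt_continuous.
  exact: measurable_funM.
have mD : measurable D by exact: measurable_itv.
have mf n : measurable_fun D (f n).
  apply/measurable_EFinP/measurable_funTS; apply: measurable_funM.
    by exact: measurableT_comp.
  by apply: measurable_funM.
have xs0 x : D x -> 0 < x / s by rewrite /D/= in_itv/= andbT => x0; rewrite divr_gt0.
have ffl x : D x -> f ^~ x @ \oo --> fl x.
  move=> Dx; have x0 : 0 < x by move: Dx; rewrite /D/= in_itv/= andbT.
  apply: cvg_EFin; first exact: nearW.
  rewrite /= -mulrA; apply: cvgMr.
  have := tail_scaled_cvg H_tail (c := Num.sqrt (x / s)).
  rewrite sqrtr_gt0 xs0// => /(_ R +oo _ a id isT a_infty a_norm).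
  rewrite -powR12_sqrt; last by rewrite ltW// xs0.
  rewrite -powRrM.
  have -> : (x / s) `^ (2^-1 * - alpha) = x `^ (- (alpha / 2)) * s `^ (alpha / 2).
    rewrite powRM ?invr_ge0 ?ltW//; congr (_ * _); first by congr (_ `^ _); ring.
    rewrite -(powR_inv1 (ltW s0)) -powRrM; congr (_ `^ _); ring.
  rewrite powR12_sqrt; last by rewrite ltW// xs0.
  by move=> h; exact: (cvg_comp _ _ vy h).
have ig : mu.-integrable D g.
  have q2 : 0 < q / 2 < 1 by lra.
  have i1 := @integrable_expRN R.
  have i2 := integrable_expRN_powR q2.
  have -> : g = (fun x : R => C%:E * ((expR (- x))%:E +
      (s `^ (q / 2))%:E * (expR (- x) * x `^ (- (q / 2)))%:E))%E.
    by apply/funext => x; rewrite /g EFinM EFinD (mulrC _ (s `^ _)) (EFinM (s `^ _)).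
  by apply: integrableZl => //; apply: integrableD => //; exact: integrableZl.
have fg n x : D x -> (`|f n x| <= g x)%E.
  move=> Dx; have x0 : 0 < x by move: Dx; rewrite /D/= in_itv/= andbT.
  have [v0 av0 vdom] := vP n.
  rewrite /f /g abse_EFin lee_fin ger0_norm; last first.
    by rewrite mulr_ge0 ?expR_ge0// mulr_ge0// ltW.
  have -> : C * (expR (- x) + expR (- x) * x `^ (- (q / 2)) * s `^ (q / 2)) =
      expR (- x) * (C * (1 + x `^ (- (q / 2)) * s `^ (q / 2))) by ring.
  rewrite ler_pM2l ?expR_gt0//.
  have -> : x `^ (- (q / 2)) * s `^ (q / 2) = Num.sqrt (x / s) `^ (- q).
    rewrite -powR12_sqrt; last by rewrite ltW// xs0.
    rewrite -powRrM powRM ?invr_ge0 ?ltW//; congr (_ * _); first by congr (_ `^ _); ring.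
    rewrite -(powR_inv1 (ltW s0)) -powRrM; congr (_ `^ _); ring.
  by apply: vdom; rewrite sqrtr_gt0 xs0.
have mfl : measurable_fun D fl.
  apply/measurable_EFinP; apply: measurable_funM => //.
  exact: measurable_expRN_powR.
have [||_ _ cv] := @dominated_convergence _ _ _ mu D mD f fl g mf mfl _ ig.
- exact: aeW.
- by apply: aeW => x n; exact: fg.
have fE n : (v n * (1 - \int[P]_w expR (- (s / a (v n) ^+ 2 * X w ^+ 2))))%:E =
    (\int[mu]_(x in D) f n x)%E.
  have [v0 av0 _] := vP n.
  rewrite EFinM one_sub_mean// -ge0_integralZl//.
  - by apply: eq_integral => x _; rewrite /f -EFinM; congr EFin; ring.
  - apply/measurable_EFinP/measurable_funTS; apply: measurable_funM; last exact: mH.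
    exact: measurableT_comp.
  - by move=> x _; rewrite lee_fin mulr_ge0 ?expR_ge0.
  - by rewrite lee_fin ltW.
have flE : (\int[mu]_(x in D) fl x)%E = (Gamma (1 - alpha / 2) * s `^ (alpha / 2))%:E.
  have al2 : 0 < alpha / 2 < 1 by have /andP[? ?] := alpha02; apply/andP; split; lra.
  have i2 := integrable_expRN_powR al2.
  rewrite mulrC EFinM /Gamma /Rintegral fineK; last first.
    apply: integrable_fin_num => //; apply: eq_integrable i2 => // x _.
    by rewrite /= mulrC; congr (_ `^ _ * _)%:E; ring.
  rewrite -ge0_integralZl//.
  - apply: eq_integral => x _; rewrite /fl -EFinM; congr EFin.
    rewrite mulrC; congr (_ * _); rewrite mulrC; congr (_ `^ _ * _); ring.
  - apply/measurable_EFinP; apply: measurable_funM.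
      by apply: measurable_funTS; exact: measurable_powR.
    by apply: measurable_funTS; exact: measurableT_comp.
  - by move=> x _; rewrite lee_fin mulr_ge0 ?expR_ge0 ?powR_ge0.
  - by rewrite lee_fin powR_ge0.
rewrite flE in cv.
have {}cv : (v n * (1 - \int[P]_w expR (- (s / a (v n) ^+ 2 * X w ^+ 2))))%:E @[n --> \oo] -->
    (Gamma (1 - alpha / 2) * s `^ (alpha / 2))%:E.
  by under eq_fun do rewrite fE.
exact: (fine_cvg cv).
Unshelve. all: by end_near. Qed.

End laplace_of_squares.

(** * Identically distributed variables and the weak law *)

Section equal_laws.
Context d (T : measurableType d) (R : realType) (P : probability T R)
  (X Y : {RV P >-> R}).
Hypothesis XY : forall x : R, cdf X x = cdf Y x.

(** Half-open intervals form a generating class stable under intersection, and their measure is a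
    difference of two values of the distribution function. *)
Lemma eq_cdf_distribution (A : set R) : measurable A ->
  distribution P X A = distribution P Y A.
Proof.
apply: (@measure_unique _ R R (@ocitv R) (fun n => `]- n%:R, n%:R]%classic)).
- by [].
- exact: ocitvI.
- by move=> n; exact: is_ocitv.
- apply/seteqP; split=> // x _; exists (Num.trunc `|x|).+1 => //=.
  have := truncnS_gt `|x|; rewrite in_itv/= ltr_norml => /andP[-> /ltW ->].
  by [].
- move=> _ [[a b] _ <-] /=.
  have [ab|ba] := ltP a b; last by rewrite set_itv_ge ?measure0// bnd_simp -leNgt.
  have E : `]a, b]%classic = `]-oo, b] `\` `]-oo, a] :> set R.
    by rewrite -[RHS]setCK setCD setCitvl setUC -[LHS]setCK setCitv.
  have sub : `]-oo, a]%classic `<=` (`]-oo, b]%classic : set R).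
    by apply: subset_itvl; rewrite bnd_simp ltW.
  rewrite E !measureD ?setIidr//; last 2 first.
  - by rewrite -ge0_fin_numE// fin_num_measure.
  - by rewrite -ge0_fin_numE// fin_num_measure.
  by congr (_ - _)%E; exact: XY.
- by move=> n; rewrite -ge0_fin_numE// fin_num_measure.
Qed.

Lemma eq_cdf_mean (g : R -> R) : measurable_fun setT g -> (forall y, 0 <= g y) ->
  \int[P]_w g (X w) = \int[P]_w g (Y w).
Proof.
move=> mg g0; have E (Z : {RV P >-> R}) :
    (\int[P]_w (g (Z w))%:E = \int[distribution P Z]_y (g y)%:E)%E.
  by rewrite ge0_integral_distribution//; exact/measurable_EFinP.
rewrite /Rintegral !E; congr fine; apply: eq_measure_integral => A mA _.
exact: eq_cdf_distribution.
Qed.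

End equal_laws.

Section finite_mean.
Context d (T : measurableType d) (R : realType) (P : probability T R).
Context (X : T -> R) (alpha : R) (l : R -> R).
Hypothesis mX : measurable_fun setT X.
Let H (y : R) := fine (P [set w | y < `|X w|]).
Hypothesis H_tail : pareto_type (fun x => 1 - H x) alpha l.
Hypothesis alpha_gt1 : 1 < alpha.

(** With 1 < q < alpha, halving gives H (2^k x0) <= 2^(-q k), so the dyadic sum of 2^k H (2^k x0) is
    dominated by a geometric series of ratio 2^(1 - q) < 1. It bounds the truncated means, and
    monotone convergence concludes. *)
Lemma integrable_pareto : P.-integrable setT (EFin \o X).
Proof.
have mnX : measurable_fun setT (fun w => `|X w|) by exact: measurableT_comp.
have H_ge0 x : 0 <= H x by exact: fine_prob_ge0.
have H_le1 x : H x <= 1 by apply: fine_prob_le1; exact: measurable_set_gt.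
have al1 := alpha_gt1; pose q := (1 + alpha) / 2.
have q1 : 1 < q by rewrite /q; lra.
have qa : q < alpha by rewrite /q; lra.
have [x0 x00 Hx0] : exists2 x0, 0 < x0 & forall x, x0 <= x -> H (2 * x) <= 2 `^ (- q) * H x.
  have [A [_ hA]] := tail_halving H_tail qa.
  exists (Num.max A 0 + 1); first by rewrite ltr_pwDr// le_max lexx orbT.
  move=> x Ax; apply: hA; apply: lt_le_trans Ax.
  by rewrite ltr_pwDr// le_max lexx.
pose r : R := 2 `^ (- q).
have r0 : 0 < r by rewrite powR_gt0.
have Hk k : H (2 ^+ k * x0) <= r ^+ k.
  elim: k => [|k IH]; first by rewrite !expr0 mul1r.
  rewrite exprS -mulrA exprS; apply: le_trans (Hx0 _ _) _.
    by rewrite ler_peMl ?(ltW x00)// exprn_ege1// ler1n.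
  by rewrite ler_wpM2l// ltW.
have rho1 : 2 * r < 1.
  rewrite /r -[X in X * _](powRr1 (a := 2))// -powRD; last by rewrite pnatr_eq0 implybT.
  by rewrite -[ltRHS](powRr0 2) -ltr_ln ?posrE ?powR_gt0// !ln_powR ltr_pM2r ?ln_gt0 ?ltr1n//; lra.
pose rho := 2 * r.
have rho0 : 0 < rho by rewrite mulr_gt0.
pose f n w := Num.min `|X w| (2 ^+ n * x0).
have f0 n w : 0 <= f n w.
  by rewrite le_min normr_ge0/= mulr_ge0 ?exprn_ge0// ltW.
have mf n : measurable_fun setT (f n) by exact: measurable_minr.
have bf n : bounded_measurable (f n).
  split=> //; exists (2 ^+ n * x0) => w; rewrite ger0_norm//.
  by rewrite ge_min lexx orbT.
pose B := x0 + x0 / (1 - rho).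
have rho1' : 0 < 1 - rho by rewrite subr_gt0.
have Mn n : \int[P]_w f n w <= x0 + x0 * ((1 - rho ^+ n) / (1 - rho)).
  elim: n => [|n IH].
    rewrite expr0 subrr mul0r mulr0 addr0 -[leRHS](mean_cst P).
    apply: le_mean => //; first exact: bounded_measurable_cst.
    by move=> w; rewrite /f expr0 mul1r ge_min lexx orbT.
  (* Raising the truncation level from p = 2^n x0 to 2 p adds at most p, and only where |X| exceeds
     p. *)
  have step : \int[P]_w f n.+1 w <= \int[P]_w f n w + (2 ^+ n * x0) * H (2 ^+ n * x0).
    have mA : measurable [set w | 2 ^+ n * x0 < `|X w|] by exact: measurable_set_gt.
    have bA : bounded_measurable (\1_[set w | 2 ^+ n * x0 < `|X w|] : T -> R).
      exact: bounded_measurable_indic.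
    rewrite /H -mean_indic// -meanZ// -meanD//; last first.
      by apply: bounded_measurableM => //; exact: bounded_measurable_cst.
    apply: le_mean => //.
      apply: bounded_measurableD => //; apply: bounded_measurableM => //.
      exact: bounded_measurable_cst.
    move=> w; rewrite indic_pred /f exprS -mulrA.
    have p0 : 0 < 2 ^+ n * x0 by rewrite mulr_gt0// exprn_gt0.
    move: (2 ^+ n * x0) p0 => p p0.
    case: (ltP p `|X w|) => pX /=.
      by rewrite mulr1 ge_min; apply/orP; right; lra.
    by rewrite mulr0 addr0 ge_min lexx.
  apply: le_trans step _.
  have : (2 ^+ n * x0) * H (2 ^+ n * x0) <= x0 * rho ^+ n.
    rewrite /rho exprMn [X in X * _]mulrC -[leLHS]mulrA ler_wpM2l ?(ltW x00)//.
    by rewrite ler_wpM2l// exprn_ge0.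
  have -> : x0 * ((1 - rho ^+ n.+1) / (1 - rho)) =
      x0 * ((1 - rho ^+ n) / (1 - rho)) + x0 * rho ^+ n.
    by rewrite exprS; field; rewrite gt_eqF.
  lra.
have MB n : (\int[P]_w (f n w)%:E <= B%:E)%E.
  rewrite mean_EFin// lee_fin (le_trans (Mn n))// /B lerD2l ler_wpM2l ?(ltW x00)//.
  by rewrite ler_piMl ?invr_ge0 ?(ltW rho1')// gerBl exprn_ge0// ltW.
have nd_f w m n : (m <= n)%N -> f m w <= f n w.
  move=> mn; rewrite /f le_min !ge_min lexx/=; apply/orP; right.
  by rewrite ler_pM2r// ler_eXn2l// ltr1n.
apply/integrableP; split; first exact/measurable_EFinP.
have lim_f w : limn (fun n => (f n w)%:E) = (`|X w|)%:E.
  apply/cvg_lim => //; apply: cvg_near_cst.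
  exists (Num.trunc (`|X w| / x0)).+1 => // n /= Xn; congr EFin; apply/min_idPl.
  rewrite -ler_pdivrMr// ltW// (lt_le_trans (truncnS_gt _))// -natrX ler_nat.
  by rewrite (leq_trans Xn)// ltnW// ltn_expl.
rewrite (eq_integral (fun w => limn (fun n => (f n w)%:E))); last first.
  by move=> w _; rewrite lim_f.
rewrite monotone_convergence//; last 3 first.
- by move=> n; exact/measurable_EFinP.
- by move=> n w _; rewrite lee_fin.
- by move=> w _ m n mn; rewrite lee_fin nd_f.
apply: (@le_lt_trans _ _ B%:E); last exact: ltry.
apply: lime_le; last by apply: nearW => n; exact: MB.
apply: ereal_nondecreasing_is_cvgn => m n mn; apply: ge0_le_integral => //.
- by move=> w _; rewrite lee_fin.
- exact/measurable_EFinP.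
- exact/measurable_EFinP.
- by move=> w _; rewrite lee_fin nd_f.
Qed.

End finite_mean.

Section weak_law.
Context d (T : measurableType d) (R : realType) (P : probability T R)
  (X : nat -> {RV P >-> R}).
Hypothesis X_indep : mutually_independent X.
Hypothesis X_cdf : forall i x, cdf (X i) x = cdf (X 0%N) x.
Hypothesis X_int : P.-integrable setT (EFin \o X 0%N).

Let m := \int[P]_w `|X 0%N w|.
Let phi (s : R) := \int[P]_w expR (- (s * `|X 0%N w|)).

Let mX i : measurable_fun setT (fun w => `|X i w|).
Proof. exact: measurableT_comp. Qed.

Let cvg_scaled (z : R) : 0 <= z ->
  n%:R * (1 - expR (- (n%:R^-1 * z))) @[n --> \oo] --> z.
Proof.
move=> z0; apply/cvgrPdist_le => e e0; near=> n.
have n0 : 0 < n%:R :> R by rewrite ltr0n; near: n; exists 1%N.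
have nz : z ^+ 2 <= e * n%:R.
  rewrite -ler_pdivrMl//; near: n; exact: nbhs_infty_ger.
pose u := n%:R^-1 * z.
have u0 : 0 <= u by rewrite mulr_ge0// invr_ge0 ltW.
have zE : z = n%:R * u by rewrite /u mulVKf// gt_eqF.
have e1 : 1 - u <= expR (- u) by exact: expR_ge1Dx.
have e2 : expR (- u) * (1 + u) <= 1.
  have := expR_ge1Dx u; have := expRxMexpNx_1 u; have := expR_gt0 (- u).
  by nra.
have e3 : u - u ^+ 2 <= 1 - expR (- u) by nra.
rewrite -/u [in X in `|X - _|]zE -mulrBr ger0_norm; last first.
  by rewrite mulr_ge0 ?(ltW n0)//; lra.
apply: (@le_trans _ _ (n%:R * u ^+ 2)).
  by rewrite ler_pM2l//; lra.
rewrite -(ler_pM2r n0) (le_trans _ nz)// zE.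
by rewrite le_eqVlt; apply/orP; left; apply/eqP; ring.
Unshelve. all: by end_near. Qed.

(** Dominated convergence with majorant s |X|, since n (1 - exp (- z / n)) lies below its limit
    z. *)
Let phi_cvg (s : R) : 0 < s ->
  n%:R * (1 - phi (n%:R^-1 * s)) @[n --> \oo] --> s * m.
Proof.
move=> s0.
pose f n w := (n%:R * (1 - expR (- (n%:R^-1 * (s * `|X 0%N w|)))))%:E.
pose g w := (s * `|X 0%N w|)%:E.
have sX0 w : 0 <= s * `|X 0%N w| by rewrite mulr_ge0// ltW.
have ig : P.-integrable setT g.
  rewrite (_ : g = (fun w => s%:E * (`|X 0%N w|)%:E)%E); last exact/funext.
  have h := integrable_abse X_int.
  by apply: integrableZl => //.
have mf n : measurable_fun setT (f n).
  apply/measurable_EFinP; apply: measurable_funM => //; apply: measurable_funB => //.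
  by apply: measurable_expRN; exact: measurable_funM.
have fg n w : (`|f n w| <= g w)%E.
  rewrite /f /g abse_EFin lee_fin; set z := s * _.
  have nz0 : 0 <= n%:R^-1 * z by rewrite mulr_ge0 ?invr_ge0 ?sX0.
  have h1 : 0 <= 1 - expR (- (n%:R^-1 * z)) by rewrite subr_ge0 expR_le1 oppr_le0.
  rewrite ger0_norm ?mulr_ge0//.
  case: n {mf} nz0 h1 => [|n] nz0 h1; first by rewrite mul0r sX0.
  rewrite -ler_pdivlMl ?ltr0n//.
  set y := _ * z; have := expR_ge1Dx (- y); move: (expR (- y)) => E hE.
  by rewrite lerBlDr addrC -lerBlDr.
have [||_ _ cv] := @dominated_convergence _ _ _ P setT measurableT f g g mf (measurable_int _ ig) _ ig.
- by apply: aeW => w _; apply: cvg_EFin; [exact: nearW|exact: cvg_scaled].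
- by apply: aeW => w n _; exact: fg.
have bph s' : 0 <= s' -> bounded_measurable (fun w => expR (- (s' * `|X 0%N w|))).
  by move=> s'0; apply: bounded_measurable_expRN => // w; rewrite mulr_ge0.
have fE n : (\int[P]_w f n w)%E = (n%:R * (1 - phi (n%:R^-1 * s)))%:E.
  have ns0 : 0 <= n%:R^-1 * s by rewrite mulr_ge0 ?invr_ge0 ?(ltW s0).
  rewrite mean_EFin; last first.
    apply: bounded_measurableM; first exact: bounded_measurable_cst.
    apply: bounded_measurableB; first exact: bounded_measurable_cst.
    by under eq_fun do rewrite mulrA; exact: bph.
  under eq_Rintegral do rewrite mulrA.
  rewrite meanZ ?meanB ?mean_cst//.
  - exact: bounded_measurable_cst.
  - exact: bph.
  - by apply: bounded_measurableB; [exact: bounded_measurable_cst|exact: bph].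
have gE : (\int[P]_w g w)%E = (s * m)%:E.
  rewrite /m EFinM /Rintegral fineK; last first.
    by apply: integrable_fin_num => //; exact: (integrable_abse X_int).
  rewrite -ge0_integralZl//.
  - exact/measurable_EFinP.
  - by rewrite lee_fin ltW.
rewrite gE in cv.
have {}cv : (n%:R * (1 - phi (n%:R^-1 * s)))%:E @[n --> \oo] --> (s * m)%:E.
  by under eq_fun do rewrite -fE.
exact: (fine_cvg cv).
Qed.

Let S n w := n%:R^-1 * \sum_(i < n) `|X i w|.

Let mS n : measurable_fun setT (S n).
Proof. by apply: measurable_funM => //; exact: measurable_sum. Qed.

Let S_ge0 n w : 0 <= S n w.
Proof. by rewrite mulr_ge0 ?invr_ge0// sumr_ge0. Qed.

Let laplace_S (s : R) : 0 < s ->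
  \int[P]_w expR (- (s * S n w)) @[n --> \oo] --> expR (- (s * m)).
Proof.
move=> s0.
have sn0 n : 0 <= n%:R^-1 * s by rewrite mulr_ge0 ?invr_ge0 ?(ltW s0).
have SE n : \int[P]_w expR (- (s * S n w)) = phi (n%:R^-1 * s) ^+ n.
  pose g (y : R) := expR (- (n%:R^-1 * s * `|y|)).
  transitivity (\int[P]_w \prod_(i < n) g (X i w)).
    apply: eq_Rintegral => w _; rewrite -expR_sum; congr expR.
    by rewrite /S mulrA mulr_sumr -sumrN [s * _]mulrC.
  have mg : measurable_fun setT g.
    by apply: measurable_expRN; exact: normr_measurable.
  have g01 y : 0 <= g y <= 1.
    by rewrite expR_ge0 expR_le1 oppr_le0 mulr_ge0.
  have gX i : \int[P]_w g (X i w) = phi (n%:R^-1 * s).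
    by apply: (eq_cdf_mean (X_cdf i) mg) => y; have /andP[] := g01 y.
  rewrite (mean_prod_indep X_indep n mg g01).
  by under eq_bigr do rewrite gX; rewrite prodr_const card_ord.
have phi01 s' : 0 <= s' -> 0 <= phi s' <= 1.
  move=> s'0; rewrite mean_ge0 ?mean_le1//.
  - by apply: bounded_measurable_expRN => // w; rewrite mulr_ge0.
  - by move=> w; rewrite expR_le1 oppr_le0 mulr_ge0.
have c1 : 1 - phi (n%:R^-1 * s) @[n --> \oo] --> (0 : R).
  have h : n%:R^-1 * (n%:R * (1 - phi (n%:R^-1 * s))) @[n --> \oo] --> 0 * (s * m).
    apply: cvgM (phi_cvg s0); apply/gtr0_cvgV0; last exact: cvgr_idn.
    by exists 1%N => // n /= n1; rewrite ltr0n.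
  rewrite mul0r in h; apply: cvg_trans h; apply: near_eq_cvg; exists 1%N => // n /= n1.
  by rewrite mulKf// pnatr_eq0 -lt0n.
have c2 : expR (- (n%:R * (1 - phi (n%:R^-1 * s)))) @[n --> \oo] --> expR (- (s * m)).
  apply: (cvg_comp _ expR (cvgN (phi_cvg s0))); exact: continuous_expR.
under eq_fun do rewrite SE.
apply/cvgrPdist_le => e e0.
have e20 : 0 < e / 2 by rewrite divr_gt0.
have e40 : 0 < e / 4 by rewrite divr_gt0.
move/cvgrPdist_le : c2 => /(_ _ e20); move/cvgrPdist_le : c1 => /(_ _ e40).
apply: filterS2 => n; rewrite sub0r normrN => h1 h2.
have /andP[p0 p1] := phi01 _ (sn0 n).
have := @expRM_natl_dist _ (1 - phi (n%:R^-1 * s)) n.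
rewrite subr_ge0 p1 gerBl p0 subKr => /(_ isT) h3.
rewrite -(subrKA (expR (- (n%:R * (1 - phi (n%:R^-1 * s)))))).
rewrite (le_trans (ler_normD _ _))//.
rewrite ger0_norm ?subr_ge0// in h1.
by rewrite distrC in h3; lra.
Qed.

(** The averages converge to a constant in Laplace transform, hence in law; [laplace_cvg_near] below
    and above [m] bounds the two deviations. Only the first moment enters, as the squares are not
    integrable in the application. *)
Lemma weak_law_abs (h e : R) : 0 < h -> 0 < e -> \forall n \near \oo,
  fine (P [set w | h < `|n%:R^-1 * (\sum_(i < n) `|X i w|) - m|]) <= e.
Proof.
move=> h0 e0.
have m0 : 0 <= m by exact: mean_ge0.
have lap r : 0 <= r -> \int[P]_w expR (- (r * S n w)) @[n --> \oo] -->
    \int[P]_w expR (- (r * (cst m : T -> R) w)).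
  rewrite le_eqVlt => /predU1P[<-|r0]; last first.
    have -> : \int[P]_w expR (- (r * (cst m : T -> R) w)) = expR (- (r * m)).
      by rewrite -[RHS](mean_cst P).
    exact: laplace_S.
  under eq_fun do under eq_Rintegral do rewrite mul0r.
  under eq_Rintegral do rewrite mul0r.
  exact: cvg_cst.
have near1 := @laplace_cvg_near _ \oo _ _ _ _ _ _ P P S (cst m) mS
  (measurable_cst m) S_ge0 (fun=> m0) lap.
have e20 : 0 < e / 2 by rewrite divr_gt0.
have lo := near1 _ (m - h) (m - h / 2) (e / 2) (ltac:(lra)) e20.
have hi := near1 _ m (m + h) (e / 2) (ltac:(lra)) e20.
apply: filterS2 lo hi => n [lo _] [_ hi].
rewrite (_ : [set w | cst m w <= m - h / 2] = set0) ?measure0 in lo; last first.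
  by rewrite -subset0 => w /=; lra.
rewrite (_ : [set w | cst m w <= m] = setT) in hi; last first.
  by apply/seteqP; split=> // w _ /=.
rewrite probability_setT in hi.
have m1 : measurable [set w | S n w <= m - h] by exact: measurable_set_le.
have m2 : measurable [set w | S n w <= m + h] by exact: measurable_set_le.
have m3 : measurable [set w | h < `|S n w - m|].
  apply: measurable_set_gt; apply: measurableT_comp => //; exact: measurable_funB.
apply: (@le_trans _ _ (fine (P ([set w | S n w <= m - h] `|` ~` [set w | S n w <= m + h])))).
  apply: le_fine_prob => //; first by apply: measurableU => //; exact: measurableC.
  move=> w /= hw; have [|c] := leP (S n w) (m - h); first by left.
  right => hS; move: hw; rewrite -/(S n w) ltNge => /negP; apply.
  by rewrite ler_norml; apply/andP; split; lra.
apply: le_trans (fine_prob_setU P m1 (measurableC m2)) _.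
rewrite fine_prob_setC//; move: lo hi => /=; lra.
Qed.

End weak_law.

(** * The stable limit *)

(** On [1, 2] the integrand is at least x^(-1) exp (- 2) >= exp (- 2) / 2. Positivity of this
    constant keeps the limit law in [stable_variable] nondegenerate. *)
Lemma Gamma_gt0 (R : realType) (p : R) : 0 < p < 1 -> 0 < Gamma (1 - p).
Proof.
move=> /andP[p0 p1]; rewrite /Gamma.
have -> : 1 - p - 1 = - p by ring.
have p01 : 0 < p < 1 by rewrite p0.
pose f (x : R) := x `^ (- p) * expR (- x).
have mf D : measurable D -> measurable_fun D f.
  move=> mD; apply: measurable_funM.
    by apply: measurable_funTS; exact: measurable_powR.
  by apply: measurable_funTS; apply: measurableT_comp.
have f0 x : 0 <= f x by rewrite mulr_ge0 ?powR_ge0 ?expR_ge0.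
have ig : lebesgue_measure.-integrable `]0, +oo[ (EFin \o f).
  by apply: eq_integrable (integrable_expRN_powR p01) => // x _; rewrite /f/= mulrC.
pose k : R := 2^-1 * expR (- 2).
have k0 : 0 < k by rewrite mulr_gt0 ?expR_gt0// invr_gt0.
have fk x : 1 <= x <= 2 -> k <= f x.
  move=> /andP[x1 x2]; apply: ler_pM; rewrite ?expR_ge0 ?ler_expR ?lerN2//.
  have x0 : 0 < x by rewrite (lt_le_trans _ x1).
  apply: (@le_trans _ _ (x `^ (-1))).
    by rewrite powR_inv1 ?(ltW x0)// lef_pV2 ?posrE.
  by rewrite ler_powR// lerN2 ltW.
have sub : `[1, 2]%classic `<=` (`]0, +oo[%classic : set R).
  by move=> x /=; rewrite !in_itv/= andbT => /andP[x1 _]; rewrite (lt_le_trans _ x1).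
suff : (k%:E <= \int[lebesgue_measure]_(x in `]0%R, +oo[) (f x)%:E)%E.
  move=> h; apply: lt_le_trans k0 _.
  by rewrite -lee_fin /Rintegral (fineK (integrable_fin_num _ ig)).
apply: (@le_trans _ _ (\int[lebesgue_measure]_(x in `[1%R, 2%R]) (f x)%:E)%E); last first.
  apply: ge0_subset_integral => //; first by apply/measurable_EFinP; exact: mf.
  by move=> x _; rewrite lee_fin.
apply: (@le_trans _ _ (\int[lebesgue_measure]_(x in `[1%R, 2%R]) k%:E)%E).
  rewrite integral_cst; last exact: measurable_itv.
  have mu12 : lebesgue_measure (`[1, 2]%classic : set R) = 1%E.
    rewrite lebesgue_measure_itv/= lte_fin ltr1n -EFinB; congr EFin; ring.
  by rewrite [X in (_ * X)%E](_ : _ = 1%E) ?mule1.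
apply: ge0_le_integral => //.
- by move=> x _; rewrite lee_fin ltW.
- by apply/measurable_EFinP; exact: mf.
Qed.

Section sums_of_squares.
Context d (T : measurableType d) (R : realType) (P : probability T R)
  (X : nat -> {RV P >-> R}).
Hypothesis X_indep : mutually_independent X.
Hypothesis X_cdf : forall i x, cdf (X i) x = cdf (X 0%N) x.

Lemma measurable_sum_squares n : measurable_fun setT (fun w => \sum_(i < n) X i w ^+ 2).
Proof. by apply: measurable_sum => i; exact: measurable_funX. Qed.

Lemma sum_squares_ge0 n w : 0 <= \sum_(i < n) X i w ^+ 2.
Proof. by apply: sumr_ge0 => i _; exact: sqr_ge0. Qed.

Definition square_laplace (s : R) := \int[P]_w expR (- (s * X 0%N w ^+ 2)).

Lemma bounded_measurable_square s : 0 <= s ->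
  bounded_measurable (fun w => expR (- (s * X 0%N w ^+ 2))).
Proof.
move=> s0; apply: bounded_measurable_expRN; last first.
  by move=> w; rewrite mulr_ge0// sqr_ge0.
by apply: measurable_funM => //; exact: measurable_funX.
Qed.

Lemma square_laplace01 s : 0 <= s -> 0 <= square_laplace s <= 1.
Proof.
move=> s0; rewrite mean_ge0 ?mean_le1//; first exact: bounded_measurable_square.
by move=> w; rewrite expR_le1 oppr_le0 mulr_ge0// sqr_ge0.
Qed.

Lemma square_laplace_ni s s' : 0 <= s -> s <= s' ->
  square_laplace s' <= square_laplace s.
Proof.
move=> s0 ss'; apply: le_mean.
- by apply: bounded_measurable_square; exact: le_trans ss'.
- exact: bounded_measurable_square.
- by move=> w; rewrite ler_expR lerN2 ler_wpM2r// sqr_ge0.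
Qed.

Lemma mean_expRN_sum_squares s n : 0 <= s ->
  \int[P]_w expR (- (s * \sum_(i < n) X i w ^+ 2)) = square_laplace s ^+ n.
Proof.
move=> s0; pose g (y : R) := expR (- (s * y ^+ 2)).
transitivity (\int[P]_w \prod_(i < n) g (X i w)).
  by apply: eq_Rintegral => w _; rewrite -expR_sum mulr_sumr -sumrN.
have mg : measurable_fun setT g.
  by apply: measurable_expRN; exact: measurable_funX.
have g01 y : 0 <= g y <= 1.
  by rewrite expR_ge0 expR_le1 oppr_le0 mulr_ge0// sqr_ge0.
have gX i : \int[P]_w g (X i w) = square_laplace s.
  by apply: (eq_cdf_mean (X_cdf i) mg) => y; have /andP[] := g01 y.
rewrite (mean_prod_indep X_indep n mg g01).
by under eq_bigr do rewrite gX; rewrite prodr_const card_ord.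
Qed.

Lemma square_laplaceX_dist s n : 0 <= s ->
  `|square_laplace s ^+ n - expR (- (n%:R * (1 - square_laplace s)))|
    <= 2 * (1 - square_laplace s).
Proof.
move=> s0; have /andP[p0 p1] := square_laplace01 s0.
have := @expRM_natl_dist _ (1 - square_laplace s) n.
by rewrite subr_ge0 p1 gerBl p0 subKr => /(_ isT).
Qed.

Context (a : R -> R) (beta c : R).
Hypotheses (beta_gt0 : 0 < beta) (c_gt0 : 0 < c).
Hypothesis square_tail : forall s, 0 < s ->
  t * (1 - square_laplace (s / a t ^+ 2)) @[t --> +oo] --> c * s `^ beta.

Lemma square_laplace_cvg1 s : 0 < s ->
  1 - square_laplace (s / a t ^+ 2) @[t --> +oo] --> (0 : R).
Proof.
move=> s0.
have h : t^-1 * (t * (1 - square_laplace (s / a t ^+ 2))) @[t --> +oo] --> 0 * (c * s `^ beta).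
  apply: cvgM (square_tail s0); apply/gtr0_cvgV0; last exact: cvg_id.
  exact: nbhs_pinfty_gt.
rewrite mul0r in h; apply: cvg_trans h; apply: near_eq_cvg.
near=> t; rewrite mulKf// gt_eqF//; near: t; exact: nbhs_pinfty_gt.
Unshelve. all: by end_near. Qed.

(* The limit law of the normalised sums of squares. *)
Lemma stable_variable : exists (Q : probability (measurableTypeR R) R)
    (W : {RV Q >-> R}),
  (forall w, 0 <= W w) /\
  forall r, 0 < r -> \int[Q]_w expR (- (r * W w)) = expR (- (c * r `^ beta)).
Proof.
pose V n w := (a n%:R ^+ 2)^-1 * \sum_(i < n) X i w ^+ 2.
have mV n : measurable_fun setT (V n).
  by apply: measurable_funM => //; exact: measurable_sum_squares.
have V0 n w : 0 <= V n w by rewrite mulr_ge0 ?sum_squares_ge0// invr_ge0 sqr_ge0.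
have lap r : 0 < r -> \int[P]_w expR (- (r * V n w)) @[n --> \oo] -->
    expR (- (c * r `^ beta)).
  move=> r0.
  have VE n : \int[P]_w expR (- (r * V n w)) = square_laplace (r / a n%:R ^+ 2) ^+ n.
    have s0 : 0 <= r / a n%:R ^+ 2 by rewrite divr_ge0 ?sqr_ge0 ?(ltW r0).
    rewrite -(mean_expRN_sum_squares n s0).
    by apply: eq_Rintegral => w _; rewrite /V mulrA.
  under eq_fun do rewrite VE.
  have natcvg : (n%:R : R) @[n --> \oo] --> +oo by exact: cvgr_idn.
  have c2 : expR (- (n%:R * (1 - square_laplace (r / a n%:R ^+ 2)))) @[n --> \oo]
      --> expR (- (c * r `^ beta)).
    have h := cvgN (cvg_comp _ _ natcvg (square_tail r0)).
    apply: (cvg_comp (fun n : nat => - (n%:R * (1 - square_laplace (r / a n%:R ^+ 2)))) expR).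
      exact: h.
    exact: continuous_expR.
  have c1 := cvg_comp _ _ natcvg (square_laplace_cvg1 r0).
  apply/cvgrPdist_le => e e0.
  have e20 : 0 < e / 2 by rewrite divr_gt0.
  have e40 : 0 < e / 4 by rewrite divr_gt0.
  move/cvgrPdist_le : c2 => /(_ _ e20); move/cvgrPdist_le : c1 => /(_ _ e40).
  apply: filterS2 => n /=; rewrite sub0r normrN => h1 h2.
  have s0 : 0 <= r / a n%:R ^+ 2 by rewrite divr_ge0 ?sqr_ge0 ?(ltW r0).
  have h3 := square_laplaceX_dist n s0.
  have /andP[_ p1] := square_laplace01 s0.
  rewrite -(subrKA (expR (- (n%:R * (1 - square_laplace (r / a n%:R ^+ 2)))))).
  rewrite (le_trans (ler_normD _ _))//.
  rewrite ger0_norm ?subr_ge0// in h1.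
  by rewrite distrC in h3; lra.
have be0 := beta_gt0; have c0 := c_gt0.
(* Together with [psiy], this is what [laplace_limit] needs: no mass lost at infinity and none
   concentrated at 0. *)
have psi0 : expR (- (c * r `^ beta)) @[r --> 0^'+] --> (1 : R).
  have E : expR (- (c * 0)) = 1 :> R by rewrite mulr0 oppr0 expR0.
  rewrite -[X in _ --> X]E.
  apply: (cvg_comp (fun r : R => - (c * r `^ beta)) expR); last exact: continuous_expR.
  apply: cvgN; apply: cvgM; first exact: cvg_cst.
  apply/cvgrPdist_le => e e0; near=> r.
  have r0 : 0 < r by near: r; exact: nbhs_right_gt.
  rewrite sub0r normrN ger0_norm ?powR_ge0//.
  have -> : e = (e `^ beta^-1) `^ beta.
    by rewrite -powRrM mulVf ?powRr1 ?gt_eqF// ltW.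
  rewrite ge0_ler_powR ?nnegrE ?powR_ge0 ?(ltW r0) ?(ltW be0)//.
  by near: r; apply: nbhs_right_le; exact: powR_gt0.
have psiy : expR (- (c * r `^ beta)) @[r --> +oo] --> (0 : R).
  apply/cvgrPdist_le => e e0; near=> r.
  rewrite sub0r normrN ger0_norm ?expR_ge0//.
  have r0 : 0 < r by near: r; exact: nbhs_pinfty_gt.
  have z0 : 0 < c * r `^ beta by rewrite mulr_gt0 ?powR_gt0.
  rewrite expRN -[leRHS]invrK lef_pV2 ?posrE ?expR_gt0 ?invr_gt0//.
  apply: (@le_trans _ _ (c * r `^ beta)); last first.
    by apply: le_trans (expR_ge1Dx _); rewrite lerDr.
  rewrite -ler_pdivrMl//.
  have -> : c^-1 * e^-1 = ((c^-1 * e^-1) `^ beta^-1) `^ beta.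
    by rewrite -powRrM mulVf ?powRr1 ?gt_eqF// mulr_ge0// invr_ge0 ltW.
  rewrite ge0_ler_powR ?nnegrE ?powR_ge0 ?(ltW r0) ?(ltW be0)//.
have [Q [W [W0 _ WE]]] := laplace_limit mV V0 lap psi0 psiy.
by exists Q, W.
Unshelve. all: by end_near. Qed.

End sums_of_squares.

(** On the product space, U = W Lambda^(1 / beta). Given Lambda = y, its transform at k(y) is exp (-
    c k(y)^beta y), and Fubini averages over y. An argument [k] depending on [L] absorbs powers of
    [L] multiplying [U], and [g] carries the second variable of the joint transform. *)
Lemma subordination d d' (T : measurableType d) (T' : measurableType d')
    (R : realType) (Q : probability T R) (P' : probability T' R)
    (W : {RV Q >-> R}) (Lambda : {RV P' >-> R}) (beta c : R) :
  (forall w, 0 <= W w) -> (forall w, 0 <= Lambda w) -> 0 < beta ->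
  (forall r, 0 < r -> \int[Q]_w expR (- (r * W w)) = expR (- (c * r `^ beta))) ->
  exists (dU : measure_display) (TU : measurableType dU) (PU : probability TU R)
      (U L : {RV PU >-> R}),
    [/\ forall w, 0 <= U w, forall w, 0 <= L w,
        forall B, measurable B -> distribution PU L B = distribution P' Lambda B
      & forall k g : R -> R, measurable_fun setT k -> measurable_fun setT g ->
          (forall y, 0 <= k y) -> (forall y, 0 <= g y <= 1) ->
          \int[PU]_w (expR (- (k (L w) * U w)) * g (L w)) =
          \int[P']_w (expR (- (k (Lambda w) `^ beta * c * Lambda w)) * g (Lambda w))].
Proof.
move=> W0 L0 be0 WE.
pose U0 (z : T * T') := W z.1 * Lambda z.2 `^ beta^-1.
pose L1 (z : T * T') := Lambda z.2.
have mW : measurable_fun setT (fun z : T * T' => W z.1).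
  exact: (measurableT_comp (measurable_funPT W) measurable_fst).
have mL : measurable_fun setT L1.
  exact: (measurableT_comp (measurable_funPT Lambda) measurable_snd).
have mU : measurable_fun setT U0.
  apply: measurable_funM => //.
  exact: (measurableT_comp (measurable_powR beta^-1) mL).
pose PU : probability _ R := (Q \x P')%E.
have U_isM := isMeasurableFun.Build _ _ _ _ U0 mU.
have L_isM := isMeasurableFun.Build _ _ _ _ L1 mL.
pose U : {RV PU >-> R} := HB.pack U0 U_isM.
pose L : {RV PU >-> R} := HB.pack L1 L_isM.
exists _, _, PU, U, L; split.
- by move=> w; rewrite /= mulr_ge0 ?powR_ge0.
- by move=> w; exact: L0.
- move=> B mB; rewrite /distribution /pushforward.
  have -> : L @^-1` B = setT `*` (Lambda @^-1` B).
    by apply/seteqP; split => z /=; [split|case].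
  have mLB : measurable (Lambda @^-1` B) by exact: measurable_funPTI.
  apply: etrans (product_measure1E Q P' measurableT mLB) _.
  by rewrite [X in (X * _)%E](_ : _ = 1%E) ?mul1e//; exact: probability_setT.
move=> k g mk mg k0 g01.
have g0 y : 0 <= g y by have /andP[] := g01 y.
have mF : measurable_fun setT (fun w => expR (- (k (L w) * U w)) * g (L w)).
  apply: measurable_funM; last exact: measurableT_comp.
  apply: measurableT_comp => //; apply: measurableT_comp => //.
  by apply: measurable_funM => //; exact: measurableT_comp.
rewrite /Rintegral; congr fine.
rewrite /PU fubini_tonelli2; first last.
- by move=> z; rewrite lee_fin mulr_ge0 ?expR_ge0.
- exact/measurable_EFinP.
apply: eq_integral => y _; rewrite /fubini_G/=.
have bW r : 0 <= r -> bounded_measurable (fun w => expR (- (r * W w))).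
  move=> r0; apply: bounded_measurable_expRN; last by move=> w; rewrite mulr_ge0.
  exact: measurable_funPT W.
pose s := k (Lambda y) * Lambda y `^ beta^-1.
have s0 : 0 <= s by rewrite mulr_ge0 ?powR_ge0.
transitivity (\int[Q]_w (expR (- (s * W w)) * g (Lambda y))%:E)%E.
  apply: eq_integral => w _; congr (expR (- _) * _)%:E.
  by rewrite /s /U0 /L1/= [W w * _]mulrC mulrA.
rewrite mean_EFin; last first.
  by apply: bounded_measurableM; [exact: bW|exact: bounded_measurable_cst].
under eq_Rintegral do rewrite mulrC.
rewrite meanZ; last exact: bW.
rewrite mulrC; congr (_ * _)%:E.
have sE : s `^ beta = k (Lambda y) `^ beta * Lambda y.
  by rewrite powRM ?powR_ge0// -powRrM mulVf ?powRr1// gt_eqF.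
(* The transform of [W] is given at positive points only; at s = 0 both sides are 1, since 0 to the
   power beta is 0. *)
move: s0; rewrite le_eqVlt => /predU1P[s0|s0]; last first.
  by rewrite WE// sE; congr (expR (- _)); ring.
transitivity (1 : R).
  rewrite -[RHS](mean_cst Q); apply: eq_Rintegral => w _.
  by rewrite -s0 mul0r oppr0 expR0.
by rewrite mulrAC -sE -s0 powR0 ?mul0r ?oppr0 ?expR0// gt_eqF.
Qed.

(** * Random indices *)

Lemma continuous_powR (R : realType) (p x : R) : 0 < x ->
  {for x, continuous (fun y : R => y `^ p)}.
Proof.
move=> x0.
have E : \forall y \near x, expR (p * ln y) = y `^ p.
  near=> y; rewrite /powR gt_eqF//; near: y; exact: lt_nbhsr.
have Ex : expR (p * ln x) = x `^ p by rewrite /powR gt_eqF.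
have h : expR (p * ln y) @[y --> x] --> expR (p * ln x).
  apply: (cvg_comp (fun y : R => p * ln y) expR); last exact: continuous_expR.
  by apply: cvgMr; exact: continuous_ln.
by rewrite Ex in h; apply: cvg_trans h; exact: near_eq_cvg.
Unshelve. all: by end_near. Qed.

Lemma dist_squeeze (R : realFieldType) (e x x1 x2 y y1 y2 : R) :
  x1 <= x <= x2 -> `|x1 - y1| <= e / 2 -> `|x2 - y2| <= e / 2 ->
  `|y - y1| <= e / 2 -> `|y - y2| <= e / 2 -> `|x - y| <= e.
Proof.
rewrite !ler_norml => /andP[? ?] /andP[? ?] /andP[? ?] /andP[? ?] /andP[? ?].
by apply/andP; split; lra.
Qed.

Lemma dist01 (R : realFieldType) (x y : R) :
  0 <= x <= 1 -> 0 <= y <= 1 -> `|x - y| <= 1.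
Proof.
move=> /andP[? ?] /andP[? ?]; rewrite ler_norml.
by apply/andP; split; lra.
Qed.

Section random_sum.
Context d (T : measurableType d) (R : realType) (P : probability T R)
  (X : nat -> {RV P >-> R}) (N : R -> {RV P >-> nat}).
Hypothesis X_N_indep : independent_families [set: nat] [set t : R | 0 <= t] X N.

(** The variable [v] of the inner mean runs over the summands while [w] fixes their number: the sum
    is averaged as if [N t] were a constant. *)
Lemma mean_random_sum (t : R) (f : R -> R) (g : nat -> R -> R) : 0 <= t ->
  measurable_fun setT f -> (forall n, measurable_fun setT (g n)) ->
  (forall n y, 0 <= g n y <= 1) ->
  \int[P]_w g (N t w) (\sum_(i < N t w) f (X i w)) =
  \int[P]_w (\int[P]_v g (N t w) (\sum_(i < N t w) f (X i v))).
Proof.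
move=> t0 mf mg g01.
pose h n w := g n (\sum_(i < n) f (X i w)).
have mh n : measurable_fun setT (h n).
  apply: measurableT_comp; first exact: mg.
  by apply: measurable_sum => i; exact: measurableT_comp.
apply: (@mean_random_index _ _ _ P (N t) h) => //.
  by move=> n w; exact: g01.
move=> n y; apply: X_N_indep; last first.
  by apply: sub_sigma_algebra; exists t, [set n].
pose G := [set A : set T | exists i (B : set R),
  [/\ [set: nat] i, measurable B & A = X i @^-1` B]].
(* The sample space with only the events generated by the [X i]. Measurability of [h n] there says
   that its level sets belong to the sigma-algebra covered by the independence hypothesis. *)
pose TX := g_sigma_algebraType G.
have mX i : measurable_fun [set: TX] (X i : TX -> R).
  by move=> _ B mB; rewrite setTI; apply: sub_sigma_algebra; exists i, B.
have mhX : measurable_fun [set: TX] (h n : TX -> R).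
  apply: measurableT_comp; first exact: mg.
  by apply: measurable_sum => i; exact: measurableT_comp.
exact: (measurable_set_gt y mhX).
Qed.

End random_sum.

Section random_ratio.
Context d (T : measurableType d) (R : realType) (P : probability T R)
  (X : nat -> {RV P >-> R}).
Hypothesis X_indep : mutually_independent X.
Hypothesis X_cdf : forall i x, cdf (X i) x = cdf (X 0%N) x.
Hypothesis X_int : P.-integrable setT (EFin \o X 0%N).
Context (N : R -> {RV P >-> nat}).
Hypothesis X_N_indep : independent_families [set: nat] [set t : R | 0 <= t] X N.
Context (a : R -> R) (beta c : R).
Hypotheses (beta_gt0 : 0 < beta) (c_gt0 : 0 < c).
Hypothesis square_tail : forall s, 0 < s ->
  t * (1 - square_laplace X (s / a t ^+ 2)) @[t --> +oo] --> c * s `^ beta.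
Context d' (T' : measurableType d') (P' : probability T' R)
  (Lambda : {RV P' >-> R}).
Hypothesis N_avg : D_averages_in_time N Lambda.
Hypothesis Lambda_ge0 : forall w, 0 <= Lambda w.

Let phi := square_laplace X.
Let mu := \int[P]_w `|X 0%N w|.
Hypothesis mu_gt0 : 0 < mu.

Let Y t w := (N t w)%:R / t : R.

Let mN t (f : nat -> R) : measurable_fun setT (fun w => f (N t w)).
Proof. exact: (measurableT_comp (f := f)). Qed.

Let mY t : measurable_fun setT (Y t).
Proof. exact: (mN t (fun n => n%:R / t)). Qed.

(* The left-hand side is monotone in [s] and its limit is continuous. *)
Let uniform_square_tail k1 k2 e : 0 < k1 -> 0 < e -> \forall t \near +oo,
  forall s, k1 <= s <= k2 -> `|t * (1 - phi (s / a t ^+ 2)) - c * s `^ beta| <= e.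
Proof.
move=> k10 e0.
have e20 : 0 < e / 2 by rewrite divr_gt0.
have cG : {in `[k1, k2], forall y : R, {for y, continuous (fun s => c * s `^ beta)}}.
  move=> y; rewrite in_itv/= => /andP[k1y _].
  by apply: cvgMr; apply: continuous_powR; exact: lt_le_trans k1y.
have [h h0 hG] := uniform_continuity_on_itv cG e20.
pose del := h / 2.
have del0 : 0 < del by rewrite divr_gt0.
have delh : del < h by rewrite /del; lra.
(* Two more than the last cell index: the cell of [s] uses the nodes j and j + 1, the latter
   possibly beyond [k2]. *)
pose M := (Num.trunc ((k2 - k1) / del)).+2.
pose s_ j := k1 + j%:R * del.
have s_0 j : 0 < s_ j by rewrite ltr_pwDl// mulr_ge0// ltW.
have grid : \forall t \near +oo, forall j : 'I_M,
    `|t * (1 - phi (s_ j / a t ^+ 2)) - c * s_ j `^ beta| <= e / 2.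
  apply: filter_forall => j.
  move: (square_tail (s_0 j)) => /cvgrPdist_le/(_ _ e20).
  by apply: filterS => t; rewrite distrC.
near=> t => s /andP[k1s sk2].
have t0 : 0 <= t by near: t; apply: nbhs_pinfty_ge; exact: num_real.
pose j := Num.trunc ((s - k1) / del).
have sk0 : 0 <= (s - k1) / del by rewrite divr_ge0 ?subr_ge0// ltW.
have /andP[j1 j2] := trunc_itv sk0.
rewrite -/j ler_pdivlMr// in j1; rewrite -/j ltr_pdivrMr// in j2.
have s1 : s_ j <= s by rewrite /s_; lra.
have s2 : s <= s_ j.+1 by rewrite /s_; lra.
have jM : (j.+1 < M)%N.
  rewrite /M ltnS ltnS; apply: le_truncn.
  by rewrite ler_pM2r ?invr_gt0// lerB.
have dG i : s_ i - s <= del -> s - s_ i <= del ->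
    `|c * s `^ beta - c * s_ i `^ beta| <= e / 2.
  move=> d1 d2; apply: hG; first by rewrite k1s.
  apply: le_lt_trans delh; rewrite ler_norml d2 andbT.
  by rewrite lerNl opprB.
have Kn u v : 0 <= u -> u <= v ->
    t * (1 - phi (u / a t ^+ 2)) <= t * (1 - phi (v / a t ^+ 2)).
  move=> u0 uv; apply: (ler_wpM2l t0); apply: lerB; first exact: lexx.
  apply: square_laplace_ni.
    by rewrite divr_ge0// sqr_ge0.
  by rewrite ler_wpM2r// invr_ge0 sqr_ge0.
have gr i : (i < M)%N ->
    `|t * (1 - phi (s_ i / a t ^+ 2)) - c * s_ i `^ beta| <= e / 2.
  by move=> iM; have : forall j : 'I_M,
    `|t * (1 - phi (s_ j / a t ^+ 2)) - c * s_ j `^ beta| <= e / 2;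
    [near: t|move=> /(_ (Ordinal iM))].
have sS : s_ j.+1 = s_ j + del by rewrite /s_ -natr1 mulrDl mul1r addrA.
have d1 : s - s_ j <= del by rewrite lerBlDl -sS.
have d2 : s_ j.+1 - s <= del by rewrite sS lerBlDr [leRHS]addrC lerD2r.
apply: (dist_squeeze _ (gr _ (ltnW jM)) (gr _ jM) (dG j _ d1) (dG j.+1 d2 _)).
- by apply/andP; split; apply: Kn => //; [exact: ltW|exact: (le_trans (ltW k10) k1s)].
- by rewrite (le_trans _ (ltW del0))// subr_le0.
- by rewrite (le_trans _ (ltW del0))// subr_le0.
Unshelve. all: by end_near. Qed.

(** With k(y) = q y^p and N = Y t, the integrand is close to exp (- N (1 - phi)) = exp (- Y t (1 -
    phi (k(Y) / a_t^2))), hence to exp (- Y c k(Y)^beta), uniformly for Y in a compact part of the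
    open half-line. *)
Let cvg_laplace_random (p q : R) : p <= 0 -> 0 < q ->
  \int[P]_w phi (q * Y t w `^ p / a t ^+ 2) ^+ N t w @[t --> +oo] -->
  \int[P']_w expR (- ((q * Lambda w `^ p) `^ beta * c * Lambda w)).
Proof.
move=> p0 q0; have [L0 cdfY] := N_avg; have c0 := c_gt0; have be0 := beta_gt0.
(* The maximum keeps [G] in [0, 1] on the whole line, as [helly_bray] requires, and is invisible at
   [Lambda]. *)
pose G y := expR (- ((q * y `^ p) `^ beta * c * Num.max y 0)).
have -> : \int[P']_w expR (- ((q * Lambda w `^ p) `^ beta * c * Lambda w)) =
    \int[P']_w G (Lambda w).
  by apply: eq_Rintegral => w _; rewrite /G max_l.
have k0 y : 0 <= q * y `^ p by rewrite mulr_ge0 ?powR_ge0// ltW.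
have ka0 t y : 0 <= q * y `^ p / a t ^+ 2 by rewrite divr_ge0 ?sqr_ge0.
apply: (helly_bray mY L0 cdfY).
- apply: measurableT_comp => //; apply: measurableT_comp => //.
  apply: measurable_funM; last exact: measurable_maxr.
  apply: measurable_funM => //.
  apply: (measurableT_comp (measurable_powR beta)).
  by apply: measurable_funM => //; exact: measurable_powR.
- move=> y; rewrite expR_ge0 expR_le1 oppr_le0 !mulr_ge0 ?powR_ge0 ?(ltW c0)//.
  by rewrite le_max lexx orbT.
- move=> y y0; apply: (cvg_comp (fun y : R =>
    - ((q * y `^ p) `^ beta * c * Num.max y 0)) expR); last exact: continuous_expR.
  apply: cvgN; apply: cvgM; last first.
    by apply: continuous_max; [exact: cvg_id|exact: cvg_cst].
  apply: cvgMl; apply: (cvg_comp (fun y : R => q * y `^ p) (fun z => z `^ beta)).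
    by apply: cvgMr; exact: continuous_powR.
  by apply: continuous_powR; rewrite mulr_gt0 ?powR_gt0.
- by move=> t; exact: (mN t (fun n => phi (q * (n%:R / t) `^ p / a t ^+ 2) ^+ n)).
- move=> t w; have /andP[h0 h1] := square_laplace01 X (ka0 t (Y t w)).
  by rewrite exprn_ge0//= exprn_ile1.
move=> u v e u0 uv e0; have v0 := lt_trans u0 uv.
pose k y := q * y `^ p.
have kv0 : 0 < k v by rewrite mulr_gt0 ?powR_gt0.
have ku0 : 0 < k u by rewrite mulr_gt0 ?powR_gt0.
(* Because p <= 0, the random argument stays in [k v, k u]: there [uniform_square_tail] applies, and
   1 - phi is largest at [k u]. *)
have kni y : u <= y <= v -> k v <= k y <= k u.
  move=> /andP[uy yv]; have y0 := lt_le_trans u0 uy.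
  have pw x z : 0 < x -> x <= z -> z `^ p <= x `^ p.
    move=> x0 xz; have z0 := lt_le_trans x0 xz.
    rewrite -ler_ln ?posrE ?powR_gt0// !ln_powR ler_wnM2l// ler_ln//.
  by rewrite /k !ler_pM2l// !pw.
have e40 : 0 < e / 4 by rewrite divr_gt0.
have e2v0 : 0 < e / (2 * v) by rewrite divr_gt0// mulr_gt0.
move: (uniform_square_tail (k u) kv0 e2v0).
move: (square_laplace_cvg1 square_tail ku0) => /cvgrPdist_le/(_ _ e40).
have := nbhs_pinfty_gt (num_real (0 : R)).
apply: filterS3 => t t0; rewrite sub0r normrN => h1 h2 w uYv.
have y0 : 0 < Y t w by case/andP : uYv => uY _; exact: lt_le_trans uY.
have /andP[kvy kyu] := kni _ uYv.
have {}h2 := h2 _ (kni _ uYv).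
set y := Y t w in y0 kvy kyu uYv h2 *; rewrite -/(k y).
have ky0 : 0 <= k y / a t ^+ 2 by exact: ka0.
have kyule : k y / a t ^+ 2 <= k u / a t ^+ 2.
  by rewrite ler_wpM2r// invr_ge0 sqr_ge0.
have h3 := square_laplaceX_dist X (N t w) ky0.
have h4 := square_laplace_ni X ky0 kyule.
have /andP[_ p1] := square_laplace01 X (le_trans ky0 kyule).
have NE : (N t w)%:R = y * t by rewrite /y /Y mulfVK// gt_eqF.
have GE : G y = expR (- (y * (c * k y `^ beta))).
  by rewrite /G max_l ?(ltW y0)//; congr (expR (- _)); rewrite -/(k y); ring.
rewrite -(subrKA (expR (- ((N t w)%:R * (1 - phi (k y / a t ^+ 2)))))).
rewrite (le_trans (ler_normD _ _))//.
(* The exponents differ by y times the error of [uniform_square_tail], and y <= v; hence the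
   precision e / (2 v). *)
have h5 : `|expR (- ((N t w)%:R * (1 - phi (k y / a t ^+ 2)))) - G y| <= e / 2.
  have /andP[_ p2] := square_laplace01 X ky0.
  rewrite GE; apply: le_trans (expR_dist _ _) _.
  - by rewrite mulr_ge0// subr_ge0.
  - by rewrite mulr_ge0 ?(ltW y0)// mulr_ge0 ?powR_ge0// ltW.
  rewrite NE -mulrA -mulrBr normrM (ger0_norm (ltW y0)).
  have yv : y <= v by case/andP : uYv.
  have -> : e / 2 = v * (e / (2 * v)) by field; rewrite gt_eqF.
  by apply: ler_pM => //; exact: ltW.
rewrite ger0_norm ?subr_ge0// in h1.
rewrite [leRHS]splitr lerD// (le_trans h3)//.
have -> : e / 2 = 2 * (e / 4) by field.
apply: ler_wpM2l; first exact: ler0n.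
apply: le_trans h1; apply: lerB; [exact: lexx|exact: h4].
Qed.

Let bad (eta : R) n (y : R) : R := (eta < `|n%:R^-1 * y - mu|)%R%:R.

(** Where N t / t >= u the index is at least u t, so the weak law for deterministic indices bounds
    the conditional probability; [helly_bray] applies with limit function 0. *)
Let cvg_bad eta : 0 < eta ->
  \int[P]_w bad eta (N t w) (\sum_(i < N t w) `|X i w|) @[t --> +oo] --> (0 : R).
Proof.
move=> eta0; have [L0 cdfY] := N_avg.
have mb n : measurable_fun setT (bad eta n).
  have -> : bad eta n = \1_[set y | eta < `|n%:R^-1 * y - mu|].
    by apply/funext => y; rewrite indic_pred.
  apply: measurable_indic; apply: measurable_set_gt; apply: measurableT_comp => //.
  by apply: measurable_funB => //; exact: measurable_funM.
have b01 n y : 0 <= bad eta n y <= 1 by rewrite /bad; case: (_ < _)%R => /=; rewrite ?lexx ?ler01.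
pose pr n := \int[P]_w bad eta n (\sum_(i < n) `|X i w|).
have prE n : pr n = fine (P [set w | eta < `|n%:R^-1 * (\sum_(i < n) `|X i w|) - mu|]).
  rewrite -mean_indic; last first.
    apply: measurable_set_gt; apply: measurableT_comp => //.
    apply: measurable_funB => //; apply: measurable_funM => //.
    by apply: measurable_sum => i; exact: measurableT_comp.
  by apply: eq_Rintegral => w _; rewrite indic_pred.
have bpr n : bounded_measurable (fun w => bad eta n (\sum_(i < n) `|X i w|)).
  apply: bounded_measurable01 => //; apply: measurableT_comp; first exact: mb.
  by apply: measurable_sum => i; exact: measurableT_comp.
have pr01 n : 0 <= pr n <= 1.
  by rewrite mean_ge0 ?mean_le1// => w; have /andP[] := b01 n (\sum_(i < n) `|X i w|).
have h : \int[P]_w pr (N t w) @[t --> +oo] --> \int[P']_w (cst 0 : R -> R) (Lambda w).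
  apply: (helly_bray mY L0 cdfY).
  - exact: measurable_cst.
  - by move=> y; rewrite /= lexx ler01.
  - by move=> y _; exact: cvg_cst.
  - by move=> t; exact: mN.
  - by [].
  move=> u v e u0 uv e0.
  have [n0 _ hn0] := weak_law_abs X_indep X_cdf X_int eta0 e0.
  near=> t => w /andP[uY _].
  have t0 : 0 < t by near: t; apply: nbhs_pinfty_gt; exact: num_real.
  have tn : n0%:R / u <= t by near: t; apply: nbhs_pinfty_ge; exact: num_real.
  have /andP[q0 _] := pr01 (N t w).
  rewrite subr0 ger0_norm// prE; apply: hn0 => /=.
  rewrite -(ler_nat R); rewrite /Y ler_pdivlMr// in uY; apply: le_trans uY.
  by rewrite mulrC -ler_pdivrMr.
have E0 : \int[P']_w (cst 0 : R -> R) (Lambda w) = 0 by exact: mean_cst.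
rewrite E0 in h; apply: cvg_trans h; apply: near_eq_cvg; near=> t.
have t0 : 0 <= t by near: t; apply: nbhs_pinfty_ge; exact: num_real.
by rewrite (mean_random_sum X_N_indep t0 (@normr_measurable R setT) mb b01).
Unshelve. all: by end_near. Qed.

(** A Slutsky argument inside the transform. Replacing the average by [mu] multiplies the exponent
    by mu^2 / S^2, harmless by [expR_scale_dist] unless the event of [bad] occurs; what remains is
    [cvg_laplace_random] with q = r / mu^2. *)
Lemma cvg_random_ratio (p : R) : p <= 0 -> forall r : R, 0 <= r ->
  \int[P]_w expR (- (r * (Y t w `^ p * ((\sum_(i < N t w) X i w ^+ 2) / a t ^+ 2)
      / ((N t w)%:R^-1 * \sum_(i < N t w) `|X i w|) ^+ 2))) @[t --> +oo] -->
  \int[P']_w expR (- ((r / mu ^+ 2 * Lambda w `^ p) `^ beta * c * Lambda w)).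
Proof.
move=> p0 r; rewrite le_eqVlt => /predU1P[<-|r0].
  have -> : \int[P']_w expR (- ((0 / mu ^+ 2 * Lambda w `^ p) `^ beta * c * Lambda w)) = 1.
    rewrite -[RHS](mean_cst P'); apply: eq_Rintegral => w _.
    by rewrite !mul0r powR0 ?gt_eqF// !mul0r oppr0 expR0.
  apply: cvg_near_cst; apply: nearW => t.
  rewrite -[RHS](mean_cst P); apply: eq_Rintegral => w _.
  by rewrite mul0r oppr0 expR0.
have m0 := mu_gt0.
pose q := r / mu ^+ 2.
have q0 : 0 < q by rewrite divr_gt0 ?exprn_gt0.
pose V n w := \sum_(i < n) X i w ^+ 2.
pose S n w := n%:R^-1 * \sum_(i < n) `|X i w|.
pose kk t n := q * (n%:R / t) `^ p / a t ^+ 2.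
pose B t w := expR (- (kk t (N t w) * V (N t w) w)).
pose A t w := expR (- (r * (Y t w `^ p * (V (N t w) w / a t ^+ 2) / S (N t w) w ^+ 2))).
have kk0 t n : 0 <= kk t n by rewrite /kk divr_ge0 ?sqr_ge0// mulr_ge0 ?powR_ge0// ltW.
have mV n : measurable_fun setT (V n) by exact: measurable_sum_squares.
have mS n : measurable_fun setT (S n).
  by apply: measurable_funM => //; apply: measurable_sum => i; exact: measurableT_comp.
have V0 n w : 0 <= V n w by exact: sum_squares_ge0.
have S0 n w : 0 <= S n w by rewrite mulr_ge0 ?invr_ge0// sumr_ge0.
have bB t : bounded_measurable (B t).
  apply: bounded_measurable01; last first.
    by move=> w; rewrite expR_ge0 expR_le1 oppr_le0 mulr_ge0.
  apply: (@measurable_random_index _ _ _ (N t) (fun n w => expR (- (kk t n * V n w)))) => // n.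
  by apply: measurableT_comp => //; apply: measurableT_comp => //; exact: measurable_funM.
have bA t : bounded_measurable (A t).
  apply: bounded_measurable01; last first.
    move=> w; rewrite expR_ge0 expR_le1 oppr_le0 mulr_ge0 ?(ltW r0)//.
    by rewrite divr_ge0 ?sqr_ge0// mulr_ge0 ?powR_ge0// divr_ge0 ?sqr_ge0.
  apply: (@measurable_random_index _ _ _ (N t) (fun n w => expR (- (r *
    ((n%:R / t) `^ p * (V n w / a t ^+ 2) / S n w ^+ 2))))) => // n.
  apply: measurableT_comp => //; apply: measurableT_comp => //.
  apply: measurable_funM => //; apply: measurable_funM.
    by apply: measurable_funM => //; exact: measurable_funM.
  under eq_fun do rewrite -(powR_inv1 (sqr_ge0 _)).
  by apply: (measurableT_comp (measurable_powR (-1))); exact: measurable_funX.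
have BE t : 0 <= t -> \int[P]_w B t w = \int[P]_w phi (q * Y t w `^ p / a t ^+ 2) ^+ N t w.
  move=> t0.
  pose g n (y : R) := expR (- (kk t n * Num.max y 0)).
  have mg n : measurable_fun setT (g n).
    apply: measurableT_comp => //; apply: measurableT_comp => //.
    by apply: measurable_funM => //; exact: measurable_maxr.
  have g01 n y : 0 <= g n y <= 1.
    by rewrite expR_ge0 expR_le1 oppr_le0 mulr_ge0// le_max lexx orbT.
  have msq : measurable_fun setT (fun y : R => y ^+ 2) by exact: measurable_funX.
  transitivity (\int[P]_w g (N t w) (\sum_(i < N t w) X i w ^+ 2)).
    by apply: eq_Rintegral => w _; rewrite /g max_l//; exact: V0.
  rewrite (mean_random_sum X_N_indep t0 msq mg g01); apply: eq_Rintegral => w _.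
  rewrite -(mean_expRN_sum_squares X_indep X_cdf (N t w) (kk0 t (N t w))).
  by apply: eq_Rintegral => v _; rewrite /g max_l//; exact: V0.
have cB := cvg_laplace_random p0 q0.
apply/cvgrPdist_le => e e0.
have e30 : 0 < e / 3 by rewrite divr_gt0.
(* The first bound keeps mu^2 / S^2 above 1/2, as [expR_scale_dist] asks; the second makes its error
   2 del at most e / 3. *)
pose del := Num.min 2^-1 (e / 6).
have del0 : 0 < del by rewrite lt_min invr_gt0 ltr0n divr_gt0.
have del1 : del <= 2^-1 by rewrite ge_min lexx.
have del2 : 2 * del <= e / 3.
  have : del <= e / 6 by rewrite ge_min lexx orbT.
  by move: del {del0 del1} => x; lra.
have [eta eta0 heta] : exists2 eta, 0 < eta &
    forall y, `|y - mu| <= eta -> `|mu ^+ 2 / y ^+ 2 - 1| <= del.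
  have h : mu ^+ 2 / y ^+ 2 @[y --> mu] --> mu ^+ 2 / mu ^+ 2.
    apply: cvgMr; apply: cvgV; first by rewrite expf_neq0// gt_eqF.
    exact: exprn_continuous.
  rewrite divff ?expf_neq0 ?gt_eqF// in h.
  move/cvgrPdist_le : h => /(_ _ del0)/nbhs_ballP[eta /= eta0 h].
  exists (eta / 2); first by rewrite divr_gt0.
  move=> y hy; rewrite distrC; apply: h; rewrite /ball/= distrC.
  by apply: le_lt_trans hy _; rewrite ltr_pdivrMr// ltr_pMr// ltr1n.
move/cvgrPdist_le : cB => /(_ _ e30).
move/cvgrPdist_le : (cvg_bad eta0) => /(_ _ e30).
have := nbhs_pinfty_ge (num_real (0 : R)).
apply: filterS3 => t t0 h1 h2.
rewrite -BE// in h2.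
pose b w := bad eta (N t w) (\sum_(i < N t w) `|X i w|).
have bb : bounded_measurable b.
  apply: bounded_measurable01; last first.
    by move=> w; rewrite /b /bad; case: (_ < _)%R => /=; rewrite ?lexx ?ler01.
  apply: (@measurable_random_index _ _ _ (N t) (fun n w => bad eta n (\sum_(i < n) `|X i w|))) => // n.
  have -> : (fun w => bad eta n (\sum_(i < n) `|X i w|)) = \1_[set w | eta < `|S n w - mu|].
    by apply/funext => w; rewrite indic_pred.
  apply: measurable_indic; apply: measurable_set_gt; apply: measurableT_comp => //.
  exact: measurable_funB.
have b2 : bounded_measurable (fun w => 2 * del + b w).
  by apply: bounded_measurableD => //; exact: bounded_measurable_cst.
have AB w : `|B t w - A t w| <= 2 * del + b w.
  have x0 : 0 <= kk t (N t w) * V (N t w) w by rewrite mulr_ge0.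
  have bw0 : 0 <= b w by rewrite /b /bad ler0n.
  have [hS|hS] := leP `|S (N t w) w - mu| eta.
    have hu := heta _ hS.
    have -> : A t w = expR (- (mu ^+ 2 / S (N t w) w ^+ 2 * (kk t (N t w) * V (N t w) w))).
      rewrite /A -[r in LHS](divfK (x := mu ^+ 2)) ?expf_neq0 ?gt_eqF//.
      rewrite -/q /kk -/(Y t w); congr (expR (- _)); ring.
    apply: le_trans (_ : 2 * del <= _); last by rewrite lerDl.
    rewrite distrC; apply: le_trans (expR_scale_dist _ x0) _; last by rewrite ler_pM2l.
    move: hu; rewrite ler_norml => /andP[hu _].
    by move: (mu ^+ 2 / _) hu del1 => x; move: del {b2 del0 del2 heta} => y; lra.
  apply: (@le_trans _ _ 1).
    apply: dist01.
      by rewrite expR_ge0 expR_le1 oppr_le0.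
    rewrite expR_ge0 expR_le1 oppr_le0 mulr_ge0 ?(ltW r0)//.
    by rewrite divr_ge0 ?sqr_ge0// mulr_ge0 ?powR_ge0// divr_ge0 ?sqr_ge0.
  have -> : b w = 1 by rewrite /b /bad hS.
  by rewrite lerDr mulr_ge0// ltW.
have h3 := mean_dist P (bB t) (bA t) b2 AB.
have h4 : \int[P]_w (2 * del + b w) = 2 * del + \int[P]_w b w.
  by rewrite meanD ?mean_cst//; exact: bounded_measurable_cst.
rewrite h4 in h3; rewrite sub0r normrN in h1.
have h5 : \int[P]_w b w <= e / 3 by apply: le_trans h1; exact: ler_norm.
rewrite -(subrKA (\int[P]_w B t w)).
rewrite (le_trans (ler_normD _ _))//.
have h6 : `|\int[P]_w B t w - \int[P]_w A t w| <= e / 3 + e / 3.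
  by apply: le_trans h3 _; exact: lerD.
have -> : e = e / 3 + (e / 3 + e / 3) by field.
exact: lerD.
Qed.

End random_ratio.

(** * Almost sure equality *)

Section almost_sure.
Context d (T : measurableType d) (R : realType) (P : probability T R).

Lemma eq_prob_ae (A B : set T) : measurable A -> measurable B ->
  {ae P, forall w, A w <-> B w} -> P A = P B.
Proof.
move=> mA mB AB; rewrite -[LHS]fineK ?fin_num_measure// -[RHS]fineK ?fin_num_measure//.
rewrite -!mean_indic//; congr EFin; apply: mean_ae_eq.
- exact: bounded_measurable_indic.
- exact: bounded_measurable_indic.
apply: filterS AB => w AB; rewrite !indicE; congr ((nat_of_bool _)%:R).
by apply/idP/idP; rewrite !inE => /AB.
Qed.

Lemma eq_expectation_ae (f g : T -> R) : measurable_fun setT f ->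
  measurable_fun setT g -> {ae P, forall w, f w = g w} ->
  ('E_P[f] = 'E_P[g])%E.
Proof.
move=> mf mg fg; rewrite unlock; apply: ae_eq_integral => //.
- exact/measurable_EFinP.
- exact/measurable_EFinP.
- by apply: filterS fg => w /= -> _.
Qed.

Lemma expectation_mean (f : T -> R) : bounded_measurable f ->
  ('E_P[f] = (\int[P]_w f w)%R%:E)%E.
Proof. by move=> bf; rewrite unlock mean_EFin. Qed.

Lemma ae_prob1 (A : set T) : measurable A -> P A = 1%E -> {ae P, forall w, A w}.
Proof.
move=> mA A1; exists (~` A); split => //; first exact: measurableC.
by rewrite probability_setC// A1 subee.
Qed.

Lemma mean_abs_gt0 (X : T -> R) : measurable_fun setT X ->
  P.-integrable setT (EFin \o X) -> {ae P, forall w, 0 < X w} ->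
  0 < \int[P]_w `|X w|.
Proof.
move=> mX iX X0; rewrite lt_neqAle; apply/andP; split; last exact: mean_ge0.
apply/eqP => E.
have mEX : measurable_fun setT (EFin \o X) by exact/measurable_EFinP.
have iF : (\int[P]_w `|(EFin \o X) w|)%E \is a fin_num.
  by apply: integrable_fin_num => //; exact: integrable_abse.
have : (\int[P]_w `|(EFin \o X) w|)%E = 0%E.
  by rewrite -(fineK iF); congr EFin; rewrite [RHS]E.
move/(ae_eq_integral_abs P measurableT mEX) => X00.
have : {ae P, forall w : T, False}.
  apply: filterS2 X0 X00 => w X0 /(_ I) /= [X00].
  by rewrite X00 ltxx in X0.
move=> [A [mA A0 sA]].
have : P setT = 0%E by apply: (subset_measure0 _ _ _ A0) => // w _; apply: sA => /=.
by rewrite probability_setT => /eqP; rewrite onee_eq0.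
Qed.

End almost_sure.

Theorem theorem3 (R : realType)
  (d : measure_display) (T : measurableType d) (P : probability T R)
  (X : nat -> {RV P >-> R}) (F : R -> R)
  (X_pos : forall i, {ae P, forall w, 0 < X i w})
  (X_indep : mutually_independent X)
  (X_cdf : forall i x, cdf (X i) x = (F x)%:E)
  (N : R -> {RV P >-> nat})
  (N_counting : counting_process N)
  (X_N_indep : independent_families [set: nat] [set t : R | 0 <= t] X N)
  (alpha : R) (l : R -> R)
  (F_pareto : pareto_type F alpha l)
  (alpha_range :
     1 < alpha < 2 \/ alpha = 1 /\ ('E_P[X 0%N] < +oo)%E)
  (d' : measure_display) (T' : measurableType d') (P' : probability T' R)
  (Lambda : {RV P' >-> R})
  (N_avg : D_averages_in_time N Lambda)
  (a : R -> R)
  (a_infty : a t @[t --> +oo] --> +oo)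
  (a_norm : t * a t `^ (- alpha) * l (a t) @[t --> +oo] --> (1 : R)) :
  let mu1 := fine 'E_P[X 0%N] in
  let c := Gamma (1 - alpha / 2) in
  (* (a) *)
  (exists (dU : measure_display) (TU : measurableType dU)
          (PU : probability TU R) (U : {RV PU >-> R}),
     (forall r : R, 0 <= r ->
        ('E_PU[fun w => expR (- (r * U w))%R] =
         'E_P'[fun w => expR (- (r `^ (alpha / 2) * c * Lambda w))%R])%E) /\
     cvg_in_distribution P PU
       (fun t w => ((N t w)%:R / a t) ^+ 2 * sq_ratio X (N t w) w)
       (fun w => (mu1 ^+ 2)^-1 * U w)) /\
  (* (b); L is a copy of Lambda on the space where U lives. The joint transform
     keeps the factor depending on s, without which it cannot hold. *)
  (exists (dU : measure_display) (TU : measurableType dU)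
          (PU : probability TU R) (U L : {RV PU >-> R}),
     [/\ forall B, measurable B ->
           distribution PU L B = distribution P' Lambda B,
         forall r s : R, 0 < r -> 0 <= s ->
           ('E_PU[fun w => expR (- (r * U w) - s * (mu1 * L w))%R] =
            'E_P'[fun w => expR (- (r `^ (alpha / 2) * c * Lambda w)
                                 - s * (mu1 * Lambda w))%R])%E,
         forall r : R, 0 <= r ->
           ('E_PU[fun w => expR (- (r * U w))%R] =
            'E_P'[fun w => expR (- (r `^ (alpha / 2) * c * Lambda w))%R])%E
       & cvg_in_distribution P PU
           (fun t w => (t / a t) ^+ 2 * sq_ratio X (N t w) w)
           (fun w => (mu1 ^+ 2)^-1 * (U w / L w ^+ 2))]).
Proof.
have alpha12 : 1 <= alpha < 2.
  case: alpha_range => [/andP[/ltW -> ->]//|[-> _]].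
  by rewrite lexx ltr1n.
move=> mu1 c; set beta := alpha / 2.
have al0 : 0 < alpha by case/andP : alpha12 => h _; exact: lt_le_trans h.
have al02 : 0 < alpha < 2 by case/andP : alpha12 => _ ->; rewrite al0.
have be0 : 0 < beta by rewrite divr_gt0.
have c0 : 0 < c.
  apply: Gamma_gt0; rewrite -/beta be0/= ltr_pdivrMr// mul1r.
  by case/andP : alpha12.
have X_cdf0 i x : cdf (X i) x = cdf (X 0%N) x by rewrite !X_cdf.
(* A single null set serves all indices, so sums of any random length agree as well. *)
have absX : {ae P, forall w, forall i, `|X i w| = X i w}.
  apply/ae_foralln => i; apply: filterS (X_pos i) => w X0.
  by rewrite ger0_norm// ltW.
have tailF : (fun x => 1 - fine (P [set w | x < `|X 0%N w|])) = F.
  apply/funext => x.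
  have -> : P [set w | x < `|X 0%N w|] = P [set w | x < X 0%N w].
    apply: eq_prob_ae.
    - by apply: measurable_set_gt; exact: measurableT_comp.
    - exact: measurable_set_gt.
    by apply: filterS absX => w /= ->.
  have -> : [set w | x < X 0%N w] = ~` [set w | X 0%N w <= x].
    by apply/seteqP; split=> w /=; [rewrite ltNge => /negP|move/negP; rewrite -ltNge].
  rewrite fine_prob_setC; last exact: measurable_set_le.
  by rewrite subKr; have := X_cdf 0%N x => /(congr1 fine) /= <-.
have X_tail : pareto_type (fun x => 1 - fine (P [set w | x < `|X 0%N w|])) alpha l.
  by rewrite tailF.
have mX0 : measurable_fun setT (X 0%N) by [].
have absXE : (\int[P]_w (`|X 0%N w|)%:E = 'E_P[X 0%N])%E.
  rewrite unlock; apply: ae_eq_integral => //.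
  - exact/measurable_EFinP/measurableT_comp.
  - exact/measurable_EFinP.
  - by apply: filterS absX => w /= -> _.
(* The two ranges of [alpha] differ here: above 1 the tail forces a finite mean, at 1 it is
   assumed. *)
have X_int : P.-integrable setT (EFin \o X 0%N).
  case: alpha_range => [/andP[a1 _]|[_ EX]].
    exact: (integrable_pareto mX0 X_tail a1).
  apply/integrableP; split; first exact/measurable_EFinP.
  by under eq_integral do rewrite abse_EFin; rewrite absXE.
have muE : \int[P]_w `|X 0%N w| = mu1.
  by rewrite /mu1 -absXE.
have mu0 : 0 < mu1 by rewrite -muE; exact: mean_abs_gt0 (X_pos 0%N).
have square_tail s : 0 < s ->
    t * (1 - square_laplace X (s / a t ^+ 2)) @[t --> +oo] --> c * s `^ beta.
  exact: (laplace_square_tail mX0 X_tail al02 a_infty a_norm).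
have [Q [W [W0 WE]]] := stable_variable X_indep X_cdf0 be0 c0 square_tail.
have [L_gt0 cdfY] := N_avg.
have mLam : measurable_fun setT Lambda by [].
have Lpos : {ae P', forall w, 0 < Lambda w}.
  exact: (ae_prob1 (measurable_set_gt 0 mLam) L_gt0).
(* The positive part of [Lambda] has the same law and is nonnegative everywhere, so its real powers
   and transforms need no exceptional set. *)
pose Lam0f w := Num.max (Lambda w) 0.
have mLam0 : measurable_fun setT Lam0f by exact: measurable_maxr.
pose Lam0_isM := isMeasurableFun.Build _ _ _ _ Lam0f mLam0.
pose Lam0 : {RV P' >-> R} := HB.pack Lam0f Lam0_isM.
have Lam0_ge0 w : 0 <= Lam0 w by rewrite /= le_max lexx orbT.
have Lam0E : {ae P', forall w, Lam0 w = Lambda w}.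
  by apply: filterS Lpos => w /ltW L0; rewrite /= /Lam0f max_l.
have Lam0_prob B : measurable B -> P' (Lam0 @^-1` B) = P' (Lambda @^-1` B).
  move=> mB; apply: eq_prob_ae; try exact: measurable_funPTI.
  by apply: filterS Lam0E => w /= ->.
have Lam0_cdf x : P' [set w | Lam0 w <= x] = P' [set w | Lambda w <= x].
  apply: eq_prob_ae; [exact: measurable_set_le|exact: measurable_set_le|].
  by apply: filterS Lam0E => w /= ->.
have N_avg0 : D_averages_in_time N Lam0.
  split.
    rewrite -L_gt0; congr (P' _); apply/seteqP.
    by split=> w /=; rewrite /Lam0f lt_max ltxx orbF.
  move=> x; rewrite Lam0_cdf => cx; apply: cdfY.
  have E : (fun y => P' [set w | Lam0 w <= y]) = (fun y => P' [set w | Lambda w <= y]).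
    exact/funext.
  by rewrite -E.
have E_Lam0 (f : R -> R) : measurable_fun setT f ->
    ('E_P'[f \o Lambda] = 'E_P'[f \o Lam0])%E.
  move=> mf; apply: eq_expectation_ae; try exact: measurableT_comp.
  by apply: filterS Lam0E => w /= ->.
(* This one pair realises the limits of both parts. *)
have [dU [TU [PU [U [L [U0 L0 distL UL]]]]]] := subordination W0 Lam0_ge0 be0 WE.
have joint r s : 0 <= r -> 0 <= s ->
    ('E_PU[fun w => expR (- (r * U w) - s * (mu1 * L w))%R] =
     'E_P'[fun w => expR (- (r `^ (alpha / 2) * c * Lambda w)
                          - s * (mu1 * Lambda w))%R])%E.
  move=> r0 s0.
  pose g y := expR (- (s * (mu1 * Num.max y 0))).
  have mg : measurable_fun setT g.
    apply: measurableT_comp => //; apply: measurableT_comp => //.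
    by do 2!apply: measurable_funM => //; exact: measurable_maxr.
  have g01 y : 0 <= g y <= 1.
    rewrite expR_ge0 expR_le1 oppr_le0 mulr_ge0// mulr_ge0 ?(ltW mu0)//.
    by rewrite le_max lexx orbT.
  pose f y := expR (- (r `^ beta * c * y) - s * (mu1 * y)).
  have mf : measurable_fun setT f.
    apply: measurableT_comp => //; apply: measurable_funB.
      by apply: measurableT_comp => //; exact: measurable_funM.
    by do 2!apply: measurable_funM => //.
  rewrite -[RHS]/('E_P'[f \o Lambda])%E E_Lam0//.
  rewrite !expectation_mean; first last.
  - apply: bounded_measurable01; last first.
      move=> w; rewrite expR_ge0 expR_le1 -opprD oppr_le0 addr_ge0 ?mulr_ge0 ?(ltW mu0)//.
    apply: measurableT_comp => //; apply: measurable_funB.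
      by apply: measurableT_comp => //; exact: measurable_funM.
    by do 2!apply: measurable_funM => //.
  - apply: bounded_measurable01; first exact: measurableT_comp.
    move=> w; rewrite expR_ge0 expR_le1 -opprD oppr_le0.
    by rewrite addr_ge0// !mulr_ge0 ?powR_ge0 ?(ltW mu0) ?(ltW c0).
  have h := UL (cst r) g (measurable_cst r) mg (fun=> r0) g01.
  congr EFin; rewrite -[RHS]/(\int[P']_w f (Lam0 w)).
  transitivity (\int[PU]_w (expR (- (r * U w)) * g (L w))).
    by apply: eq_Rintegral => w _; rewrite expRD /g max_l.
  rewrite h; apply: eq_Rintegral => w _.
  by rewrite /f expRD /g max_l.
have single r : 0 <= r ->
    ('E_PU[fun w => expR (- (r * U w))%R] =
     'E_P'[fun w => expR (- (r `^ (alpha / 2) * c * Lambda w))%R])%E.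
  move=> r0; have := joint r 0 r0 (lexx _).
  under eq_fun do rewrite mul0r subr0; move=> ->.
  by under eq_fun do rewrite mul0r subr0.
(* Once |X i| = X i, the quotient of V / a_t^2 by (S / n)^2 is (n / a_t)^2 T_n, where V and S are
   the sums of the squares and of the variables. The power p = - 2 then exchanges n for t. *)
pose ratio p t n w := (n%:R / t) `^ p * ((\sum_(i < n) X i w ^+ 2) / a t ^+ 2)
  / (n%:R^-1 * \sum_(i < n) `|X i w|) ^+ 2.
have m_ratio p t n : measurable_fun setT (ratio p t n).
  apply: measurable_funM.
    by apply: measurable_funM => //; apply: measurable_funM => //; exact: measurable_sum_squares.
  under eq_fun do rewrite -(powR_inv1 (sqr_ge0 _)).
  apply: (measurableT_comp (measurable_powR (-1))); apply: measurable_funX.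
  by apply: measurable_funM => //; apply: measurable_sum => i; exact: measurableT_comp.
have mNr p t : measurable_fun setT (fun w => ratio p t (N t w) w).
  by apply: measurable_random_index.
have cvg_ratio p : p <= 0 -> cvg_in_distribution P PU
    (fun t w => ratio p t (N t w) w) (fun w => (mu1 ^+ 2)^-1 * (U w * L w `^ p)).
  move=> p0 x; apply: laplace_cvg_cdf.
  - by move=> t; exact: mNr.
  - apply: measurable_funM => //; apply: measurable_funM => //.
    exact: (measurableT_comp (measurable_powR p)).
  - move=> t w; rewrite divr_ge0 ?sqr_ge0// mulr_ge0 ?powR_ge0//.
    by rewrite divr_ge0 ?sqr_ge0 ?sum_squares_ge0.
  - by move=> w; rewrite mulr_ge0 ?invr_ge0 ?sqr_ge0// mulr_ge0 ?powR_ge0.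
  move=> r r0.
  have -> : \int[PU]_w expR (- (r * ((mu1 ^+ 2)^-1 * (U w * L w `^ p)))) =
      \int[P']_w expR (- ((r / mu1 ^+ 2 * Lam0 w `^ p) `^ beta * c * Lam0 w)).
    (* The factor L^p of the limit is absorbed into the argument of the transform, giving the limit
       of [cvg_random_ratio]. *)
    pose k y := r / mu1 ^+ 2 * y `^ p.
    have mk : measurable_fun setT k.
      by apply: measurable_funM => //; exact: measurable_powR.
    have k0 y : 0 <= k y by rewrite mulr_ge0 ?powR_ge0// divr_ge0 ?sqr_ge0.
    have one01 (y : R) : 0 <= (cst 1 : R -> R) y <= 1 by rewrite lexx ler01.
    have h := UL k (cst 1) mk (measurable_cst _) k0 one01.
    transitivity (\int[PU]_w (expR (- (k (L w) * U w)) * 1)).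
      by apply: eq_Rintegral => w _; rewrite mulr1 /k; congr (expR (- _)); ring.
    by rewrite h; apply: eq_Rintegral => w _; rewrite mulr1.
  rewrite -muE; apply: (cvg_random_ratio X_indep X_cdf0 X_int X_N_indep be0 c0
    square_tail N_avg0 Lam0_ge0 _ p0 r0).
  by rewrite muE.
have m_sq n : measurable_fun setT (sq_ratio X n).
  case: n => [|n]; first exact: measurable_cst.
  rewrite /sq_ratio; apply: measurable_funM; first exact: measurable_sum_squares.
  under eq_fun do rewrite -(powR_inv1 (sqr_ge0 _)).
  apply: (measurableT_comp (measurable_powR (-1))); apply: measurable_funX.
  by apply: measurable_sum => i.
have transfer p (k : R -> nat -> R) : p <= 0 ->
    (forall t n w, 0 < t -> (forall i, `|X i w| = X i w) ->
      k t n * sq_ratio X n w = ratio p t n w) ->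
    cvg_in_distribution P PU (fun t w => k t (N t w) * sq_ratio X (N t w) w)
      (fun w => (mu1 ^+ 2)^-1 * (U w * L w `^ p)).
  move=> p0 kE x cx; apply: cvg_trans (cvg_ratio p p0 x cx); apply: near_eq_cvg.
  near=> t.
  have t0 : 0 < t by near: t; apply: nbhs_pinfty_gt; exact: num_real.
  apply: eq_prob_ae.
  - exact: measurable_set_le.
  - apply: measurable_set_le.
    apply: (@measurable_random_index _ _ _ (N t) (fun n w => k t n * sq_ratio X n w)) => // n.
    exact: measurable_funM.
  by apply: filterS absX => w h; rewrite /= kE.
split.
  exists dU, TU, PU, U; split=> //.
  have := @transfer 0 (fun t n => (n%:R / a t) ^+ 2) (lexx 0).
  have LE : (fun w => (mu1 ^+ 2)^-1 * (U w * L w `^ 0)) = (fun w => (mu1 ^+ 2)^-1 * U w).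
    by apply/funext => w; rewrite powRr0 mulr1.
  rewrite LE.
  apply => t n w t0 Xw.
  rewrite /ratio powRr0 mul1r; under [X in _ / (_ * X) ^+ 2]eq_bigr do rewrite Xw.
  (* At n = 0 both sides vanish: [sq_ratio] by convention, [ratio] through its empty sum of
     squares. *)
  case: n => [|n]; first by rewrite /sq_ratio mulr0 big_ord0 !mul0r.
  rewrite /sq_ratio; move: (\sum_(i < _) X i w ^+ 2) (\sum_(i < _) X i w) => V S.
  rewrite !expr_div_n exprMn exprVn; move: (a t ^+ 2) (S ^+ 2) (n.+1%:R ^+ 2) => A S2 n2.
  by rewrite (invfM n2^-1) invrK; ring.
exists dU, TU, PU, U, L; split=> //.
- by move=> B mB; rewrite distL//; exact: Lam0_prob.
- by move=> r s r0; apply: joint; exact: ltW.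
have := @transfer (- 2) (fun t n => (t / a t) ^+ 2) (ltac:(by rewrite oppr_le0)).
have LE : (fun w => (mu1 ^+ 2)^-1 * (U w * L w `^ (- 2))) =
    (fun w => (mu1 ^+ 2)^-1 * (U w / L w ^+ 2)).
  by apply/funext => w; rewrite powRN powR_mulrn.
rewrite LE.
apply => t n w t0 Xw; rewrite /ratio powRN powR_mulrn ?divr_ge0 ?(ltW t0)//.
under [X in _ / (_ * X) ^+ 2]eq_bigr do rewrite Xw.
case: n => [|n]; first by rewrite /sq_ratio big_ord0 !(mul0r, mulr0).
rewrite /sq_ratio; move: (\sum_(i < _) X i w ^+ 2) (\sum_(i < _) X i w) => V S.
have n0 : n.+1%:R ^+ 2 != 0 :> R by rewrite expf_neq0// pnatr_eq0.
rewrite !expr_div_n exprMn exprVn.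
move: (a t ^+ 2) (S ^+ 2) (t ^+ 2) (n.+1%:R ^+ 2) n0 => A S2 t2 n2 n0.
rewrite (invfM n2) (invfM n2^-1) !invrK.
transitivity (n2^-1 * n2 * (t2 / A * (V / S2))); first by rewrite mulVf// mul1r.
by ring.
Unshelve. all: by end_near. Qed.
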